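(* Let $p$ be a prime with $p\ne 2,5$. Then $T_{p}$ maps $M$ into $M$ and $M(\mathrm{odd})$ into $M(\mathrm{odd})$. In fact, for each $m\ge 0$, $T_{p}$ stabilizes the $\mathbb{Z}/2$-span of the $r^{i}$, $0\le i\le 2m$, as well as the $\mathbb{Z}/2$-span of the $r^{2i}(r^{2}+r)$, $0\le i\le m-1$.
   Context: For even $k\ge 0$, $M_{k}$ is the set of $f\in\mathbb{Z}/2[[x]]$ for which there is a modular form of weight $k$ for $\Gamma_{0}(5)$ whose expansion at infinity (in $x=e^{2\pi i z}$) lies in $\mathbb{Z}[[x]]$ and reduces mod $2$ to $f$; $M=\bigcup_{m}M_{4m}$ and $M(\mathrm{odd})=M\cap x\,\mathbb{Z}/2[[x^{2}]]$. Let $r=\sum_{n>0}(x^{n^{2}}+x^{2n^{2}}+x^{5n^{2}}+x^{10n^{2}})\in\mathbb{Z}/2[[x]]$. For an odd prime $p$, $T_{p}:\mathbb{Z}/2[[x]]\to\mathbb{Z}/2[[x]]$ is $T_{p}(\sum c_{n}x^{n})=\sum c_{pn}x^{n}+\sum c_{n}x^{pn}$. *)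

(* Defs.v *)
From Coquelicot Require Import Coquelicot.
From Stdlib Require Import Reals ZArith Znumtheory List Arith.

(* ---------- Formal power series over Z/2 : coefficient sequences nat -> bool ---------- *)
Definition ps2 := nat -> bool.

Definition ps2_add (f g : ps2) : ps2 := fun n => xorb (f n) (g n).

Definition ps2_mul (f g : ps2) : ps2 :=
  fun n => fold_right xorb false (map (fun i => andb (f i) (g (n - i)%nat)) (seq 0 (S n))).

Definition ps2_one : ps2 := fun n => Nat.eqb n 0.

Fixpoint ps2_pow (f : ps2) (i : nat) : ps2 :=
  match i with O => ps2_one | S j => ps2_mul f (ps2_pow f j) end.

Definition Tp (p : nat) (f : ps2) : ps2 :=
  fun n => xorb (f (p * n)%nat)
                (if Nat.eqb (n mod p) 0 then f (n / p)%nat else false).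

Definition is_j_square (j N : nat) : bool :=
  existsb (fun m => Nat.eqb (j * (m * m)) N) (seq 1 N).

Definition r : ps2 :=
  fun N => xorb (is_j_square 1 N) (xorb (is_j_square 2 N)
             (xorb (is_j_square 5 N) (is_j_square 10 N))).

Fixpoint in_span (gens : list ps2) (f : ps2) : Prop :=
  match gens with
  | nil => forall n, f n = false
  | g :: gs => in_span gs f \/ in_span gs (ps2_add f g)
  end.

Open Scope R_scope.

(* n-th term a_n q^n, q = e^{2 pi i z}, as a complex number *)
Definition qterm (a : nat -> Z) (z : Complex.C) (n : nat) : Complex.C :=
  (IZR (a n) * exp (- 2 * PI * INR n * Im z) * cos (2 * PI * INR n * Re z),
   IZR (a n) * exp (- 2 * PI * INR n * Im z) * sin (2 * PI * INR n * Re z)).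

Definition qconverges (a : nat -> Z) (z : Complex.C) : Prop :=
  ex_series (fun n => Re (qterm a z n)) /\ ex_series (fun n => Im (qterm a z n)).

Definition qval (a : nat -> Z) (z : Complex.C) : Complex.C :=
  (Series (fun n => Re (qterm a z n)), Series (fun n => Im (qterm a z n))).

Definition mobius (al be ga de : Z) (z : Complex.C) : Complex.C :=
  Cdiv (Cplus (Cmult (RtoC (IZR al)) z) (RtoC (IZR be)))
       (Cplus (Cmult (RtoC (IZR ga)) z) (RtoC (IZR de))).

Definition autfac (ga de : Z) (k : nat) (z : Complex.C) : Complex.C :=
  Cpow (Cplus (Cmult (RtoC (IZR ga)) z) (RtoC (IZR de))) k.

(* [a] is the q-expansion at infinity of a modular form of weight k for Gamma_0(5):
   the series converges on the upper half plane (so it defines a holomorphic,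
   1-periodic function f there), f satisfies the weight-k transformation law for
   Gamma_0(5), and f is holomorphic at every cusp: (f|_k gamma)(z) is bounded as
   Im z -> oo for every gamma in SL_2(Z). *)
Definition is_modform_G05 (k : nat) (a : nat -> Z) : Prop :=
  (forall z, 0 < Im z -> qconverges a z) /\
  (forall al be ga de : Z, (al * de - be * ga = 1)%Z -> (5 | ga)%Z ->
     forall z, 0 < Im z ->
       qval a (mobius al be ga de z) = Cmult (autfac ga de k z) (qval a z)) /\
  (forall al be ga de : Z, (al * de - be * ga = 1)%Z ->
     exists B Y : R, forall z, Y < Im z ->
       Cmod (qval a (mobius al be ga de z)) <= B * Cmod (autfac ga de k z)).

Close Scope R_scope.

Definition M_k (k : nat) (f : ps2) : Prop :=
  exists a : nat -> Z, is_modform_G05 k a /\ forall n, f n = Z.odd (a n).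

Definition M (f : ps2) : Prop := exists m : nat, M_k (4 * m) f.

Definition Modd (f : ps2) : Prop := M f /\ forall n, Nat.even n = true -> f n = false.

Definition stabilizes (T : ps2 -> ps2) (gens : list ps2) : Prop :=
  forall f, in_span gens f -> in_span gens (T f).

(* Main.v *)
(* Let P = eta(z)^5 / eta(5z) and Q = eta(5z)^5 / eta(z). Then P^2, PQ and Q^2 have weight 4 on
   Gamma_0(5), the Fricke involution permutes them up to scalars, P does not vanish at infinity, Q
   has a simple zero there, and neither vanishes on the upper half plane. Dividing a form of weight
   4m by Q^(2m) therefore yields a Sturm bound: a form whose coefficients of index at most 2m are
   zero is zero. As P^(2m-j) Q^j = x^j + ..., integral forms of weight 4m are integral combinations
   of the P^(2m-j) Q^j with 0 <= j <= 2m.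

   For E = (5 E_2(5z) - E_2(z)) / 4 the form E^2 is congruent to 1 mod 2, and comparing coefficients
   gives (P + Q)^2 = 1, hence P + Q = 1 mod 2. Comparing the logarithmic derivatives of P and Q then
   gives Q = sum sigma(n) (x^n + x^(5n)) = r and P = 1 + r mod 2, as sigma(n) is odd exactly when n
   is a square or twice a square. So the span of the r^i, i <= 2m, consists of the reductions of the
   integral forms of weight 4m, and the Hecke operator a(n) -> p a(pn) + p^(4m) a(n/p) acts on these
   and reduces to T_p. The operator x d/dx projects this span mod 2 onto its part of odd exponents,
   and maps r^(2i+1) to r^(2i) (r^2 + r).

   The inversion law of eta^2 comes from that of E_2, which follows from the partial fractions of
   the cotangent. *)
Require Import Defs.
From Stdlib Require Import Reals ZArith Znumtheory List Arith Lia Lra.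
From Stdlib Require Import FunctionalExtensionality Permutation.
From Coquelicot Require Import Coquelicot.
From mathcomp Require Import ssreflect.

Set Bullet Behavior "Strict Subproofs".
Open Scope C_scope.

(** * Limits and series of complex numbers *)

(** No complex function theory is used: a function on the upper half plane is only the sum of an
    integral series in e(z) = exp(2 pi i z). Contour integrals are replaced by finite averages over
    the points z + k/N, and the maximum principle by a contraction: a weight 0 function vanishing at
    both cusps is bounded by its majorant at height 17/100, and as the expansions at both cusps lack
    a constant term, that majorant is at most t < 1 times the bound. The square of eta is preferred
    to eta because its inversion law has the factor -i z and no square root. The lattice sum behind
    E_2 does not converge absolutely; it is corrected by a telescoping series before its two orders
    of summation are compared. Modularity under Gamma_0(5) is reduced to periodicity, one elliptic
    element g and the Fricke involution W, so a form is carried as a pair of integral expansions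
    exchanged by W up to scalars. The claim on M is independent of the spans: the Hecke operator is
    applied to an arbitrary modular form. *)

Lemma C_eq (x y : C) : Re x = Re y -> Im x = Im y -> x = y.
Proof. destruct x, y; simpl; congruence. Qed.

Lemma Cmod_minus_sym (x y : C) : Cmod (x - y) = Cmod (y - x).
Proof. rewrite -Cmod_opp. f_equal. ring. Qed.

Lemma Cmod_le_triangle (x y z : C) : (Cmod (x - z) <= Cmod (x - y) + Cmod (y - z))%R.
Proof. replace (x - z) with ((x - y) + (y - z)) by ring. apply Cmod_triangle. Qed.

Lemma Cmod_triangle_inv (x y : C) : (Cmod x - Cmod y <= Cmod (x - y))%R.
Proof.
have := Cmod_triangle (x - y) y.
replace (x - y + y) with x by ring. lra.
Qed.

Lemma im_le_Cmod (z : C) : (Rabs (Im z) <= Cmod z)%R.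
Proof.
have := Rmax_Cmod z. have := Rmax_r (Rabs (fst z)) (Rabs (snd z)). unfold Im. lra.
Qed.

Lemma Cmod_le_Re_Im (z : C) : (Cmod z <= Rabs (Re z) + Rabs (Im z))%R.
Proof.
replace z with (RtoC (Re z) + Ci * RtoC (Im z)) at 1.
- have := Cmod_triangle (RtoC (Re z)) (Ci * RtoC (Im z)).
  rewrite Cmod_mult !Cmod_R Cmod_Ci. lra.
- apply C_eq; simpl; ring.
Qed.

Fixpoint csum (u : nat -> C) (n : nat) : C :=
  match n with O => 0 | S k => csum u k + u k end.

Lemma csum_S (u : nat -> C) (n : nat) : csum u (S n) = csum u n + u n.
Proof. reflexivity. Qed.

Lemma csum_ext (u v : nat -> C) (n : nat) :
  (forall k, (k < n)%nat -> u k = v k) -> csum u n = csum v n.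
Proof.
elim: n => [|n IH] H //=. rewrite IH; last by (intros; apply H; lia). rewrite H //. 
Qed.

Lemma csum_plus (u v : nat -> C) (n : nat) :
  csum (fun k => u k + v k) n = csum u n + csum v n.
Proof. elim: n => [|n IH] /=; [ring | rewrite IH; ring]. Qed.

Lemma csum_scal (c : C) (u : nat -> C) (n : nat) :
  csum (fun k => c * u k) n = c * csum u n.
Proof. elim: n => [|n IH] /=; [ring | rewrite IH; ring]. Qed.

Lemma csum_minus (u v : nat -> C) (n : nat) :
  csum (fun k => u k - v k) n = csum u n - csum v n.
Proof. elim: n => [|n IH] /=; [ring | rewrite IH; ring]. Qed.

Lemma csum_const (c : C) (n : nat) : csum (fun _ => c) n = RtoC (INR n) * c.
Proof.
elim: n => [|n IH] /=; first ring.
change (match n with O => 1%R | S _ => (INR n + 1)%R end) with (INR (S n)).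
rewrite IH S_INR RtoC_plus. ring.
Qed.

Lemma csum_add (u : nat -> C) (n m : nat) :
  csum u (n + m) = csum u n + csum (fun k => u (n + k)%nat) m.
Proof.
elim: m => [|m IH]; first by rewrite Nat.add_0_r /=; ring.
rewrite Nat.add_succ_r /= IH. ring.
Qed.

Lemma csum_rev (u : nat -> C) (n : nat) :
  csum u n = csum (fun k => u (n - 1 - k)%nat) n.
Proof.
elim: n => [|n IH] //.
rewrite (csum_add (fun k => u (S n - 1 - k)%nat) 1 n).
rewrite (csum_ext (fun k => u (S n - 1 - (1 + k))%nat) (fun k => u (n - 1 - k)%nat));
  last by (intros k Hk; f_equal; lia).
rewrite -IH. simpl. rewrite !Nat.sub_0_r. ring.
Qed.

Lemma csum_swap (u : nat -> nat -> C) (n m : nat) :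
  csum (fun i => csum (fun j => u i j) m) n = csum (fun j => csum (fun i => u i j) n) m.
Proof.
elim: n => [|n IH] /=.
- elim: m => [|m IHm] //=. rewrite -IHm. ring.
- rewrite IH csum_plus. reflexivity.
Qed.

Lemma Cmod_csum (u : nat -> C) (b : nat -> R) (n : nat) :
  (forall k, (k < n)%nat -> Cmod (u k) <= b k) ->
  (Cmod (csum u n) <= match n with O => 0 | S k => sum_f_R0 b k end)%R.
Proof.
elim: n => [|n IH] H; first by rewrite /= Cmod_0; lra.
change (csum u (S n)) with (csum u n + u n).
apply: Rle_trans; first apply Cmod_triangle.
have H1 := IH (fun k Hk => H k (Nat.lt_lt_succ_r _ _ Hk)).
have H2 := H n (Nat.lt_succ_diag_r n).
destruct n; simpl in *; lra.
Qed.

(** Convergence is measured by the modulus, so that every limit below is a real sequence squeezed to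
    0. *)
Definition clim (u : nat -> C) (l : C) : Prop :=
  is_lim_seq (fun n => Cmod (u n - l)) 0.

Lemma clim_le (u : nat -> C) (l : C) (b : nat -> R) :
  (forall n, (Cmod (u n - l) <= b n)%R) -> is_lim_seq b 0 -> clim u l.
Proof.
intros H Hb. apply (is_lim_seq_le_le (fun _ => 0%R) _ b); auto.
- intros n; split; [apply Cmod_ge_0 | apply H].
- apply is_lim_seq_const.
Qed.

Lemma clim_le_loc (u : nat -> C) (l : C) (b : nat -> R) (N : nat) :
  (forall n, (N <= n)%nat -> (Cmod (u n - l) <= b n)%R) -> is_lim_seq b 0 -> clim u l.
Proof.
intros H Hb. apply (is_lim_seq_le_le_loc (fun _ => 0%R) _ b); auto.
- exists N. intros n Hn; split; [apply Cmod_ge_0 | by apply H].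
- apply is_lim_seq_const.
Qed.

Lemma clim_ext (u v : nat -> C) (l : C) : (forall n, u n = v n) -> clim u l -> clim v l.
Proof. intros H. apply is_lim_seq_ext. intros n. by rewrite H. Qed.

Lemma clim_const (c : C) : clim (fun _ => c) c.
Proof.
apply (clim_le _ _ (fun _ => 0%R)); last apply is_lim_seq_const.
intros n. replace (c - c) with (RtoC 0) by ring. rewrite Cmod_0. lra.
Qed.

Lemma is_lim_seq_plus_0 (u v : nat -> R) :
  is_lim_seq u 0 -> is_lim_seq v 0 -> is_lim_seq (fun n => (u n + v n)%R) 0.
Proof. intros Hu Hv. replace 0%R with (0 + 0)%R by ring. by apply is_lim_seq_plus'. Qed.

Lemma is_lim_seq_scal_0 (c : R) (u : nat -> R) :
  is_lim_seq u 0 -> is_lim_seq (fun n => (c * u n)%R) 0.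
Proof.
intros Hu. replace 0%R with (c * 0)%R by ring.
exact (is_lim_seq_scal_l u c (Finite 0) Hu).
Qed.

Lemma clim_plus (u v : nat -> C) (l m : C) :
  clim u l -> clim v m -> clim (fun n => u n + v n) (l + m).
Proof.
intros Hu Hv. apply (clim_le _ _ (fun n => Cmod (u n - l) + Cmod (v n - m))%R).
- intros n. replace (u n + v n - (l + m)) with ((u n - l) + (v n - m)) by ring.
  apply Cmod_triangle.
- by apply is_lim_seq_plus_0.
Qed.

Lemma clim_mult (u v : nat -> C) (l m : C) :
  clim u l -> clim v m -> clim (fun n => u n * v n) (l * m).
Proof.
intros Hu Hv.
apply (clim_le _ _ (fun n => (Cmod (u n - l) * Cmod (v n - m) + Cmod m * Cmod (u n - l))
                      + Cmod l * Cmod (v n - m))%R).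
- intros n. replace (u n * v n - l * m)
    with ((u n - l) * (v n - m) + m * (u n - l) + l * (v n - m)) by ring.
  apply: Rle_trans; first apply Cmod_triangle.
  rewrite !Cmod_mult. apply Rplus_le_compat_r.
  apply: Rle_trans; first apply Cmod_triangle. rewrite !Cmod_mult. lra.
- apply is_lim_seq_plus_0; last by apply is_lim_seq_scal_0.
  apply is_lim_seq_plus_0; last by apply is_lim_seq_scal_0.
  replace 0%R with (0 * 0)%R by ring. by apply is_lim_seq_mult'.
Qed.

Lemma clim_scal (c : C) (u : nat -> C) (l : C) :
  clim u l -> clim (fun n => c * u n) (c * l).
Proof. apply clim_mult, clim_const. Qed.

Lemma clim_minus (u v : nat -> C) (l m : C) :
  clim u l -> clim v m -> clim (fun n => u n - v n) (l - m).
Proof.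
intros Hu Hv. apply (clim_ext (fun n => u n + (- (1)) * v n)); first by intros; ring.
replace (l - m) with (l + (- (1)) * m) by ring. by apply clim_plus, clim_scal.
Qed.

Lemma clim_unique (u : nat -> C) (l m : C) : clim u l -> clim u m -> l = m.
Proof.
intros Hl Hm.
have H : is_lim_seq (fun n => Cmod (u n - l) + Cmod (u n - m))%R 0 by apply is_lim_seq_plus_0.
have H' : Rbar_le (Finite (Cmod (l - m))) (Finite 0).
  apply (is_lim_seq_le (fun _ => Cmod (l - m)) (fun n => Cmod (u n - l) + Cmod (u n - m))%R);
  auto; last apply is_lim_seq_const.
  intros n. rewrite (Cmod_minus_sym (u n) l). apply Cmod_le_triangle.
have E : l - m = 0 by apply Cmod_eq_0; simpl in H'; have := Cmod_ge_0 (l - m); lra.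
replace l with (l - m + m) by ring. rewrite E. ring.
Qed.

Lemma clim_subseq (u : nat -> C) (l : C) (f : nat -> nat) :
  (forall n, (f n < f (S n))%nat) -> clim u l -> clim (fun n => u (f n)) l.
Proof.
intros Hf Hu. apply (is_lim_seq_subseq (fun n => Cmod (u n - l)) 0 f); auto.
by apply eventually_subseq.
Qed.

Lemma clim_Cmod_le (u : nat -> C) (l : C) (b : R) (N : nat) :
  clim u l -> (forall n, (N <= n)%nat -> (Cmod (u n) <= b)%R) -> (Cmod l <= b)%R.
Proof.
intros Hu Hb.
have H' : Rbar_le (Finite (Cmod l - b)) (Finite 0).
  apply (is_lim_seq_le_loc (fun _ => (Cmod l - b)%R) (fun n => Cmod (u n - l)) ); auto;
  last apply is_lim_seq_const.
  exists N. intros n Hn. rewrite (Cmod_minus_sym (u n) l).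
  have := Cmod_triangle_inv l (u n). have := Hb n Hn. lra.
simpl in H'. lra.
Qed.

Definition cser (u : nat -> C) (l : C) : Prop := clim (csum u) l.

(** The sum is taken on real and imaginary parts, as in [qval], so that [qval_CS] holds without any
    convergence hypothesis. *)
Definition CS (u : nat -> C) : C := (Series (fun n => Re (u n)), Series (fun n => Im (u n))).

Definition asum (u : nat -> C) : Prop := ex_series (fun n => Cmod (u n)).

Lemma asum_le (u : nat -> C) (b : nat -> R) :
  (forall n, (Cmod (u n) <= b n)%R) -> ex_series b -> asum u.
Proof.
intros H Hb. apply (@ex_series_le R_AbsRing R_CompleteNormedModule) with b; auto.
intros n. change (Rabs (Cmod (u n)) <= b n)%R. rewrite Rabs_pos_eq; auto. apply Cmod_ge_0.
Qed.

Lemma ex_series_Rle (a b : nat -> R) :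
  (forall n, (Rabs (a n) <= b n)%R) -> ex_series b -> ex_series a.
Proof. apply (@ex_series_le R_AbsRing R_CompleteNormedModule). Qed.

Lemma asum_Re (u : nat -> C) : asum u -> ex_series (fun n => Re (u n)).
Proof. apply ex_series_Rle. intros n. apply re_le_Cmod. Qed.

Lemma asum_Im (u : nat -> C) : asum u -> ex_series (fun n => Im (u n)).
Proof. apply ex_series_Rle. intros n. apply im_le_Cmod. Qed.

Lemma csum_Re_Im (u : nat -> C) (n : nat) :
  csum u (S n) = (sum_n (fun k => Re (u k)) n, sum_n (fun k => Im (u k)) n).
Proof.
elim: n => [|n IH].
- rewrite !sum_O. apply C_eq; rewrite /Re /Im /=; ring.
- change (csum u (S (S n))) with (csum u (S n) + u (S n)). rewrite IH !sum_Sn.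
  apply C_eq; reflexivity.
Qed.

Lemma is_lim_seq_C (u : nat -> C) (l : C) :
  is_lim_seq (fun n => Re (u n)) (Re l) -> is_lim_seq (fun n => Im (u n)) (Im l) -> clim u l.
Proof.
intros HR HI.
apply (clim_le _ _ (fun n => Rabs (Re (u n) - Re l) + Rabs (Im (u n) - Im l))%R).
- intros n. apply: Rle_trans; first apply Cmod_le_Re_Im. simpl; unfold Re, Im, Rminus; lra.
- apply is_lim_seq_plus_0; rewrite -(is_lim_seq_abs_0 (fun n => _ - _)%R).
  + replace 0%R with (Re l - Re l)%R by ring. apply is_lim_seq_minus'; auto.
    apply is_lim_seq_const.
  + replace 0%R with (Im l - Im l)%R by ring. apply is_lim_seq_minus'; auto.
    apply is_lim_seq_const.
Qed.

Lemma CS_cser' (u : nat -> C) :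
  ex_series (fun n => Re (u n)) -> ex_series (fun n => Im (u n)) -> cser u (CS u).
Proof.
intros HR HI.
have H : clim (fun n => csum u (S n)) (CS u).
  apply (clim_ext (fun n => (sum_n (fun k => Re (u k)) n, sum_n (fun k => Im (u k)) n))).
    by intros; rewrite csum_Re_Im.
  apply is_lim_seq_C; simpl; [exact (Series_correct _ HR) | exact (Series_correct _ HI)].
by apply (is_lim_seq_incr_1 (fun n => Cmod (csum u n - CS u))).
Qed.

Lemma CS_cser (u : nat -> C) : asum u -> cser u (CS u).
Proof. intros H. by apply CS_cser'; [apply asum_Re | apply asum_Im]. Qed.

Lemma CS_unique (u : nat -> C) (l : C) : asum u -> cser u l -> CS u = l.
Proof. intros H Hl. apply (clim_unique (csum u)); auto. by apply CS_cser. Qed.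

Lemma CS_ext (u v : nat -> C) : (forall n, u n = v n) -> CS u = CS v.
Proof. intros H. rewrite /CS. apply C_eq; apply Series_ext => n; by rewrite H. Qed.

Lemma asum_plus (u v : nat -> C) : asum u -> asum v -> asum (fun n => u n + v n).
Proof.
intros Hu Hv. apply (asum_le _ (fun n => Cmod (u n) + Cmod (v n))%R).
- intros n. apply Cmod_triangle.
- exact (ex_series_plus _ _ Hu Hv).
Qed.

Lemma asum_scal (c : C) (u : nat -> C) : asum u -> asum (fun n => c * u n).
Proof.
intros Hu. apply (asum_le _ (fun n => Cmod c * Cmod (u n))%R).
- intros n. rewrite Cmod_mult. lra.
- exact (ex_series_scal_l (Cmod c) _ Hu).
Qed.

Lemma CS_plus (u v : nat -> C) : asum u -> asum v -> CS (fun n => u n + v n) = CS u + CS v.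
Proof.
intros Hu Hv. apply CS_unique; first by apply asum_plus.
apply (clim_ext (fun n => csum u n + csum v n)); first by intros; rewrite csum_plus.
by apply clim_plus; apply CS_cser.
Qed.

Lemma CS_scal (c : C) (u : nat -> C) : asum u -> CS (fun n => c * u n) = c * CS u.
Proof.
intros Hu. apply CS_unique; first by apply asum_scal.
apply (clim_ext (fun n => c * csum u n)); first by intros; rewrite csum_scal.
by apply clim_scal; apply CS_cser.
Qed.

Lemma sum_f_R0_le_Series (b : nat -> R) (n : nat) :
  (forall k, (0 <= b k)%R) -> ex_series b -> (sum_f_R0 b n <= Series b)%R.
Proof.
intros Hb Hs. rewrite (Series_incr_n b (S n)); auto; last lia. simpl.
have E : Series (fun _ : nat => 0%R) = 0%R.
{ transitivity (0 * Series (fun _ : nat => 0%R))%R; last ring.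
  rewrite -Series_scal_l. apply Series_ext => k. ring. }
have : (0 <= Series (fun k => b (S n + k)%nat))%R.
{ rewrite -[X in (X <= _)%R]E. apply Series_le; last by apply ex_series_incr_n.
  intros k. split; [lra | apply Hb]. }
simpl. lra.
Qed.

Lemma Series_ge_0 (b : nat -> R) :
  (forall k, (0 <= b k)%R) -> ex_series b -> (0 <= Series b)%R.
Proof.
intros Hb Hs. have := sum_f_R0_le_Series b 0 Hb Hs. have := Hb 0%nat. simpl. lra.
Qed.

Lemma Cmod_csum_le_Series (u : nat -> C) (b : nat -> R) (n : nat) :
  (forall k, (Cmod (u k) <= b k)%R) -> ex_series b -> (Cmod (csum u n) <= Series b)%R.
Proof.
intros H Hb.
have Hpos : forall k, (0 <= b k)%R by (intros k; have := H k; have := Cmod_ge_0 (u k); lra).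
apply: Rle_trans; first by apply (Cmod_csum u b).
destruct n; [by apply Series_ge_0 | by apply sum_f_R0_le_Series].
Qed.

Lemma Cmod_CS_le (u : nat -> C) (b : nat -> R) :
  (forall k, (Cmod (u k) <= b k)%R) -> ex_series b -> (Cmod (CS u) <= Series b)%R.
Proof.
intros H Hb. apply (clim_Cmod_le (csum u) _ _ 0).
- apply CS_cser. by apply (asum_le _ b).
- intros n _. by apply Cmod_csum_le_Series.
Qed.

Lemma CS_split (u : nat -> C) (n : nat) :
  asum u -> CS u = csum u n + CS (fun k => u (n + k)%nat).
Proof.
intros H.
have H' : asum (fun k => u (n + k)%nat) by apply (ex_series_incr_n (fun k => Cmod (u k))).
apply CS_unique; auto.
apply (is_lim_seq_incr_n (fun m => Cmod (csum u m - _)) n).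
apply (clim_ext (fun m => csum u n + csum (fun k => u (n + k)%nat) m)).
- intros m. by rewrite -csum_add Nat.add_comm.
- apply clim_plus; first apply clim_const. by apply CS_cser.
Qed.

Lemma Series_tail (b : nat -> R) :
  ex_series b -> is_lim_seq (fun n => Series (fun k => b (n + k)%nat)) 0.
Proof.
intros H. apply is_lim_seq_incr_1.
apply (is_lim_seq_ext (fun n => Series b - sum_n b n)%R).
- intros n. rewrite (Series_incr_n b (S n)) //; last lia.
  rewrite sum_n_Reals /=. ring.
- replace 0%R with (Series b - Series b)%R by ring.
  apply is_lim_seq_minus'; first apply is_lim_seq_const. exact (Series_correct _ H).
Qed.

(** Tannery's theorem. An index n is fixed at which the tail of [b] drops below eps / 3; the first n
    terms converge, and the two tails past n are each below eps / 3. *)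
Lemma clim_dominated (u : nat -> nat -> C) (v : nat -> C) (b : nat -> R) (f : nat -> nat) :
  (forall k, clim (fun j => u j k) (v k)) ->
  (forall j k, (Cmod (u j k) <= b k)%R) -> ex_series b ->
  (forall n, exists J, forall j, (J <= j)%nat -> (n <= f j)%nat) ->
  clim (fun j => csum (u j) (f j)) (CS v).
Proof.
intros Hlim Hdom Hb Hf.
have Hv : forall k, (Cmod (v k) <= b k)%R.
  intros k. apply (clim_Cmod_le _ _ _ 0 (Hlim k)). auto.
have Hfin : forall n, clim (fun j => csum (u j) n) (csum v n).
  elim=> [|n IH] /=; first apply clim_const. by apply clim_plus.
apply is_lim_seq_spec => eps.
have Heps3 : (0 < eps / 3)%R by have := cond_pos eps; lra.
have Ht := Series_tail b Hb. apply is_lim_seq_spec in Ht.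
destruct (Ht (mkposreal _ Heps3)) as [n Hn]. move: (Hn n (Nat.le_refl n)) => {}Hn.
simpl in Hn.
have Hfn := Hfin n. apply is_lim_seq_spec in Hfn.
destruct (Hfn (mkposreal _ Heps3)) as [J1 HJ1]. simpl in HJ1.
destruct (Hf n) as [J2 HJ2].
exists (J1 + J2)%nat => j Hj.
have HJ2' := HJ2 j ltac:(lia). have HJ1' := HJ1 j ltac:(lia).
rewrite Rminus_0_r in HJ1'. rewrite Rminus_0_r in Hn. rewrite Rminus_0_r.
rewrite Rabs_pos_eq in HJ1'; last apply Cmod_ge_0.
rewrite Rabs_pos_eq; last apply Cmod_ge_0.
have Hbn : ex_series (fun k => b (n + k)%nat) by apply ex_series_incr_n.
rewrite (CS_split v n); last by apply (asum_le _ b).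
replace (f j) with (n + (f j - n))%nat by lia. rewrite csum_add.
have T1 : (Cmod (csum (fun k => u j (n + k)%nat) (f j - n)) <= Series (fun k => b (n + k)%nat))%R.
  by apply Cmod_csum_le_Series.
have T2 : (Cmod (CS (fun k => v (n + k)%nat)) <= Series (fun k => b (n + k)%nat))%R.
  by apply Cmod_CS_le.
set X := csum (u j) n in HJ1' *. set Y := csum v n in HJ1' *.
set A := csum _ _ in T1 *. set B := CS _ in T2 *.
replace (X + A - (Y + B)) with ((X - Y) + A + (- B)) by ring.
have := Cmod_triangle (X - Y + A) (- B). have := Cmod_triangle (X - Y) A.
rewrite Cmod_opp. have := Rle_abs (Series (fun k => b (n + k)%nat)). lra.
Qed.

(** * The exponential e(z) = exp(2 pi i z) *)

Definition qexp (z : C) : C :=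
  (exp (- 2 * PI * Im z) * cos (2 * PI * Re z), exp (- 2 * PI * Im z) * sin (2 * PI * Re z))%R.

Lemma qexp_plus (z w : C) : qexp (z + w) = qexp z * qexp w.
Proof.
destruct z as [x y], w as [x' y']. apply C_eq; rewrite /qexp /Re /Im /=;
  rewrite !Rmult_plus_distr_l exp_plus ?cos_plus ?sin_plus; ring.
Qed.

Lemma qexp_0 : qexp 0 = 1.
Proof. apply C_eq; rewrite /qexp /= !Rmult_0_r exp_0 ?cos_0 ?sin_0; ring. Qed.

Lemma qexp_nat (n : nat) (z : C) : qexp (INR n * z) = qexp z ^ n.
Proof.
elim: n => [|n IH]; first by rewrite Cmult_0_l qexp_0.
rewrite Cpow_S -IH -qexp_plus S_INR RtoC_plus. f_equal. ring.
Qed.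

Lemma Cmod_qexp (z : C) : Cmod (qexp z) = exp (- 2 * PI * Im z).
Proof.
rewrite /Cmod /qexp /=.
set e := exp _. set c := cos _. set s := sin _.
have H : (s * s + c * c = 1)%R by apply sin2_cos2.
replace (_ + _)%R with (e * e)%R.
- apply sqrt_square. left. apply exp_pos.
- replace (e * c * (e * c * 1) + e * s * (e * s * 1))%R with (e * e * (s * s + c * c))%R by ring.
  rewrite H. ring.
Qed.

Lemma qexp_neq_0 (z : C) : qexp z <> 0.
Proof. apply Cmod_gt_0. rewrite Cmod_qexp. apply exp_pos. Qed.

Lemma qexp_1 : qexp 1 = 1.
Proof.
apply C_eq; rewrite /qexp /= !Rmult_0_r exp_0 Rmult_1_r ?cos_2PI ?sin_2PI; ring.
Qed.

Lemma qexp_half : qexp (/ 2) = - (1).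
Proof.
have -> : / 2 = RtoC (/ 2) by rewrite RtoC_inv //; lra.
apply C_eq; rewrite /qexp /= !Rmult_0_r exp_0;
replace (2 * PI * / 2)%R with PI by field; rewrite ?cos_PI ?sin_PI; ring.
Qed.

Lemma qexp_opp (z : C) : qexp (- z) = / qexp z.
Proof.
have H : qexp z * qexp (- z) = 1 by rewrite -qexp_plus Cplus_opp_r qexp_0.
have Hn := qexp_neq_0 z. rewrite -(Cmult_1_l (qexp (-z))) -(Cinv_l (qexp z)) //.
by rewrite -Cmult_assoc H Cmult_1_r.
Qed.

Lemma qexp_INR (n : nat) : qexp (INR n) = 1.
Proof. rewrite -(Cmult_1_r (INR n)) qexp_nat qexp_1. apply Cpow_1_l. Qed.

Lemma qexp_IZR (k : Z) : qexp (IZR k) = 1.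
Proof.
destruct (Z_le_gt_dec 0 k).
- replace (IZR k) with (INR (Z.to_nat k)); first apply qexp_INR.
  by rewrite INR_IZR_INZ Z2Nat.id.
- replace (RtoC (IZR k)) with (- RtoC (INR (Z.to_nat (- k)))).
  + rewrite qexp_opp qexp_INR. field.
  + rewrite INR_IZR_INZ Z2Nat.id; last lia. by rewrite -RtoC_opp opp_IZR Ropp_involutive.
Qed.

(** * Power series and their values *)

Fixpoint zsum (f : nat -> Z) (n : nat) : Z :=
  match n with O => 0%Z | S k => (zsum f k + f k)%Z end.

Lemma zsum_ext (f g : nat -> Z) (n : nat) :
  (forall k, (k < n)%nat -> f k = g k) -> zsum f n = zsum g n.
Proof.
elim: n => [|n IH] H //=. rewrite IH; last by (intros; apply H; lia). rewrite H //.
Qed.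

Lemma zsum_plus (f g : nat -> Z) (n : nat) :
  zsum (fun k => f k + g k)%Z n = (zsum f n + zsum g n)%Z.
Proof. elim: n => [|n IH] /=; lia. Qed.

Lemma zsum_scal (c : Z) (f : nat -> Z) (n : nat) :
  zsum (fun k => c * f k)%Z n = (c * zsum f n)%Z.
Proof. elim: n => [|n IH] /=; lia. Qed.

Lemma zsum_0 (f : nat -> Z) (n : nat) : (forall k, (k < n)%nat -> f k = 0%Z) -> zsum f n = 0%Z.
Proof.
elim: n => [|n IH] H //=. rewrite IH; last by (intros; apply H; lia). rewrite H //.
Qed.

Lemma zsum_single (f : nat -> Z) (n i : nat) :
  (i < n)%nat -> (forall k, (k < n)%nat -> k <> i -> f k = 0%Z) -> zsum f n = f i.
Proof.
elim: n => [|n IH] Hi H; first lia. simpl.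
destruct (Nat.eq_dec i n) as [->|Hne].
- rewrite zsum_0 //. intros k Hk. apply H; lia.
- rewrite IH; [|lia|intros; apply H; lia]. rewrite (H n); lia.
Qed.

Lemma zsum_succ_l (f : nat -> Z) (n : nat) :
  zsum f (S n) = (f 0%nat + zsum (fun k => f (S k)) n)%Z.
Proof. elim: n => [|n IH]; first by simpl; lia. change (zsum f (S (S n))) with (zsum f (S n) + f (S n))%Z. rewrite IH /=. lia. Qed.

Lemma zsum_rev (f : nat -> Z) (n : nat) : zsum f n = zsum (fun k => f (n - 1 - k)%nat) n.
Proof.
elim: n => [|n IH] //. rewrite [RHS]zsum_succ_l /= IH.
rewrite (zsum_ext (fun k => f (n - 0 - S k)%nat) (fun k => f (n - 1 - k)%nat));
  last by (intros; f_equal; lia).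
rewrite !Nat.sub_0_r. lia.
Qed.

(** Both sides run over the pairs (j, k) with j + k < n, by diagonals on the left and by rows on the
    right. This gives associativity of the Cauchy product. *)
Lemma zsum_triangle (F : nat -> nat -> Z) (n : nat) :
  zsum (fun i => zsum (fun j => F j (i - j)%nat) (S i)) n =
  zsum (fun j => zsum (fun k => F j k) (n - j)) n.
Proof.
elim: n => [|n IH] //.
change (zsum (fun i => zsum (fun j => F j (i - j)%nat) (S i)) n
  + zsum (fun j => F j (n - j)%nat) (S n) =
  zsum (fun j => zsum (fun k => F j k) (S n - j)) n + zsum (fun k => F n k) (S n - n))%Z.
rewrite IH. replace (S n - n)%nat with 1%nat by lia.
rewrite (zsum_ext (fun j => zsum (fun k => F j k) (S n - j))
  (fun j => zsum (fun k => F j k) (n - j) + F j (n - j)%nat)%Z).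
- rewrite zsum_plus /= Nat.sub_diag. lia.
- intros k Hk. by replace (S n - k)%nat with (S (n - k)) by lia.
Qed.

Definition series : Type := nat -> Z.

Definition s0 : series := fun _ => 0%Z.
Definition s1 : series := fun n => if Nat.eqb n 0 then 1%Z else 0%Z.
Definition sadd (a b : series) : series := fun n => (a n + b n)%Z.
Definition sopp (a : series) : series := fun n => (- a n)%Z.
Definition ssub (a b : series) : series := sadd a (sopp b).
Definition smul (a b : series) : series := fun n => zsum (fun i => a i * b (n - i)%nat)%Z (S n).
Definition sX : series := fun n => if Nat.eqb n 1 then 1%Z else 0%Z.
Definition sC (c : Z) : series := fun n => if Nat.eqb n 0 then c else 0%Z.

Fixpoint spow (a : series) (n : nat) : series :=
  match n with O => s1 | S k => smul a (spow a k) end.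

Lemma smulC (a b : series) : smul a b = smul b a.
Proof.
apply functional_extensionality => n. rewrite /smul zsum_rev.
apply zsum_ext => k Hk. replace (n - (S n - 1 - k))%nat with k by lia.
replace (S n - 1 - k)%nat with (n - k)%nat by lia. apply Z.mul_comm.
Qed.

Lemma smulA (a b c : series) : smul a (smul b c) = smul (smul a b) c.
Proof.
apply functional_extensionality => n. rewrite /smul.
have E := zsum_triangle (fun j k => a j * (b k * c (n - j - k)%nat))%Z (S n).
rewrite (zsum_ext (fun i => zsum (fun i0 => a i0 * b (i - i0)%nat)%Z (S i) * c (n - i)%nat)%Z
 (fun i => zsum (fun j => a j * (b (i - j)%nat * c (n - j - (i - j))%nat))%Z (S i))).
- rewrite E. apply zsum_ext => k Hk. rewrite -zsum_scal.
  by replace (S n - k)%nat with (S (n - k)) by lia.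
- intros k Hk. rewrite Z.mul_comm -zsum_scal. apply zsum_ext => j Hj.
  replace (n - j - (k - j))%nat with (n - k)%nat by lia. lia.
Qed.

Lemma smul1 (a : series) : smul s1 a = a.
Proof.
apply functional_extensionality => n. rewrite /smul (zsum_single _ _ 0); last first.
- by move=> [|k] Hk H.
- lia.
- by rewrite Nat.sub_0_r /s1 Nat.eqb_refl Z.mul_1_l.
Qed.

Lemma smulDl (a b c : series) : smul (sadd a b) c = sadd (smul a c) (smul b c).
Proof.
apply functional_extensionality => n. rewrite /smul /sadd -zsum_plus.
apply zsum_ext => k Hk. lia.
Qed.

Lemma sC_mul (c : Z) (a : series) (n : nat) : smul (sC c) a n = (c * a n)%Z.
Proof.
rewrite /smul (zsum_single _ _ 0); last first.
- by move=> [|k] Hk H.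
- lia.
- by rewrite Nat.sub_0_r /sC.
Qed.

(** By functional extensionality the ring laws hold for Leibniz equality, so identities between
    expansions can be left to [ring]. The constants [sC c] are atoms for it, which explains why
    [sC 2] is rewritten as [sadd s1 s1] in later proofs. *)
Lemma series_ring : ring_theory s0 s1 sadd smul ssub sopp eq.
Proof.
split; intros; try (apply functional_extensionality => n; rewrite /ssub /sadd /sopp /s0; lia).
- apply smul1.
- apply smulC.
- apply smulA.
- apply smulDl.
Qed.

Add Ring series_Ring : series_ring.

Lemma smul_coef0 (a b : series) : smul a b 0%nat = (a 0%nat * b 0%nat)%Z.
Proof. exact (Z.add_0_l _). Qed.

Lemma spow_coef0 (a : series) (n : nat) : a 0%nat = 1%Z -> spow a n 0%nat = 1%Z.
Proof. intros H. elim: n => [|n IH] //=. by rewrite smul_coef0 H IH. Qed.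

Lemma sX_mul (a : series) (n : nat) : smul sX a (S n) = a n.
Proof.
rewrite /smul (zsum_single _ _ 1); last first.
- by move=> [|[|k]] Hk H.
- lia.
- by rewrite /sX /= Nat.sub_0_r; destruct (a n).
Qed.

Lemma spow_add (a : series) (n m : nat) : spow a (n + m) = smul (spow a n) (spow a m).
Proof. elim: n => [|n IH] /=; [ring | rewrite IH; ring]. Qed.

Lemma spow_mul_l (a b : series) (n : nat) : spow (smul a b) n = smul (spow a n) (spow b n).
Proof. elim: n => [|n IH] /=; [ring | rewrite IH; ring]. Qed.

Lemma spow_s1 (n : nat) : spow s1 n = s1.
Proof. elim: n => [|n IH] //=. rewrite IH. ring. Qed.

Lemma spow_mul (a : series) (n m : nat) : spow a (n * m) = spow (spow a n) m.
Proof.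
elim: m => [|m IH] /=; first by rewrite Nat.mul_0_r.
by rewrite Nat.mul_succ_r Nat.add_comm spow_add IH.
Qed.

(** * Series converging in the open unit disc, and their values *)

Definition conv (a : series) : Prop :=
  forall rho, (0 <= rho < 1)%R -> ex_series (fun n => Rabs (IZR (a n)) * rho ^ n)%R.

Definition qpow (a : series) (z : C) (n : nat) : C := RtoC (IZR (a n)) * qexp z ^ n.

Lemma qterm_qpow (a : series) (z : C) (n : nat) : qterm a z n = qpow a z n.
Proof.
rewrite /qpow -qexp_nat. rewrite /qterm /qexp. destruct z as [x y].
apply C_eq; rewrite /Re /Im /=.
- replace (-2 * PI * (INR n * y + 0 * x))%R with (- 2 * PI * INR n * y)%R by ring.
  replace (2 * PI * (INR n * x - 0 * y))%R with (2 * PI * INR n * x)%R by ring. ring.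
- replace (-2 * PI * (INR n * y + 0 * x))%R with (- 2 * PI * INR n * y)%R by ring.
  replace (2 * PI * (INR n * x - 0 * y))%R with (2 * PI * INR n * x)%R by ring. ring.
Qed.

Lemma qval_CS (a : series) (z : C) : qval a z = CS (qpow a z).
Proof. rewrite /qval /CS. apply C_eq; apply Series_ext => n; by rewrite qterm_qpow. Qed.

Lemma Cmod_qpow (a : series) (z : C) (n : nat) :
  Cmod (qpow a z n) = (Rabs (IZR (a n)) * exp (- 2 * PI * Im z) ^ n)%R.
Proof. by rewrite /qpow Cmod_mult Cmod_R Cmod_pow Cmod_qexp. Qed.

Lemma exp_im_range (z : C) : (0 < Im z)%R -> (0 <= exp (- 2 * PI * Im z) < 1)%R.
Proof.
intros H. split; first by left; apply exp_pos.
rewrite -exp_0. apply exp_increasing. have := PI_RGT_0. nra.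
Qed.

Lemma conv_asum (a : series) (z : C) : conv a -> (0 < Im z)%R -> asum (qpow a z).
Proof.
intros Ha Hz. apply (ex_series_ext (fun n => Rabs (IZR (a n)) * exp (- 2 * PI * Im z) ^ n)%R).
- intros n. by rewrite Cmod_qpow.
- by apply Ha, exp_im_range.
Qed.

Lemma conv_qconverges (a : series) (z : C) : conv a -> (0 < Im z)%R -> qconverges a z.
Proof.
intros Ha Hz. have H := conv_asum a z Ha Hz.
split; [apply (ex_series_ext (fun n => Re (qpow a z n))) | apply (ex_series_ext (fun n => Im (qpow a z n)))];
try (intros; by rewrite qterm_qpow).
- by apply asum_Re.
- by apply asum_Im.
Qed.

Lemma conv_le (a b : series) : (forall n, (Z.abs (a n) <= b n)%Z) -> conv b -> conv a.
Proof.
intros H Hb rho Hr. apply (ex_series_Rle _ (fun n => Rabs (IZR (b n)) * rho ^ n)%R); last by apply Hb.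
intros n. rewrite Rabs_mult Rabs_Rabsolu (Rabs_pos_eq (rho ^ n)); last by apply pow_le; lra.
apply Rmult_le_compat_r; first by apply pow_le; lra.
rewrite -!abs_IZR. apply IZR_le. have := H n. lia.
Qed.

(** Abel's lemma: boundedness at the larger radius (1 + rho) / 2 gives a geometric majorant of ratio
    2 rho / (1 + rho) at radius rho. *)
Lemma conv_bounded (a : series) :
  (forall rho, (0 < rho < 1)%R -> exists K, forall n, (Rabs (IZR (a n)) * rho ^ n <= K)%R) -> conv a.
Proof.
intros H rho Hr.
destruct (H ((1 + rho) / 2)%R ltac:(lra)) as [K HK].
set t := (rho / ((1 + rho) / 2))%R.
have Ht : (0 <= t < 1)%R.
{ rewrite /t. split; first by apply Rmult_le_pos; [lra | left; apply Rinv_0_lt_compat; lra].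
  apply (Rmult_lt_reg_r ((1 + rho) / 2)); first lra. field_simplify; lra. }
apply (ex_series_Rle _ (fun n => K * t ^ n)%R).
- intros n. rewrite Rabs_mult Rabs_Rabsolu (Rabs_pos_eq (rho ^ n)); last by apply pow_le; lra.
  replace (rho ^ n)%R with (((1 + rho) / 2) ^ n * t ^ n)%R.
  + rewrite -Rmult_assoc. apply Rmult_le_compat_r; first by apply pow_le; lra. apply HK.
  + rewrite -Rpow_mult_distr. f_equal. rewrite /t. field. lra.
- apply: ex_series_scal_l. apply ex_series_geom. rewrite Rabs_pos_eq; lra.
Qed.

Lemma is_lim_seq_bounded (u : nat -> R) (l : R) :
  is_lim_seq u l -> exists K, forall n, (Rabs (u n) <= K)%R.
Proof.
intros Hu. apply is_lim_seq_spec in Hu. destruct (Hu (mkposreal 1 Rlt_0_1)) as [N HN].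
have Hfin : forall N, exists K, forall n, (n < N)%nat -> (Rabs (u n) <= K)%R.
{ elim=> [|m [K HK]]; first by (exists 0%R; intros; lia).
  exists (Rmax K (Rabs (u m))). intros n Hn.
  destruct (Nat.eq_dec n m) as [->|]; first apply Rmax_r.
  apply: Rle_trans; [apply HK; lia | apply Rmax_l]. }
destruct (Hfin N) as [K HK]. exists (Rmax K (Rabs l + 1)). intros n.
destruct (Nat.lt_ge_cases n N) as [H|H].
- apply: Rle_trans; [by apply HK | apply Rmax_l].
- apply: Rle_trans; last apply Rmax_r. have H1 := HN n H. simpl in H1.
  have := Rabs_triang_inv (u n) l. lra.
Qed.

(** On the imaginary axis the terms are real. At z = i y with exp(-2 pi y) = rho, convergence makes
    them tend to 0, so |a_n| rho^n is bounded, and Abel's lemma upgrades this to absolute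
    convergence. *)
Lemma qconverges_conv (a : series) : (forall z, (0 < Im z)%R -> qconverges a z) -> conv a.
Proof.
intros H. apply conv_bounded => rho Hr.
set y := (- ln rho / (2 * PI))%R.
have Hpi := PI_RGT_0.
have Hln : (ln rho < 0)%R by rewrite -ln_1; apply ln_increasing; lra.
have Hy : (0 < y)%R by rewrite /y; apply Rdiv_lt_0_compat; lra.
destruct (H (0, y) Hy) as [HR _].
have Hlim := ex_series_lim_0 _ HR.
have Hb := is_lim_seq_bounded _ _ Hlim.
destruct Hb as [K HK]. exists K. intros n. have := HK n.
rewrite /qterm /Re /Im /= Rmult_0_r cos_0 Rmult_1_r Rabs_mult.
rewrite (Rabs_pos_eq (exp _)); last by left; apply exp_pos.
have -> : (-2 * PI * INR n * y)%R = (INR n * ln rho)%R by rewrite /y; field; lra.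
have -> : exp (INR n * ln rho) = (rho ^ n)%R.
{ rewrite -(Rpower_pow n rho); last lra. reflexivity. }
auto.
Qed.

Lemma conv_sadd (a b : series) : conv a -> conv b -> conv (sadd a b).
Proof.
intros Ha Hb rho Hr.
apply (ex_series_Rle _ (fun n => (Rabs (IZR (a n)) * rho ^ n) + Rabs (IZR (b n)) * rho ^ n)%R).
- intros n. rewrite Rabs_mult Rabs_Rabsolu (Rabs_pos_eq (rho ^ n)); last by apply pow_le; lra.
  rewrite -Rmult_plus_distr_r. apply Rmult_le_compat_r; first by apply pow_le; lra.
  rewrite /sadd plus_IZR. apply Rabs_triang.
- apply: ex_series_plus; auto.
Qed.

Lemma conv_scal (c : Z) (a b : series) :
  (forall n, (Z.abs (b n) <= Z.abs (c * a n))%Z) -> conv a -> conv b.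
Proof.
intros H Ha rho Hr.
apply (ex_series_Rle _ (fun n => Rabs (IZR c) * (Rabs (IZR (a n)) * rho ^ n))%R).
- intros n. rewrite Rabs_mult Rabs_Rabsolu (Rabs_pos_eq (rho ^ n)); last by apply pow_le; lra.
  rewrite -Rmult_assoc. apply Rmult_le_compat_r; first by apply pow_le; lra.
  rewrite -Rabs_mult -mult_IZR -!abs_IZR. apply IZR_le. apply H.
- apply: ex_series_scal_l. auto.
Qed.

Lemma conv_sopp (a : series) : conv a -> conv (sopp a).
Proof. apply (conv_scal 1). intros n. rewrite /sopp. lia. Qed.

Lemma conv_ssub (a b : series) : conv a -> conv b -> conv (ssub a b).
Proof. intros Ha Hb. apply conv_sadd; auto. by apply conv_sopp. Qed.

Lemma conv_sC (c : Z) : conv (sC c).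
Proof.
apply conv_bounded => rho Hr. exists (Rabs (IZR c)) => n. rewrite /sC.
have := Rabs_pos (IZR c). destruct n; simpl; first lra.
rewrite Rabs_R0. intros. have := Rabs_pos (IZR c). lra.
Qed.

Lemma conv_s1 : conv s1.
Proof. exact (conv_sC 1). Qed.

Lemma conv_sX : conv sX.
Proof.
apply conv_bounded => rho Hr. exists 1%R => n. rewrite /sX.
destruct n as [|[|n]]; simpl; rewrite ?Rabs_R0 ?Rabs_R1; lra.
Qed.

Lemma is_series_sum_f (u v : nat -> R) :
  ex_series (fun n => Rabs (u n)) -> ex_series (fun n => Rabs (v n)) ->
  is_series (fun n => sum_f_R0 (fun k => u k * v (n - k)%nat)%R n) (Series u * Series v)%R.
Proof.
intros Hu Hv. apply is_series_mult; auto; apply Series_correct; by apply ex_series_Rabs.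
Qed.

Lemma csum_sum_f (u : nat -> C) (n : nat) :
  csum u (S n) = (sum_f_R0 (fun k => Re (u k)) n, sum_f_R0 (fun k => Im (u k)) n).
Proof. by rewrite csum_Re_Im !sum_n_Reals. Qed.

(** Mertens' theorem is applied to the four real products of real and imaginary parts, each of which
    inherits absolute convergence. *)
Lemma CS_mult (u v : nat -> C) : asum u -> asum v ->
  CS (fun n => csum (fun k => u k * v (n - k)%nat) (S n)) = CS u * CS v.
Proof.
intros Hu Hv.
have HRu : ex_series (fun n => Rabs (Re (u n))).
{ apply: ex_series_Rle Hu. intros n. rewrite Rabs_Rabsolu. apply re_le_Cmod. }
have HIu : ex_series (fun n => Rabs (Im (u n))).
{ apply: ex_series_Rle Hu. intros n. rewrite Rabs_Rabsolu. apply im_le_Cmod. }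
have HRv : ex_series (fun n => Rabs (Re (v n))).
{ apply: ex_series_Rle Hv. intros n. rewrite Rabs_Rabsolu. apply re_le_Cmod. }
have HIv : ex_series (fun n => Rabs (Im (v n))).
{ apply: ex_series_Rle Hv. intros n. rewrite Rabs_Rabsolu. apply im_le_Cmod. }
apply C_eq.
- change (Series (fun n => Re (csum (fun k => u k * v (n - k)%nat)%C (S n))) =
   (Series (fun n => Re (u n)) * Series (fun n => Re (v n)) -
    Series (fun n => Im (u n)) * Series (fun n => Im (v n))))%R.
  apply is_series_unique.
  apply: (is_series_ext _ _ _ _ (is_series_minus _ _ _ _ (is_series_sum_f _ _ HRu HRv) (is_series_sum_f _ _ HIu HIv))).
  intros n. rewrite csum_sum_f /=.
  change (sum_f_R0 (fun k => Re (u k) * Re (v (n - k)%nat))%R n -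
    sum_f_R0 (fun k => Im (u k) * Im (v (n - k)%nat))%R n =
    sum_f_R0 (fun k => Re (u k * v (n - k)%nat)%C) n)%R.
  rewrite -minus_sum. apply sum_eq => i Hi. reflexivity.
- change (Series (fun n => Im (csum (fun k => u k * v (n - k)%nat)%C (S n))) =
   (Series (fun n => Re (u n)) * Series (fun n => Im (v n)) +
    Series (fun n => Im (u n)) * Series (fun n => Re (v n))))%R.
  apply is_series_unique.
  apply: (is_series_ext _ _ _ _ (is_series_plus _ _ _ _ (is_series_sum_f _ _ HRu HIv) (is_series_sum_f _ _ HIu HRv))).
  intros n. rewrite csum_sum_f /=.
  change (sum_f_R0 (fun k => Re (u k) * Im (v (n - k)%nat))%R n +
    sum_f_R0 (fun k => Im (u k) * Re (v (n - k)%nat))%R n =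
    sum_f_R0 (fun k => Im (u k * v (n - k)%nat)%C) n)%R.
  rewrite -plus_sum. apply sum_eq => i Hi. rewrite /Re /Im /=. ring.
Qed.

Lemma IZR_zsum (f : nat -> Z) (n : nat) :
  RtoC (IZR (zsum f n)) = csum (fun k => RtoC (IZR (f k))) n.
Proof. elim: n => [|n IH] //=. by rewrite plus_IZR RtoC_plus IH. Qed.

Lemma qpow_smul (a b : series) (z : C) (n : nat) :
  qpow (smul a b) z n = csum (fun k => qpow a z k * qpow b z (n - k)) (S n).
Proof.
rewrite /qpow /smul IZR_zsum Cmult_comm -csum_scal. apply csum_ext => k Hk.
rewrite mult_IZR RtoC_mult. replace (qexp z ^ n) with (qexp z ^ k * qexp z ^ (n - k)).
- ring.
- rewrite -Cpow_add_r. f_equal. lia.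
Qed.

Lemma conv_smul (a b : series) : conv a -> conv b -> conv (smul a b).
Proof.
intros Ha Hb rho Hr.
have H1 := Ha rho Hr. have H2 := Hb rho Hr.
have P : forall (c : series) n, Rabs (Rabs (IZR (c n)) * rho ^ n)%R = (Rabs (IZR (c n)) * rho ^ n)%R.
{ intros c n. apply Rabs_pos_eq, Rmult_le_pos; [apply Rabs_pos | apply pow_le; lra]. }
have H := is_series_sum_f (fun n => Rabs (IZR (a n)) * rho ^ n)%R (fun n => Rabs (IZR (b n)) * rho ^ n)%R
  (ex_series_ext _ _ (fun n => eq_sym (P a n)) H1) (ex_series_ext _ _ (fun n => eq_sym (P b n)) H2).
apply: (ex_series_Rle _ _ _ (ex_intro _ _ H)) => n. rewrite P /smul.
have : forall m, (m <= n)%nat -> (Rabs (IZR (zsum (fun i => a i * b (n - i)%nat)%Z (S m))) * rho ^ n <=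
  sum_f_R0 (fun k => Rabs (IZR (a k)) * rho ^ k * (Rabs (IZR (b (n - k)%nat)) * rho ^ (n - k)))%R m)%R.
{ have E : forall k, (k <= n)%nat -> (Rabs (IZR (a k * b (n - k)%nat)) * rho ^ n =
    Rabs (IZR (a k)) * rho ^ k * (Rabs (IZR (b (n - k)%nat)) * rho ^ (n - k)))%R.
  { intros k Hk. rewrite mult_IZR Rabs_mult. replace n with (k + (n - k))%nat at 2 by lia.
    rewrite pow_add. ring. }
  elim=> [|m IH] Hm.
  - change (zsum (fun i => a i * b (n - i)%nat)%Z 1) with (0 + a 0%nat * b (n - 0)%nat)%Z.
    rewrite Z.add_0_l E //. simpl. lra.
  - change (zsum (fun i => a i * b (n - i)%nat)%Z (S (S m))) with
      (zsum (fun i => a i * b (n - i)%nat)%Z (S m) + a (S m) * b (n - S m)%nat)%Z.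
    rewrite plus_IZR. simpl sum_f_R0. rewrite -E //.
    have := IH ltac:(lia). have := Rabs_triang (IZR (zsum (fun i : nat => (a i * b (n - i)%nat)%Z) (S m))) (IZR (a (S m) * b (n - S m)%nat)).
    have : (0 <= rho ^ n)%R by apply pow_le; lra. nra. }
apply. lia.
Qed.

Lemma conv_spow (a : series) (n : nat) : conv a -> conv (spow a n).
Proof. intros H. elim: n => [|n IH] /=; [apply conv_s1 | by apply conv_smul]. Qed.

Section QvalAlgebra.
Variables (a b : series) (z : C).
Hypotheses (Ha : conv a) (Hb : conv b) (Hz : (0 < Im z)%R).

Lemma qval_smul : qval (smul a b) z = qval a z * qval b z.
Proof.
rewrite !qval_CS -CS_mult; try by apply conv_asum.
apply CS_ext => n. apply qpow_smul.
Qed.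

Lemma qval_sadd : qval (sadd a b) z = qval a z + qval b z.
Proof.
rewrite !qval_CS -CS_plus; try by apply conv_asum.
apply CS_ext => n. rewrite /qpow /sadd plus_IZR RtoC_plus. ring.
Qed.

Lemma qval_sopp : qval (sopp a) z = - qval a z.
Proof.
rewrite !qval_CS. replace (- CS (qpow a z)) with (- (1) * CS (qpow a z)) by ring.
rewrite -CS_scal; last by apply conv_asum.
apply CS_ext => n. rewrite /qpow /sopp opp_IZR RtoC_opp. ring.
Qed.

Lemma qval_le (y : R) : (0 < y <= Im z)%R ->
  (Cmod (qval a z) <= Series (fun n => Rabs (IZR (a n)) * exp (- 2 * PI * y) ^ n))%R.
Proof.
intros Hy. rewrite qval_CS. apply Cmod_CS_le; last first.
- apply Ha. apply (exp_im_range (0%R, y)). simpl. lra.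
- intros k. rewrite Cmod_qpow. apply Rmult_le_compat_l; first apply Rabs_pos.
  apply pow_incr. split; first by left; apply exp_pos.
  destruct (Rle_lt_or_eq_dec _ _ (proj2 Hy)) as [H| ->]; last lra.
  left. apply exp_increasing. have := PI_RGT_0. nra.
Qed.
End QvalAlgebra.

Lemma qval_ssub (a b : series) (z : C) : conv a -> conv b -> (0 < Im z)%R ->
  qval (ssub a b) z = qval a z - qval b z.
Proof. intros. rewrite qval_sadd //; last by apply conv_sopp. by rewrite qval_sopp. Qed.

Lemma qval_finite (a : series) (N : nat) (z : C) :
  (forall n, (N <= n)%nat -> a n = 0%Z) -> qval a z = csum (qpow a z) N.
Proof.
intros H. rewrite qval_CS.
have E : forall n, csum (qpow a z) (N + n) = csum (qpow a z) N.
{ intros n. rewrite csum_add. rewrite (csum_ext (fun k => qpow a z (N + k)) (fun _ => 0)).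
  - rewrite csum_const. ring.
  - intros k _. rewrite /qpow H; last lia. ring. }
apply (clim_unique (csum (qpow a z))).
- apply CS_cser'.
  + apply (ex_series_incr_n _ N). apply (ex_series_ext (fun n => 0 * 0 ^ n)%R).
    * intros n. rewrite /qpow H; last lia. rewrite Cmult_0_l /Re /=. ring.
    * apply: ex_series_scal_l. apply ex_series_geom. rewrite Rabs_R0. lra.
  + apply (ex_series_incr_n _ N). apply (ex_series_ext (fun n => 0 * 0 ^ n)%R).
    * intros n. rewrite /qpow H; last lia. rewrite Cmult_0_l /Im /=. ring.
    * apply: ex_series_scal_l. apply ex_series_geom. rewrite Rabs_R0. lra.
- apply (is_lim_seq_incr_n (fun m => Cmod (csum (qpow a z) m - csum (qpow a z) N)) N).
  apply (clim_ext (fun _ => csum (qpow a z) N)); last apply clim_const.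
  intros n. by rewrite Nat.add_comm E.
Qed.

Lemma qval_sC (c : Z) (z : C) : qval (sC c) z = RtoC (IZR c).
Proof.
rewrite (qval_finite _ 1).
- rewrite /= /qpow /sC /=. ring.
- intros [|n] Hn; [lia | reflexivity].
Qed.

Lemma qval_s1 (z : C) : qval s1 z = 1.
Proof. exact (qval_sC 1 z). Qed.

Lemma qval_sX (z : C) : qval sX z = qexp z.
Proof.
rewrite (qval_finite _ 2).
- rewrite /= /qpow /sX /=. ring.
- intros [|[|n]] Hn; try lia. reflexivity.
Qed.

Lemma qval_spow (a : series) (n : nat) (z : C) :
  conv a -> (0 < Im z)%R -> qval (spow a n) z = qval a z ^ n.
Proof.
intros Ha Hz. elim: n => [|n IH]; first by rewrite /= qval_s1.
by rewrite Cpow_S -IH /= qval_smul //; apply conv_spow.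
Qed.

Lemma qval_shift (a : series) (z : C) (k : Z) : qval a (z + IZR k) = qval a z.
Proof. rewrite !qval_CS. apply CS_ext => n. by rewrite /qpow qexp_plus qexp_IZR Cmult_1_r. Qed.

(* a(x^N) *)
Definition dilate (N : nat) (a : series) : series :=
  fun n => if Nat.eqb (n mod N) 0 then a (n / N)%nat else 0%Z.

Lemma dilate_mul (N : nat) (a : series) (n : nat) : (0 < N)%nat -> dilate N a (N * n)%nat = a n.
Proof.
intros HN. rewrite /dilate Nat.mul_comm Nat.Div0.mod_mul Nat.div_mul //; lia.
Qed.

Lemma dilate_other (N : nat) (a : series) (n k : nat) :
  (0 < k < N)%nat -> dilate N a (N * n + k)%nat = 0%Z.
Proof.
intros Hk. rewrite /dilate. have -> : ((N * n + k) mod N = k)%nat.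
{ rewrite Nat.add_comm Nat.mul_comm Nat.Div0.mod_add Nat.mod_small; lia. }
destruct k; [lia | reflexivity].
Qed.

Lemma csum_dilate (N : nat) (a : series) (z : C) (n : nat) : (0 < N)%nat ->
  csum (qpow (dilate N a) z) (N * n) = csum (qpow a (RtoC (INR N) * z)) n.
Proof.
intros HN. elim: n => [|n IH]; first by rewrite Nat.mul_0_r.
rewrite Nat.mul_succ_r csum_add IH /=. f_equal.
replace N with (1 + (N - 1))%nat at 1 by lia. rewrite csum_add /=.
rewrite (csum_ext (fun k => qpow (dilate N a) z (N * n + S k)) (fun _ => 0)).
- rewrite csum_const Nat.add_0_r /qpow dilate_mul // qexp_nat Cpow_mult_r. ring.
- intros k Hk. rewrite /qpow dilate_other; last lia. ring.
Qed.

Lemma conv_dilate (N : nat) (a : series) : (0 < N)%nat -> conv a -> conv (dilate N a).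
Proof.
intros HN Ha. apply conv_bounded => rho Hr.
have Hr' : (0 <= rho ^ N < 1)%R.
{ split; first by apply pow_le; lra. apply pow_lt_1_compat; [lra | lia]. }
exists (Series (fun n => Rabs (IZR (a n)) * (rho ^ N) ^ n)%R) => n.
have P : forall k, (0 <= Rabs (IZR (a k)) * (rho ^ N) ^ k)%R.
{ intros k. apply Rmult_le_pos; [apply Rabs_pos | apply pow_le; lra]. }
rewrite (Nat.div_mod_eq n N).
destruct (Nat.eq_dec (n mod N) 0) as [E|E].
- rewrite E Nat.add_0_r dilate_mul // pow_mult.
  apply: Rle_trans; last apply (sum_f_R0_le_Series _ (n / N) P (Ha _ Hr')).
  destruct (n / N)%nat; simpl; first lra.
  have : (0 <= sum_f_R0 (fun k => Rabs (IZR (a k)) * (rho ^ N) ^ k) n0)%R by apply cond_pos_sum.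
  simpl. lra.
- rewrite dilate_other; last by have := Nat.mod_upper_bound n N; lia.
  rewrite Rabs_R0 Rmult_0_l. by apply Series_ge_0; last apply Ha.
Qed.

(** Only the partial sums of length N n are compared; they determine the value because the dilated
    series converges. *)
Lemma qval_dilate (N : nat) (a : series) (z : C) : (0 < N)%nat -> conv a -> (0 < Im z)%R ->
  qval (dilate N a) z = qval a (RtoC (INR N) * z).
Proof.
intros HN Ha Hz. rewrite !qval_CS.
have HNR := lt_0_INR _ HN.
apply (clim_unique (fun n => csum (qpow (dilate N a) z) (N * n))).
- apply clim_subseq; first by (intros; nia).
  apply CS_cser, conv_asum; auto. by apply conv_dilate.
- apply (clim_ext (csum (qpow a (RtoC (INR N) * z)))); first by (intros; rewrite csum_dilate).
  apply CS_cser, conv_asum; auto. rewrite /= Rmult_0_l Rplus_0_r. by apply Rmult_lt_0_compat.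
Qed.

(** * Averages over roots of unity *)

Lemma qexp_real_1 (x : R) : qexp x = 1 -> exists k : Z, x = IZR k.
Proof.
intros H. have HR : Re (qexp x) = 1%R by rewrite H.
rewrite /qexp /Re /Im /= Rmult_0_r exp_0 Rmult_1_l in HR.
replace (2 * PI * x)%R with (2 * (PI * x))%R in HR by ring.
rewrite cos_2a_sin in HR. have Hs : sin (PI * x) = 0%R by nra.
destruct (sin_eq_0_0 _ Hs) as [k Hk]. exists k. have := PI_RGT_0. nra.
Qed.

Lemma geom_csum (w : C) (n : nat) : (1 - w) * csum (fun k => w ^ k) n = 1 - w ^ n.
Proof. elim: n => [|n IH]; first by simpl; ring. rewrite Cpow_S /= Cmult_plus_distr_l IH. ring. Qed.

(** Orthogonality: the terms are the powers of w = e(d / N), and w^N = 1 makes their geometric sum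
    vanish unless w = 1, that is, unless N divides d. *)
Lemma root_sum (N : nat) (d : Z) : (0 < N)%nat ->
  csum (fun k => qexp (RtoC (IZR d / INR N) * INR k)) N =
  if Z.eqb (d mod Z.of_nat N) 0 then RtoC (INR N) else 0.
Proof.
intros HN. have HNR := lt_0_INR _ HN.
set w := qexp (RtoC (IZR d / INR N)).
rewrite (csum_ext _ (fun k => w ^ k)); last by (intros k _; rewrite Cmult_comm qexp_nat).
destruct (Z.eqb_spec (d mod Z.of_nat N) 0) as [E|E].
- have -> : w = 1.
  { rewrite /w. apply Z.mod_divide in E; last lia. destruct E as [e ->].
    rewrite mult_IZR -INR_IZR_INZ. have -> : (IZR e * INR N / INR N)%R = IZR e by field; lra.
    apply qexp_IZR. }
  rewrite (csum_ext _ (fun _ => 1)); last by (intros; apply Cpow_1_l). rewrite csum_const. ring.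
- have Hw : 1 - w <> 0.
  { intros H. have Hw : w = 1 by replace w with (1 - (1 - w)) by ring; rewrite H; ring.
    destruct (qexp_real_1 _ Hw) as [e He]. apply E. apply Z.mod_divide; first lia. exists e.
    apply eq_IZR. rewrite mult_IZR -INR_IZR_INZ -He. field. lra. }
  have HwN : w ^ N = 1.
  { rewrite /w -qexp_nat -RtoC_mult. replace (INR N * (IZR d / INR N))%R with (IZR d) by (field; lra).
    apply qexp_IZR. }
  have := geom_csum w N. rewrite HwN => H.
  replace (csum (fun k => w ^ k) N) with (/ (1 - w) * ((1 - w) * csum (fun k => w ^ k) N)) by (field; auto).
  rewrite H. ring.
Qed.

Definition residue (N : nat) (n : nat) (a : series) : series :=
  fun l => if Z.eqb ((Z.of_nat l - Z.of_nat n) mod Z.of_nat N) 0 then a l else 0%Z.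

Lemma conv_residue (N n : nat) (a : series) : conv a -> conv (residue N n a).
Proof. apply (conv_scal 1). intros k. rewrite /residue. destruct (Z.eqb _ _); lia. Qed.

Lemma csum_CS (u : nat -> nat -> C) (N : nat) : (forall k, asum (u k)) ->
  csum (fun k => CS (u k)) N = CS (fun l => csum (fun k => u k l) N) /\
  asum (fun l => csum (fun k => u k l) N).
Proof.
intros H. elim: N => [|N [IH1 IH2]] /=.
- have H0 : asum (fun _ => 0).
  { apply (asum_le _ (fun n => 0 * 0 ^ n)%R); first by (intros; rewrite Cmod_0; lra).
    apply: ex_series_scal_l. apply ex_series_geom. rewrite Rabs_R0. lra. }
  split; auto. symmetry. apply CS_unique; auto.
  apply (clim_ext (fun _ => 0)); last apply clim_const.
  intros n. rewrite csum_const. ring.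
- split; last by apply asum_plus. by rewrite IH1 CS_plus.
Qed.

(** Translates by k / N, weighted by e(-n k / N), extract the exponents congruent to n mod N. With N
    = p and n = 0 this is the operator a(n) -> a(pn); with N tending to infinity it isolates a
    single coefficient. *)
Lemma qval_residue (N n : nat) (a : series) (z : C) : (0 < N)%nat -> conv a -> (0 < Im z)%R ->
  csum (fun k => qexp (RtoC (- INR n / INR N) * INR k) * qval a (z + RtoC (INR k / INR N))) N =
  RtoC (INR N) * qval (residue N n a) z.
Proof.
intros HN Ha Hz. have HNR := lt_0_INR _ HN.
have Hasum : forall k, asum (fun l => qexp (RtoC (- INR n / INR N) * INR k) * qpow a (z + RtoC (INR k / INR N)) l).
{ intros k. apply asum_scal, conv_asum; auto. rewrite /= Rplus_0_r. auto. }
rewrite (csum_ext _ (fun k => CS (fun l => qexp (RtoC (- INR n / INR N) * INR k) * qpow a (z + RtoC (INR k / INR N)) l))).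
- rewrite (proj1 (csum_CS _ N Hasum)) qval_CS -CS_scal; last by apply conv_asum; [apply conv_residue|].
  apply CS_ext => l. 
  rewrite (csum_ext _ (fun k => qpow a z l * qexp (RtoC (IZR (Z.of_nat l - Z.of_nat n) / INR N) * INR k))).
  + rewrite csum_scal root_sum // /qpow /residue.
    destruct (Z.eqb _ _); rewrite ?Cmult_0_l; ring.
  + intros k _. rewrite /qpow qexp_plus Cpow_mult_l.
    have -> : qexp (RtoC (IZR (Z.of_nat l - Z.of_nat n) / INR N) * INR k) =
      qexp (RtoC (- INR n / INR N) * INR k) * qexp (RtoC (INR k / INR N)) ^ l; last ring.
    rewrite -qexp_nat -qexp_plus. f_equal. rewrite -!RtoC_mult -RtoC_plus. f_equal.
    rewrite minus_IZR -!INR_IZR_INZ. field. lra.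
- intros k _. rewrite CS_scal; last by apply conv_asum; auto; rewrite /= Rplus_0_r.
  by rewrite qval_CS.
Qed.

(** * Hecke operators *)

Lemma Im_pos_neq_0 (z : C) : (0 < Im z)%R -> z <> 0.
Proof. intros H E. rewrite E /= in H. lra. Qed.

Lemma linear_neq_0 (c d : Z) (z : C) :
  (0 < Im z)%R -> (c <> 0 \/ d <> 0)%Z -> RtoC (IZR c) * z + RtoC (IZR d) <> 0.
Proof.
intros Hz H E.
have HI : (IZR c * Im z = 0)%R.
{ have := f_equal Im E. destruct z as [x y]. rewrite /Im /=. intros. lra. }
have HR : (IZR c * Re z + IZR d = 0)%R.
{ have := f_equal Re E. destruct z as [x y]. rewrite /Re /=. intros. lra. }
have Hc : IZR c = 0%R by nra.
rewrite Hc in HR. have Hd : IZR d = 0%R by lra.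
apply eq_IZR in Hc. apply eq_IZR in Hd. lia.
Qed.

Lemma Im_mobius (al be ga de : Z) (z : C) :
  RtoC (IZR ga) * z + RtoC (IZR de) <> 0 ->
  Im (mobius al be ga de z) =
  (IZR (al * de - be * ga) * Im z / Cmod (RtoC (IZR ga) * z + RtoC (IZR de)) ^ 2)%R.
Proof.
intros Hn. rewrite Cmod2_alt /mobius. destruct z as [x y].
rewrite minus_IZR !mult_IZR.
have Hd : ((IZR ga * x - 0 * y + IZR de) ^ 2 + (IZR ga * y + 0 * x + 0) ^ 2 <> 0)%R.
{ intros E. rewrite -!Rsqr_pow2 in E.
  apply Hn. apply C_eq; rewrite /Re /Im /=.
  - by apply Rplus_sqr_eq_0_l in E.
  - rewrite Rplus_comm in E. by apply Rplus_sqr_eq_0_l in E. }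
rewrite /Re /Im /=. field. intros E. apply Hd. etransitivity; [|exact E]; ring.
Qed.

Lemma mobius_comp (a b c d al be ga de : Z) (z : C) :
  RtoC (IZR ga) * z + RtoC (IZR de) <> 0 ->
  RtoC (IZR c) * mobius al be ga de z + RtoC (IZR d) <> 0 ->
  mobius a b c d (mobius al be ga de z) =
  mobius (a * al + b * ga) (a * be + b * de) (c * al + d * ga) (c * be + d * de) z.
Proof.
intros H1 H2. rewrite /mobius in H2 *.
have H3 : RtoC (IZR (c * al + d * ga)) * z + RtoC (IZR (c * be + d * de)) =
  (RtoC (IZR c) * ((RtoC (IZR al) * z + RtoC (IZR be)) / (RtoC (IZR ga) * z + RtoC (IZR de))) + RtoC (IZR d)) * (RtoC (IZR ga) * z + RtoC (IZR de)).
{ rewrite !plus_IZR !mult_IZR !RtoC_plus !RtoC_mult. field. auto. }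
rewrite H3 !plus_IZR !mult_IZR !RtoC_plus !RtoC_mult. field. split; auto.
intros E. apply H2. 
replace (RtoC (IZR c) * ((RtoC (IZR al) * z + RtoC (IZR be)) / (RtoC (IZR ga) * z + RtoC (IZR de))) + RtoC (IZR d)) with
 ((RtoC (IZR c) * (RtoC (IZR al) * z + RtoC (IZR be)) + RtoC (IZR d) * (RtoC (IZR ga) * z + RtoC (IZR de))) / (RtoC (IZR ga) * z + RtoC (IZR de))) by (field; auto).
rewrite E. field. auto.
Qed.

Lemma Im_mobius_pos (al be ga de : Z) (z : C) :
  (0 < al * de - be * ga)%Z -> (0 < Im z)%R -> (0 < Im (mobius al be ga de z))%R.
Proof.
intros Hd Hz.
have Hn : RtoC (IZR ga) * z + RtoC (IZR de) <> 0 by apply linear_neq_0; auto; nia.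
rewrite Im_mobius //. apply Rdiv_lt_0_compat.
- apply Rmult_lt_0_compat; auto. by apply (IZR_lt 0).
- apply pow_lt. by apply Cmod_gt_0.
Qed.

Fixpoint lsum (l : list C) : C := match l with nil => 0 | cons x l => x + lsum l end.

Lemma lsum_app (l l' : list C) : lsum (l ++ l') = lsum l + lsum l'.
Proof. elim: l => [|x l IH] /=; [ring | rewrite IH; ring]. Qed.

Lemma csum_lsum (u : nat -> C) (n : nat) : csum u n = lsum (map u (seq 0 n)).
Proof.
elim: n => [|n IH] //. rewrite seq_S map_app lsum_app -IH /=. ring.
Qed.

Lemma lsum_perm (l l' : list C) : Permutation l l' -> lsum l = lsum l'.
Proof. induction 1; simpl; try congruence; ring. Qed.

Lemma csum_perm (u : nat -> C) (n : nat) (s : nat -> nat) :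
  (forall i, (i < n)%nat -> (s i < n)%nat) ->
  (forall i j, (i < n)%nat -> (j < n)%nat -> s i = s j -> i = j) ->
  csum (fun i => u (s i)) n = csum u n.
Proof.
intros Hs Hinj. rewrite !csum_lsum. apply lsum_perm.
rewrite -(map_map s u). apply Permutation_map. apply NoDup_Permutation_bis.
- have : forall l, (forall i, In i l -> (i < n)%nat) -> NoDup l -> NoDup (map s l).
  { intros l Hl Hnd. induction Hnd as [|x l Hx Hnd IH]; simpl; constructor.
    - intros Hin. apply in_map_iff in Hin. destruct Hin as [y [Hy Hy']].
      have E : y = x by apply Hinj; auto; apply Hl; simpl; auto.
      by subst.
    - apply IH. intros; apply Hl; simpl; auto. }
  apply.
  + intros i Hi. apply in_seq in Hi. lia.
  + apply seq_NoDup.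
- by rewrite length_map.
- intros x Hx. apply in_map_iff in Hx. destruct Hx as [y [Hy Hy']].
  apply in_seq in Hy'. apply in_seq. have := Hs y ltac:(lia). lia.
Qed.

(** Finite choice, by induction on n; it turns the existence of image points on the projective line
    into a map. *)
Lemma bounded_choice (Rel : nat -> nat -> Prop) (n : nat) :
  (forall i, (i < n)%nat -> exists j, Rel i j) ->
  exists s : nat -> nat, forall i, (i < n)%nat -> Rel i (s i).
Proof.
elim: n => [|n IH] H; first by (exists (fun i => i); intros; lia).
destruct (IH (fun i Hi => H i (Nat.lt_lt_succ_r _ _ Hi))) as [s Hs].
destruct (H n (Nat.lt_succ_diag_r n)) as [j Hj].
exists (fun i => if Nat.eqb i n then j else s i) => i Hi.
destruct (Nat.eqb_spec i n) as [->|Hne]; auto. apply Hs. lia.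
Qed.

(* The matrices (1 i; 0 p) for i < p, and (p 0; 0 1) for i = p, represent the cosets
   SL2(Z)\{det = p}. *)
Section Hecke.
Variable p : nat.
Hypothesis Hp : prime (Z.of_nat p).

Definition hk_a (i : nat) : Z := if Nat.ltb i p then 1%Z else Z.of_nat p.
Definition hk_b (i : nat) : Z := if Nat.ltb i p then Z.of_nat i else 0%Z.
Definition hk_d (i : nat) : Z := if Nat.ltb i p then Z.of_nat p else 1%Z.
Definition hk_pt (i : nat) (z : C) : C := (RtoC (IZR (hk_a i)) * z + RtoC (IZR (hk_b i))) / RtoC (IZR (hk_d i)).

(** This is p times the usual T_p. The extra factor makes the expansion p a(pn) + p^k a(n/p)
    integral for every k, including k = 0, and it is 1 mod 2 for odd p. *)
Definition hecke (k : nat) (phi : C -> C) (z : C) : C :=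
  RtoC (INR p) ^ k * csum (fun i => phi (hk_pt i z) / RtoC (IZR (hk_d i)) ^ k) (S p).

Lemma p_pos : (1 < Z.of_nat p)%Z.
Proof. by destruct Hp. Qed.

Lemma hk_d_pos (i : nat) : (0 < hk_d i)%Z.
Proof. have := p_pos. rewrite /hk_d. destruct (Nat.ltb i p); lia. Qed.

Lemma hk_a_pos (i : nat) : (0 < hk_a i)%Z.
Proof. have := p_pos. rewrite /hk_a. destruct (Nat.ltb i p); lia. Qed.

Lemma hk_d_neq_0 (i : nat) : RtoC (IZR (hk_d i)) <> 0.
Proof. have := hk_d_pos i. intros H E. apply RtoC_inj, eq_IZR in E. lia. Qed.

Lemma Im_hk_pt (i : nat) (z : C) : Im (hk_pt i z) = (IZR (hk_a i) * Im z / IZR (hk_d i))%R.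
Proof.
have H := IZR_lt _ _ (hk_d_pos i). rewrite /hk_pt. destruct z as [x y].
rewrite /Im /=. field. lra.
Qed.

Lemma Im_hk_pt_pos (i : nat) (z : C) : (0 < Im z)%R -> (0 < Im (hk_pt i z))%R.
Proof.
intros Hz. rewrite Im_hk_pt. apply Rdiv_lt_0_compat; last by apply (IZR_lt 0), hk_d_pos.
apply Rmult_lt_0_compat; auto. by apply (IZR_lt 0), hk_a_pos.
Qed.

(* hk_pt i (g z) = G (hk_pt j z) when the matrices satisfy D_i g = G D_j. *)
Lemma hk_cocycle (i j : nat) (al be ga de A B G D : Z) (z : C) :
  (0 < Im z)%R -> (0 < al * de - be * ga)%Z ->
  (hk_a i * al + hk_b i * ga = A * hk_a j)%Z ->
  (hk_a i * be + hk_b i * de = A * hk_b j + B * hk_d j)%Z ->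
  (hk_d i * ga = G * hk_a j)%Z ->
  (hk_d i * de = G * hk_b j + D * hk_d j)%Z ->
  hk_pt i (mobius al be ga de z) = mobius A B G D (hk_pt j z) /\
  RtoC (IZR (hk_d i)) * (RtoC (IZR ga) * z + RtoC (IZR de)) =
  (RtoC (IZR G) * hk_pt j z + RtoC (IZR D)) * RtoC (IZR (hk_d j)).
Proof.
intros Hz Hdet H1 H2 H3 H4.
apply (f_equal (fun x => RtoC (IZR x))) in H1, H2, H3, H4.
rewrite !plus_IZR !mult_IZR !RtoC_plus !RtoC_mult in H1.
rewrite !plus_IZR !mult_IZR !RtoC_plus !RtoC_mult in H2.
rewrite !mult_IZR !RtoC_mult in H3.
rewrite !plus_IZR !mult_IZR !RtoC_plus !RtoC_mult in H4.
have Hi := hk_d_neq_0 i. have Hj := hk_d_neq_0 j.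
have Hn : RtoC (IZR ga) * z + RtoC (IZR de) <> 0 by apply linear_neq_0; auto; nia.
have E : RtoC (IZR (hk_d i)) * (RtoC (IZR ga) * z + RtoC (IZR de)) =
  (RtoC (IZR G) * hk_pt j z + RtoC (IZR D)) * RtoC (IZR (hk_d j)).
{ rewrite /hk_pt.
  transitivity (RtoC (IZR G) * RtoC (IZR (hk_a j)) * z + (RtoC (IZR G) * RtoC (IZR (hk_b j)) + RtoC (IZR D) * RtoC (IZR (hk_d j)))).
  - rewrite -H3 -H4. ring.
  - field. auto. }
split; auto.
have Hn2 : RtoC (IZR G) * hk_pt j z + RtoC (IZR D) <> 0.
{ intros E0. rewrite E0 Cmult_0_l in E. apply Cmult_neq_0 in E; auto. }
set u := hk_pt j z in E Hn2 *.
have E2 : RtoC (IZR (hk_a i)) * (RtoC (IZR al) * z + RtoC (IZR be)) + RtoC (IZR (hk_b i)) * (RtoC (IZR ga) * z + RtoC (IZR de))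
  = (RtoC (IZR A) * u + RtoC (IZR B)) * RtoC (IZR (hk_d j)).
{ rewrite /u /hk_pt.
  transitivity (RtoC (IZR A) * RtoC (IZR (hk_a j)) * z + (RtoC (IZR A) * RtoC (IZR (hk_b j)) + RtoC (IZR B) * RtoC (IZR (hk_d j)))).
  - rewrite -H1 -H2. ring.
  - field. auto. }
rewrite {1}/hk_pt /mobius.
transitivity ((RtoC (IZR (hk_a i)) * (RtoC (IZR al) * z + RtoC (IZR be)) + RtoC (IZR (hk_b i)) * (RtoC (IZR ga) * z + RtoC (IZR de))) / (RtoC (IZR (hk_d i)) * (RtoC (IZR ga) * z + RtoC (IZR de)))).
- field. auto.
- rewrite E E2. field. auto.
Qed.

(** The factorizations D_i g = G_i D_(s i) carry the terms of one sum to those of the other,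
    permuted by s. Two functions and a factor [kappa] are allowed so that the same statement serves
    the elements of Gamma_0(5), with [phi] = [psi] and [kappa] = 1, and the Fricke involution. *)
Lemma hecke_transform (k : nat) (phi psi : C -> C) (kappa : C) (al be ga de : Z) (s : nat -> nat) (z : C) :
  (0 < Im z)%R -> (0 < al * de - be * ga)%Z ->
  (forall i, (i < S p)%nat -> (s i < S p)%nat) ->
  (forall i j, (i < S p)%nat -> (j < S p)%nat -> s i = s j -> i = j) ->
  (forall i, (i < S p)%nat -> exists A B G D,
     (hk_a i * al + hk_b i * ga = A * hk_a (s i))%Z /\
     (hk_a i * be + hk_b i * de = A * hk_b (s i) + B * hk_d (s i))%Z /\
     (hk_d i * ga = G * hk_a (s i))%Z /\
     (hk_d i * de = G * hk_b (s i) + D * hk_d (s i))%Z /\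
     forall u, (0 < Im u)%R ->
       phi (mobius A B G D u) = kappa * (RtoC (IZR G) * u + RtoC (IZR D)) ^ k * psi u) ->
  hecke k phi (mobius al be ga de z) = kappa * autfac ga de k z * hecke k psi z.
Proof.
intros Hz Hdet Hs Hinj H. rewrite /hecke.
rewrite -(csum_perm (fun i => psi (hk_pt i z) / RtoC (IZR (hk_d i)) ^ k) (S p) s) //.
rewrite (csum_ext _ (fun i => kappa * autfac ga de k z * (psi (hk_pt (s i) z) / RtoC (IZR (hk_d (s i))) ^ k))).
- rewrite csum_scal. ring.
- intros i Hi. destruct (H i Hi) as (A & B & G & D & H1 & H2 & H3 & H4 & H5).
  destruct (hk_cocycle i (s i) al be ga de A B G D z) as [E1 E2]; auto.
  rewrite E1 H5; last by apply Im_hk_pt_pos.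
  rewrite /autfac.
  have Hi' := Cpow_nz _ k (hk_d_neq_0 i). have Hj' := Cpow_nz _ k (hk_d_neq_0 (s i)).
  apply (f_equal (fun x => x ^ k)) in E2. rewrite !Cpow_mult_l in E2.
  transitivity (kappa * psi (hk_pt (s i) z) * ((RtoC (IZR G) * hk_pt (s i) z + RtoC (IZR D)) ^ k * RtoC (IZR (hk_d (s i))) ^ k) / (RtoC (IZR (hk_d i)) ^ k * RtoC (IZR (hk_d (s i))) ^ k)).
  + field. auto.
  + rewrite -E2. field. auto.
Qed.

(* Points of the projective line over Z/p: [1 : i] for i < p, and [0 : 1] for i = p. *)
Definition pr_x (i : nat) : Z := if Nat.ltb i p then 1%Z else 0%Z.
Definition pr_y (i : nat) : Z := if Nat.ltb i p then Z.of_nat i else 1%Z.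

(** The vanishing determinant says that [x : y] is the point of index j. If p divides x this is
    [0 : 1]; otherwise j is y / x mod p. *)
Lemma pr_exists (x y : Z) : exists j, (j < S p)%nat /\ (Z.of_nat p | x * pr_y j - y * pr_x j)%Z.
Proof.
have Hp1 := p_pos.
destruct (Zdivide_dec (Z.of_nat p) x) as [Hx|Hx].
- exists p. split; first lia. rewrite /pr_x /pr_y Nat.ltb_irrefl. by rewrite Z.mul_1_r Z.mul_0_r Z.sub_0_r.
- have Hrel : rel_prime x (Z.of_nat p) by apply rel_prime_sym, prime_rel_prime.
  destruct (rel_prime_bezout _ _ Hrel) as [u v Huv].
  (* By Bezout, u is an inverse of x mod p. *)
  set j := Z.to_nat ((y * u) mod Z.of_nat p).
  have Hj : (Z.of_nat j = (y * u) mod Z.of_nat p)%Z.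
  { rewrite Z2Nat.id //. apply Z.mod_pos_bound. lia. }
  have Hb := Z.mod_pos_bound (y * u) (Z.of_nat p) ltac:(lia).
  exists j. split; first lia.
  have Hlt : Nat.ltb j p = true by apply Nat.ltb_lt; lia.
  rewrite /pr_x /pr_y Hlt Hj Z.mod_eq; last lia.
  exists (- y * v - x * (y * u / Z.of_nat p))%Z.
  have E : (y * (u * x + v * Z.of_nat p) = y)%Z by rewrite Huv; ring.
  generalize (y * u / Z.of_nat p)%Z => q. lia.
Qed.

Lemma small_divide (d : Z) : (Z.of_nat p | d)%Z -> (- Z.of_nat p < d < Z.of_nat p)%Z -> d = 0%Z.
Proof.
intros [e ->] H. have Hp1 := p_pos.
destruct (Z.lt_trichotomy e 0) as [He|[->|He]]; [nia | reflexivity | nia].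
Qed.

Lemma pr_unique (x y : Z) (i j : nat) : (i < S p)%nat -> (j < S p)%nat ->
  ~ ((Z.of_nat p | x) /\ (Z.of_nat p | y))%Z ->
  (Z.of_nat p | x * pr_y i - y * pr_x i)%Z -> (Z.of_nat p | x * pr_y j - y * pr_x j)%Z -> i = j.
Proof.
intros Hi Hj Hn H1 H2. have Hp1 := p_pos. rewrite /pr_x /pr_y in H1 H2.
destruct (Nat.ltb_spec i p) as [Li|Li]; destruct (Nat.ltb_spec j p) as [Lj|Lj].
- have H3 : (Z.of_nat p | x * (Z.of_nat i - Z.of_nat j))%Z.
  { replace (x * (Z.of_nat i - Z.of_nat j))%Z with ((x * Z.of_nat i - y * 1) - (x * Z.of_nat j - y * 1))%Z by ring.
    by apply Z.divide_sub_r. }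
  apply prime_mult in H3; auto. destruct H3 as [H3|H3].
  + exfalso. apply Hn. split; auto.
    replace y with (x * Z.of_nat i - (x * Z.of_nat i - y * 1))%Z by ring.
    apply Z.divide_sub_r; auto. by apply Z.divide_mul_l.
  + have := small_divide _ H3. lia.
- exfalso. rewrite Z.mul_1_r Z.mul_0_r Z.sub_0_r in H2. apply Hn. split; auto.
  replace y with (x * Z.of_nat i - (x * Z.of_nat i - y * 1))%Z by ring.
  apply Z.divide_sub_r; auto. by apply Z.divide_mul_l.
- exfalso. rewrite Z.mul_1_r Z.mul_0_r Z.sub_0_r in H1. apply Hn. split; auto.
  replace y with (x * Z.of_nat j - (x * Z.of_nat j - y * 1))%Z by ring.
  apply Z.divide_sub_r; auto. by apply Z.divide_mul_l.
- lia.
Qed.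

Lemma pr_nonzero (i : nat) (al be ga de : Z) : ~ (Z.of_nat p | al * de - be * ga)%Z ->
  ~ ((Z.of_nat p | pr_x i * al + pr_y i * ga) /\ (Z.of_nat p | pr_x i * be + pr_y i * de))%Z.
Proof.
intros Hdet [H1 H2]. have Hp1 := p_pos.
have Hx : (Z.of_nat p | pr_x i)%Z.
{ destruct (prime_mult _ Hp (pr_x i) (al * de - be * ga)%Z) as [H|H]; auto; last contradiction.
  replace (pr_x i * (al * de - be * ga))%Z with
    ((pr_x i * al + pr_y i * ga) * de - (pr_x i * be + pr_y i * de) * ga)%Z by ring.
  apply Z.divide_sub_r; by apply Z.divide_mul_l. }
have Hy : (Z.of_nat p | pr_y i)%Z.
{ destruct (prime_mult _ Hp (pr_y i) (al * de - be * ga)%Z) as [H|H]; auto; last contradiction.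
  replace (pr_y i * (al * de - be * ga))%Z with
    ((pr_x i * be + pr_y i * de) * al - (pr_x i * al + pr_y i * ga) * be)%Z by ring.
  apply Z.divide_sub_r; by apply Z.divide_mul_l. }
rewrite /pr_x /pr_y in Hx Hy. destruct (Nat.ltb i p).
- have := small_divide _ Hx. lia.
- have := small_divide _ Hy. lia.
Qed.

(* The right action of a matrix invertible mod p on the projective line. *)
Lemma pr_permutation (al be ga de : Z) : ~ (Z.of_nat p | al * de - be * ga)%Z ->
  exists s : nat -> nat,
    (forall i, (i < S p)%nat -> (s i < S p)%nat) /\
    (forall i j, (i < S p)%nat -> (j < S p)%nat -> s i = s j -> i = j) /\
    forall i, (i < S p)%nat ->
      (Z.of_nat p | (pr_x i * al + pr_y i * ga) * pr_y (s i) - (pr_x i * be + pr_y i * de) * pr_x (s i))%Z.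
Proof.
intros Hdet.
destruct (bounded_choice (fun i j => (j < S p)%nat /\
  (Z.of_nat p | (pr_x i * al + pr_y i * ga) * pr_y j - (pr_x i * be + pr_y i * de) * pr_x j)%Z) (S p)) as [s Hs].
{ intros i Hi. apply pr_exists. }
exists s. split; [|split].
- intros i Hi. by apply Hs.
- intros i j Hi Hj E. destruct (Hs i Hi) as [_ H1]. destruct (Hs j Hj) as [_ H2]. rewrite -E in H2.
  (* The condition is bilinear. Regrouped, it says that i and j both represent the image of the
     point [s i] under the adjugate matrix, so uniqueness of the representative applies. *)
  set x := (- (pr_x (s i) * de - pr_y (s i) * ga))%Z.
  set y := (- (pr_x (s i) * (- be) + pr_y (s i) * al))%Z.
  apply (pr_unique x y); auto.
  + intros [Hx Hy]. apply (pr_nonzero (s i) de (- be) (- ga) al).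
    { by replace (de * al - - be * - ga)%Z with (al * de - be * ga)%Z by ring. }
    split.
    * apply Z.divide_opp_r. rewrite /x in Hx.
      by replace (- (pr_x (s i) * de + pr_y (s i) * - ga))%Z with (- (pr_x (s i) * de - pr_y (s i) * ga))%Z by ring.
    * by apply Z.divide_opp_r.
  + replace (x * pr_y i - y * pr_x i)%Z with
      ((pr_x i * al + pr_y i * ga) * pr_y (s i) - (pr_x i * be + pr_y i * de) * pr_x (s i))%Z; auto.
    rewrite /x /y. ring.
  + replace (x * pr_y j - y * pr_x j)%Z with
      ((pr_x j * al + pr_y j * ga) * pr_y (s i) - (pr_x j * be + pr_y j * de) * pr_x (s i))%Z; auto.
    rewrite /x /y. ring.
- intros i Hi. by apply Hs.
Qed.

(* D_i g = G D_j, with j the image of i *)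
Lemma hk_factor (i j : nat) (al be ga de : Z) : (al * de - be * ga = 1)%Z ->
  (Z.of_nat p | (pr_x i * al + pr_y i * ga) * pr_y j - (pr_x i * be + pr_y i * de) * pr_x j)%Z ->
  exists A B G D,
     (hk_a i * al + hk_b i * ga = A * hk_a j)%Z /\
     (hk_a i * be + hk_b i * de = A * hk_b j + B * hk_d j)%Z /\
     (hk_d i * ga = G * hk_a j)%Z /\
     (hk_d i * de = G * hk_b j + D * hk_d j)%Z /\
     (A * D - B * G = 1)%Z /\
     (G = Z.of_nat p * ga \/ G = ga \/ ga = Z.of_nat p * G)%Z.
Proof.
intros Hdet [e He]. have Hp1 := p_pos.
rewrite /pr_x /pr_y in He. rewrite /hk_a /hk_b /hk_d.
set P := Z.of_nat p in Hp1 He *.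
(* In each of the four cases the one entry that requires a division by p is [e] or [- e], with [e]
   the quotient provided by the congruence. *)
destruct (Nat.ltb i p); destruct (Nat.ltb j p).
- exists (al + Z.of_nat i * ga)%Z, (- e)%Z, (P * ga)%Z, (de - ga * Z.of_nat j)%Z.
  repeat split; try (left; reflexivity); nia.
- exists e, (be + Z.of_nat i * de)%Z, ga, (P * de)%Z.
  repeat split; try (right; left; reflexivity); nia.
- exists (P * al)%Z, (be - al * Z.of_nat j)%Z, ga, (- e)%Z.
  repeat split; try (right; left; reflexivity); try nia.
- exists al, (P * be)%Z, e, de. repeat split; try (right; right); nia.
Qed.

Definition weight (k : nat) (phi : C -> C) : Prop :=
  forall al be ga de : Z, (al * de - be * ga = 1)%Z -> (5 | ga)%Z -> forall z, (0 < Im z)%R ->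
    phi (mobius al be ga de z) = autfac ga de k z * phi z.

Hypothesis Hp5 : p <> 5%nat.

Lemma five_divide (x : Z) : (5 | Z.of_nat p * x)%Z -> (5 | x)%Z.
Proof.
intros H.
have P5 : prime 5.
{ constructor; first lia. intros n Hn. apply Zgcd_1_rel_prime.
  have Hc : (n = 1 \/ n = 2 \/ n = 3 \/ n = 4)%Z by lia.
  by destruct Hc as [->|[->|[->| ->]]]. }
apply prime_mult in H; auto. destruct H as [H|H]; auto.
apply prime_div_prime in H; auto. lia.
Qed.

(** The lower left entry of the new matrix is p ga, ga or ga / p. It remains divisible by 5 because
    p is not 5. *)
Theorem hecke_weight (k : nat) (phi : C -> C) : weight k phi -> weight k (hecke k phi).
Proof.
intros Hphi al be ga de Hdet H5 z Hz.
destruct (pr_permutation al be ga de) as (s & Hs & Hinj & Hd).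
{ rewrite Hdet. intros H. apply Z.divide_1_r in H. have := p_pos. lia. }
rewrite (hecke_transform k phi phi 1 al be ga de s) //; [ring | lia |].
intros i Hi. destruct (hk_factor i (s i) al be ga de Hdet (Hd i Hi)) as (A & B & G & D & H1 & H2 & H3 & H4 & H6 & H7).
exists A, B, G, D. repeat split; auto. intros u Hu.
rewrite Hphi //; first (rewrite /autfac; ring).
destruct H7 as [->|[->|H7]]; auto.
- by apply Z.divide_mul_r.
- apply five_divide. by rewrite -H7.
Qed.

Lemma not_divide_five : ~ (Z.of_nat p | 5)%Z.
Proof.
intros [e He]. have Hp1 := p_pos.
have He5 : (5 | Z.of_nat p * e)%Z by (exists 1%Z; lia).
apply five_divide in He5. destruct He5 as [e' ->].
destruct (Z.le_gt_cases e' 0); nia.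
Qed.

(** W has determinant 5, prime to p, so it too permutes the projective line mod p. Each D_i W equals
    (W g) D_j with g in Gamma_0(5), and the laws of W and of g combine. *)
Theorem hecke_fricke (k : nat) (phi psi : C -> C) (kappa : C) : weight k psi ->
  (forall z, (0 < Im z)%R -> phi (mobius 0 (-1) 5 0 z) = kappa * autfac 5 0 k z * psi z) ->
  forall z, (0 < Im z)%R ->
    hecke k phi (mobius 0 (-1) 5 0 z) = kappa * autfac 5 0 k z * hecke k psi z.
Proof.
intros Hpsi HW z Hz. have Hp1 := p_pos.
destruct (pr_permutation 0 (-1) 5 0) as (s & Hs & Hinj & Hd).
{ exact not_divide_five. }
apply (hecke_transform k phi psi kappa 0 (-1) 5 0 s); auto; first lia.
intros i Hi.
(* D_i W = (W g) D_j with g in Gamma_0(5) *)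
have Hg : forall a b c d : Z, (a * d - b * c = 1)%Z -> (5 | c)%Z -> forall u, (0 < Im u)%R ->
  phi (mobius (- c) (- d) (5 * a) (5 * b) u) =
  kappa * (RtoC (IZR (5 * a)) * u + RtoC (IZR (5 * b))) ^ k * psi u.
{ intros a b c d Hdet H5 u Hu.
  have Hn : RtoC (IZR c) * u + RtoC (IZR d) <> 0 by apply linear_neq_0; auto; nia.
  have Hv : (0 < Im (mobius a b c d u))%R by apply Im_mobius_pos; auto; lia.
  have E : mobius (- c) (- d) (5 * a) (5 * b) u = mobius 0 (-1) 5 0 (mobius a b c d u).
  { rewrite mobius_comp //.
    - f_equal; ring.
    - apply linear_neq_0; auto; lia. }
  rewrite E HW // Hpsi // /autfac.
  have -> : RtoC (IZR (5 * a)) * u + RtoC (IZR (5 * b)) =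
    (RtoC 5 * mobius a b c d u + RtoC 0) * (RtoC (IZR c) * u + RtoC (IZR d)).
  { rewrite !mult_IZR !RtoC_mult /mobius. field. auto. }
  rewrite (Cpow_mult_l (_ + _) (_ + _)). ring. }
destruct (Hd i Hi) as [e He]. move: He. rewrite /pr_x /pr_y /hk_a /hk_b /hk_d.
have Hsi := Hs i Hi.
destruct (Nat.ltb_spec i p) as [Li|Li]; destruct (Nat.ltb_spec (s i) p) as [Lj|Lj] => He.
- exists (- (-5 * Z.of_nat i))%Z, (- e)%Z, (5 * Z.of_nat p)%Z, (5 * (- Z.of_nat (s i)))%Z.
  split; [lia | split; [lia | split; [lia | split; [lia |]]]].
  apply (Hg (Z.of_nat p) (- Z.of_nat (s i))%Z (-5 * Z.of_nat i)%Z e); first lia.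
  by exists (- Z.of_nat i)%Z; ring.
(* The image of i is the point [0 : 1], so p divides 5 i and i = 0: W exchanges (1 0; 0 p) and (p 0;
   0 1). *)
- have Hi0 : Z.of_nat i = 0%Z.
  { apply small_divide; last lia.
    have H5 : (Z.of_nat p | 5 * Z.of_nat i)%Z by (exists e; lia).
    apply prime_mult in H5; auto. destruct H5 as [H5|H5]; auto. by destruct (not_divide_five H5). }
  exists (- 0)%Z, (- 1)%Z, (5 * 1)%Z, (5 * 0)%Z. rewrite Hi0.
  split; [lia | split; [lia | split; [lia | split; [lia |]]]].
  apply (Hg 1%Z 0%Z 0%Z 1%Z); first lia. by exists 0%Z.
- have Hi0 : Z.of_nat (s i) = 0%Z.
  { apply small_divide; last lia.
    have H5 : (Z.of_nat p | 5 * Z.of_nat (s i))%Z by (exists e; lia).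
    apply prime_mult in H5; auto. destruct H5 as [H5|H5]; auto. by destruct (not_divide_five H5). }
  exists (- 0)%Z, (- 1)%Z, (5 * 1)%Z, (5 * 0)%Z. rewrite Hi0.
  split; [lia | split; [lia | split; [lia | split; [lia |]]]].
  apply (Hg 1%Z 0%Z 0%Z 1%Z); first lia. by exists 0%Z.
- destruct not_divide_five. exists e. lia.
Qed.

Lemma Cmod_csum_const (u : nat -> C) (b : R) (n : nat) :
  (forall k, (k < n)%nat -> (Cmod (u k) <= b)%R) -> (Cmod (csum u n) <= INR n * b)%R.
Proof.
elim: n => [|n IH] H; first by rewrite /= Cmod_0; lra.
rewrite S_INR. change (csum u (S n)) with (csum u n + u n).
apply: Rle_trans; first apply Cmod_triangle.
have := IH (fun k Hk => H k (Nat.lt_lt_succ_r _ _ Hk)). have := H n (Nat.lt_succ_diag_r n). lra.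
Qed.

Theorem hecke_bounded (k : nat) (phi : C -> C) :
  (forall al be ga de : Z, (al * de - be * ga = 1)%Z ->
     exists B Y : R, forall z, (Y < Im z)%R ->
       (Cmod (phi (mobius al be ga de z)) <= B * Cmod (autfac ga de k z))%R) ->
  forall al be ga de : Z, (al * de - be * ga = 1)%Z ->
     exists B Y : R, forall z, (Y < Im z)%R ->
       (Cmod (hecke k phi (mobius al be ga de z)) <= B * Cmod (autfac ga de k z))%R.
Proof.
intros H al be ga de Hdet. have Hp1 := p_pos.
have HpR : (1 < INR p)%R by rewrite INR_IZR_INZ; apply (IZR_lt 1).
destruct (pr_permutation al be ga de) as (s & Hs & Hinj & Hd).
{ rewrite Hdet. intros Hdiv. apply Z.divide_1_r in Hdiv. lia. }
have Hterm : forall i, (i < S p)%nat -> exists B Y : R, forall z, (Y < Im z)%R ->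
  (Cmod (phi (hk_pt i (mobius al be ga de z)) / RtoC (IZR (hk_d i)) ^ k) <= B * Cmod (autfac ga de k z))%R.
{ intros i Hi.
  destruct (hk_factor i (s i) al be ga de Hdet (Hd i Hi)) as (A & B & G & D & H1 & H2 & H3 & H4 & H6 & _).
  destruct (H A B G D H6) as (B0 & Y0 & HB).
  (* The height of [hk_pt (s i) z] is at least Im z / p, whence the threshold [Y0 * INR p]; the
     maximum with 0 keeps z in the upper half plane. *)
  exists (Rabs B0), (Rmax 0 (Y0 * INR p)) => z Hz.
  have Hz0 : (0 < Im z)%R by apply: Rle_lt_trans Hz; apply Rmax_l.
  have HzY : (Y0 * INR p < Im z)%R by apply: Rle_lt_trans Hz; apply Rmax_r.
  destruct (hk_cocycle i (s i) al be ga de A B G D z) as [E1 E2]; auto; first lia.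
  rewrite E1.
  have HY : (Y0 < Im (hk_pt (s i) z))%R.
  { rewrite Im_hk_pt.
    have Hd1 := IZR_lt _ _ (hk_d_pos (s i)). have Ha1 := IZR_le _ _ (Zlt_le_succ _ _ (hk_a_pos (s i))).
    have Hdp : (IZR (hk_d (s i)) <= INR p)%R.
    { rewrite INR_IZR_INZ. apply IZR_le. rewrite /hk_d. destruct (Nat.ltb (s i) p); lia. }
    simpl in Ha1.
    apply (Rmult_lt_reg_r (IZR (hk_d (s i)))); first lra.
    replace (IZR (hk_a (s i)) * Im z / IZR (hk_d (s i)) * IZR (hk_d (s i)))%R with (IZR (hk_a (s i)) * Im z)%R by (field; lra).
    destruct (Rle_lt_dec Y0 0); nra. }
  have HBu := HB _ HY. rewrite /autfac in HBu *.
  set u := hk_pt (s i) z in E2 HBu *.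
  have Hdi := Cpow_nz _ k (hk_d_neq_0 i).
  rewrite Cmod_div //.
  (* By [E2] the two automorphy factors differ by d_i / d_(s i), and d_(s i) is at least 1. *)
  have HM : (Cmod ((RtoC (IZR G) * u + RtoC (IZR D)) ^ k) <= Cmod ((RtoC (IZR ga) * z + RtoC (IZR de)) ^ k) * Cmod (RtoC (IZR (hk_d i)) ^ k))%R.
  { rewrite -Cmod_mult -Cpow_mult_l.
    replace ((RtoC (IZR ga) * z + RtoC (IZR de)) * RtoC (IZR (hk_d i))) with
      (RtoC (IZR (hk_d i)) * (RtoC (IZR ga) * z + RtoC (IZR de))) by ring.
    rewrite E2 Cpow_mult_l Cmod_mult.
    have := Cmod_ge_0 ((RtoC (IZR G) * u + RtoC (IZR D)) ^ k).
    have : (1 <= Cmod (RtoC (IZR (hk_d (s i))) ^ k))%R.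
    { rewrite Cmod_pow Cmod_R. apply pow_R1_Rle.
      have Hd1 := IZR_le _ _ (Zlt_le_succ _ _ (hk_d_pos (s i))). simpl in Hd1.
      rewrite Rabs_pos_eq; lra. }
    nra. }
  have Hpos : (0 < Cmod (RtoC (IZR (hk_d i)) ^ k))%R by apply Cmod_gt_0.
  apply (Rmult_le_reg_r (Cmod (RtoC (IZR (hk_d i)) ^ k))); auto.
  rewrite /Rdiv Rmult_assoc Rinv_l ?Rmult_1_r; last lra.
  apply: Rle_trans; first exact HBu.
  have HX := Cmod_ge_0 ((RtoC (IZR G) * u + RtoC (IZR D)) ^ k).
  have HB0 := Rle_abs B0. have HB1 := Rabs_pos B0.
  rewrite Rmult_assoc. apply: (Rle_trans _ (Rabs B0 * Cmod ((RtoC (IZR G) * u + RtoC (IZR D)) ^ k))); first nra.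
  by apply Rmult_le_compat_l. }
have Hunif : forall n, (n <= S p)%nat -> exists B Y : R, forall i, (i < n)%nat -> forall z, (Y < Im z)%R ->
  (Cmod (phi (hk_pt i (mobius al be ga de z)) / RtoC (IZR (hk_d i)) ^ k) <= B * Cmod (autfac ga de k z))%R.
{ elim=> [|n IH] Hn; first by (exists 0%R, 0%R; intros; lia).
  destruct (IH ltac:(lia)) as (B1 & Y1 & H1). destruct (Hterm n ltac:(lia)) as (B2 & Y2 & H2).
  exists (Rmax B1 B2), (Rmax Y1 Y2) => i Hi z Hz.
  have HY1 := Rmax_l Y1 Y2. have HY2 := Rmax_r Y1 Y2.
  have HB1 := Rmax_l B1 B2. have HB2 := Rmax_r B1 B2. have HA := Cmod_ge_0 (autfac ga de k z).
  destruct (Nat.eq_dec i n) as [->|Hne].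
  - have := H2 z ltac:(lra). nra.
  - have := H1 i ltac:(lia) z ltac:(lra). nra. }
destruct (Hunif (S p) (Nat.le_refl _)) as (B & Y & HBY).
exists (INR p ^ k * (INR (S p) * B))%R, Y => z Hz.
rewrite /hecke Cmod_mult Cmod_pow Cmod_R Rabs_pos_eq; last lra.
rewrite !Rmult_assoc. apply Rmult_le_compat_l; first by apply pow_le; lra.
apply Cmod_csum_const => i Hi. by apply HBY.
Qed.

Definition hecke_series (k : nat) (a : series) : series :=
  fun n => (Z.of_nat p * a (p * n)%nat + Z.of_nat p ^ Z.of_nat k * dilate p a n)%Z.

Lemma conv_subseries (a : series) : conv a -> conv (fun n => a (p * n)%nat).
Proof.
intros Ha. have Hp1 := p_pos. apply conv_bounded => rho Hr.
(* With t the p-th root of rho, |a_(pn)| rho^n is a term of the series of absolute values at radius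
   t. *)
set t := Rpower rho (/ INR p).
have HpR : (0 < INR p)%R by apply lt_0_INR; lia.
have Ht : (0 <= t < 1)%R.
{ split; first by left; apply exp_pos. rewrite /t -(Rpower_O rho); last lra.
  rewrite /Rpower. apply exp_increasing. have Hln : (ln rho < 0)%R by rewrite -ln_1; apply ln_increasing; lra.
  have := Rinv_0_lt_compat _ HpR. nra. }
have Htp : (t ^ p = rho)%R.
{ rewrite /t -Rpower_pow; last by apply exp_pos. rewrite Rpower_mult Rinv_l; last lra. apply Rpower_1. lra. }
exists (Series (fun n => Rabs (IZR (a n)) * t ^ n)%R) => n.
have P : forall m, (0 <= Rabs (IZR (a m)) * t ^ m)%R.
{ intros m. apply Rmult_le_pos; [apply Rabs_pos | apply pow_le; lra]. }
apply: Rle_trans; last apply (sum_f_R0_le_Series _ (p * n) P (Ha t Ht)).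
rewrite -Htp -pow_mult. move: (P (p * n)%nat). destruct (p * n)%nat as [|m]; simpl; first lra.
intros _. have := cond_pos_sum _ m P. lra.
Qed.

Lemma conv_hecke_series (k : nat) (a : series) : conv a -> conv (hecke_series k a).
Proof.
intros Ha. have Hp1 := p_pos.
apply (conv_sadd (fun n => Z.of_nat p * a (p * n)%nat)%Z (fun n => Z.of_nat p ^ Z.of_nat k * dilate p a n)%Z).
- apply (conv_scal (Z.of_nat p) (fun n => a (p * n)%nat)); first by intros; lia. by apply conv_subseries.
- apply (conv_scal (Z.of_nat p ^ Z.of_nat k) (dilate p a)); first by intros; lia. apply conv_dilate; auto; lia.
Qed.

Lemma qval_scal (c : Z) (a : series) (z : C) : conv a -> (0 < Im z)%R ->
  qval (fun n => c * a n)%Z z = RtoC (IZR c) * qval a z.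
Proof.
intros Ha Hz. rewrite !qval_CS -CS_scal; last by apply conv_asum.
apply CS_ext => n. rewrite /qpow mult_IZR RtoC_mult. ring.
Qed.

Lemma residue_0 (a : series) : residue p 0 a = dilate p (fun n => a (p * n)%nat).
Proof.
have Hp1 := p_pos. apply functional_extensionality => n. rewrite /residue /dilate Z.sub_0_r -Nat2Z.inj_mod.
destruct (Nat.eqb_spec (n mod p) 0) as [E|E].
- rewrite E /=. f_equal. have := Nat.div_mod_eq n p. lia.
- destruct (Z.eqb_spec (Z.of_nat (n mod p)) 0); [lia | reflexivity].
Qed.

(** The representatives (1 i; 0 p) form the average of [qval_residue] at z / p for the residue class
    0; the last one, (p 0; 0 1), gives the dilation. *)
Lemma hecke_qval (k : nat) (a : series) (z : C) : conv a -> (0 < Im z)%R ->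
  hecke k (qval a) z = qval (hecke_series k a) z.
Proof.
intros Ha Hz. have Hp1 := p_pos. have HpR : (0 < INR p)%R by apply lt_0_INR; lia.
have HpC : RtoC (INR p) <> 0 by intros E; apply RtoC_inj in E; lra.
have Hzp : (0 < Im (z / RtoC (INR p)))%R.
{ have -> : Im (z / RtoC (INR p)) = (Im z / INR p)%R by destruct z; rewrite /Im /=; field; lra.
  by apply Rdiv_lt_0_compat. }
rewrite (qval_sadd (fun n => Z.of_nat p * a (p * n)%nat)%Z (fun n => Z.of_nat p ^ Z.of_nat k * dilate p a n)%Z) //; first last.
- apply (conv_scal (Z.of_nat p ^ Z.of_nat k) (dilate p a)); first by intros; lia. apply conv_dilate; auto; lia.
- apply (conv_scal (Z.of_nat p) (fun n => a (p * n)%nat)); first by intros; lia. by apply conv_subseries.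
- rewrite !qval_scal //; [| apply conv_dilate; auto; lia | by apply conv_subseries].
  rewrite qval_dilate //; last lia.
  have E := qval_residue p 0 a (z / RtoC (INR p)) ltac:(lia) Ha Hzp.
  rewrite residue_0 qval_dilate // in E; [| lia | by apply conv_subseries].
  have Epz : RtoC (INR p) * (z / RtoC (INR p)) = z by field; auto.
  rewrite Epz in E. rewrite -INR_IZR_INZ -E.
  rewrite /hecke /=. rewrite Cmult_plus_distr_l. f_equal.
  + rewrite -csum_scal. apply csum_ext => i Hi.
    have Hlt : Nat.ltb i p = true by apply Nat.ltb_lt.
    rewrite /hk_pt /hk_a /hk_b /hk_d Hlt -!INR_IZR_INZ.
    have Hk := Cpow_nz _ k HpC.
    have -> : RtoC (- 0 / INR p) * RtoC (INR i) = 0 by rewrite /Rdiv Ropp_0 !Rmult_0_l; ring.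
    rewrite qexp_0 Cmult_1_l RtoC_div; last lra.
    have -> : (z + RtoC (INR i)) / RtoC (INR p) = z / RtoC (INR p) + RtoC (INR i) / RtoC (INR p) by field; auto.
    field. auto.
  + rewrite /hk_pt /hk_a /hk_b /hk_d Nat.ltb_irrefl -!INR_IZR_INZ Cpow_1_l -pow_IZR -INR_IZR_INZ RtoC_pow.
    have -> : (RtoC (INR p) * z + 0) / 1 = RtoC (INR p) * z by field. field.
Qed.
End Hecke.

(** * Partial fractions of the cotangent *)

Lemma RtoC_neq_0 (x : R) : x <> 0%R -> RtoC x <> 0.
Proof. intros H E. by apply RtoC_inj in E. Qed.

Lemma clim_inv (u : nat -> C) (l : C) : l <> 0 -> clim u l -> clim (fun n => / u n) (/ l).
Proof.
intros Hl Hu. have Hl0 : (0 < Cmod l)%R by apply Cmod_gt_0.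
have Hu' := Hu. apply is_lim_seq_spec in Hu'.
destruct (Hu' (mkposreal (Cmod l / 2) ltac:(lra))) as [N HN]. simpl in HN.
apply (clim_le_loc _ _ (fun n => (2 / (Cmod l * Cmod l)) * Cmod (u n - l))%R N); last by apply is_lim_seq_scal_0.
intros n Hn. have H1 := HN n Hn. rewrite Rminus_0_r Rabs_pos_eq in H1; last apply Cmod_ge_0.
have H2 : (Cmod l / 2 <= Cmod (u n))%R.
{ have := Cmod_triangle_inv l (u n). rewrite Cmod_minus_sym. lra. }
have Hun : u n <> 0 by apply Cmod_gt_0; lra.
replace (/ u n - / l) with (- (u n - l) * (/ u n * / l)) by (field; auto).
rewrite !Cmod_mult Cmod_opp !Cmod_inv // Rmult_comm.
apply Rmult_le_compat_r; first apply Cmod_ge_0.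
replace (2 / (Cmod l * Cmod l))%R with (/ (Cmod l / 2) * / Cmod l)%R by (field; lra).
apply Rmult_le_compat_r; first by left; apply Rinv_0_lt_compat.
apply Rinv_le_contravar; lra.
Qed.

(** Domination is required only for the indices that occur, k < f j, because the estimates for the
    cotangent hold only for arguments with real part at most 1/2 in absolute value. *)
Lemma clim_dominated_below (u : nat -> nat -> C) (v : nat -> C) (b : nat -> R) (f : nat -> nat) :
  (forall k, clim (fun j => u j k) (v k)) ->
  (forall j k, (k < f j)%nat -> (Cmod (u j k) <= b k)%R) -> ex_series b ->
  (forall k, (0 <= b k)%R) ->
  (forall n, exists J, forall j, (J <= j)%nat -> (n <= f j)%nat) ->
  clim (fun j => csum (u j) (f j)) (CS v) /\ asum v.
Proof.
intros Hlim Hdom Hb Hpos Hf. split.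
- apply (clim_ext (fun j => csum (fun k => if Nat.ltb k (f j) then u j k else 0) (f j))).
  { intros j. apply csum_ext => k Hk. apply Nat.ltb_lt in Hk. by rewrite Hk. }
  apply (clim_dominated _ _ b); auto.
  + intros k. destruct (Hf (S k)) as [J HJ].
    apply (is_lim_seq_ext_loc (fun j => Cmod (u j k - v k))); last by apply Hlim.
    exists J => j Hj. have := HJ j Hj => Hk. apply Nat.ltb_lt in Hk. by rewrite Hk.
  + intros j k. destruct (Nat.ltb_spec k (f j)); auto. by rewrite Cmod_0.
- apply (asum_le _ b) => // k. destruct (Hf (S k)) as [J HJ].
  apply (clim_Cmod_le _ _ _ J (Hlim k)) => j Hj. apply Hdom. have := HJ j Hj. lia.
Qed.

(** * Estimates for e(z) *)

Definition twopii : C := (0, 2 * PI)%R.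

Lemma twopii_neq_0 : twopii <> 0.
Proof. intros E. have := f_equal Im E. rewrite /Im /=. have := PI_RGT_0. lra. Qed.

Lemma exp_taylor_bound (t : R) : (Rabs (exp t - 1 - t) <= t ^ 2 * exp (Rabs t))%R.
Proof.
have H0 := exp_ineq1_le t. rewrite Rabs_pos_eq; last lra.
destruct (Rle_lt_dec 0 t) as [Ht|Ht].
- rewrite Rabs_pos_eq //. have H1 := exp_ineq1_le (- t). rewrite exp_Ropp in H1.
  have H2 := exp_pos t. have H3 : (exp t - 1 <= t * exp t)%R.
  { have : (exp t * (1 + - t) <= exp t * / exp t)%R by apply Rmult_le_compat_l; lra.
    rewrite Rinv_r; lra. }
  nra.
- rewrite Rabs_left //. have H1 := exp_ineq1_le (- t).
  have H2 : (exp t * exp (- t) = 1)%R by rewrite -exp_plus Rplus_opp_r exp_0.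
  have H3 := exp_pos t. have H4 : (exp t * (1 - t) <= 1)%R by nra.
  have H5 : (exp t <= 1 + t + t ^ 2)%R.
  { apply (Rmult_le_reg_r (1 - t)); first lra. nra. }
  have : (1 <= exp (- t))%R by lra. nra.
Qed.

Lemma one_minus_cos_bound (b : R) : (0 <= 1 - cos b <= Rmin (b ^ 2 / 2) 2)%R.
Proof.
have [H1 H2] := COS_bound b. split; first lra. apply Rmin_glb; last lra.
replace b with (2 * (b / 2))%R at 1 by field. rewrite cos_2a_sin.
have Hs : (Rabs (sin (b / 2)) <= Rabs (b / 2))%R.
{ destruct (Rle_lt_dec 0 (b / 2)) as [H|H].
  - rewrite (Rabs_pos_eq (b / 2)) //. apply Rabs_le. destruct (Req_dec (b / 2) 0) as [E|E].
    + rewrite E sin_0. lra.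
    + have := sin_lt_x (b / 2) ltac:(lra). have := SIN_bound (b / 2).
      destruct (Rle_lt_dec (b / 2) 1); last lra. have := sin_ge_0 (b / 2) ltac:(lra).
      have := PI2_1. lra.
  - rewrite (Rabs_left (b / 2)) //. rewrite -Rabs_Ropp -sin_neg. apply Rabs_le.
    have := sin_lt_x (- (b / 2)) ltac:(lra). have := SIN_bound (- (b / 2)).
    destruct (Rle_lt_dec (- (b / 2)) 1); last lra. have := sin_ge_0 (- (b / 2)) ltac:(lra).
    have := PI2_1. lra. }
apply Rsqr_le_abs_1 in Hs. rewrite /Rsqr in Hs. lra.
Qed.

Lemma sin_taylor_bound (b : R) : (Rabs (sin b - b) <= b ^ 2)%R.
Proof.
destruct (MVT_gen (fun x => sin x - x)%R 0 b (fun x => cos x - 1)%R) as [c [Hc E]].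
- intros x _. auto_derive; auto; ring.
- intros x _. apply continuity_pt_minus; [apply continuity_sin | apply derivable_continuous, derivable_id].
- rewrite sin_0 !Rminus_0_r in E. rewrite E Rabs_mult.
  have [H1 H2] := one_minus_cos_bound c.
  have Hm1 := Rmin_l (c ^ 2 / 2) 2. have Hm2 := Rmin_r (c ^ 2 / 2) 2.
  have Hcb : (Rabs c <= Rabs b)%R.
  { move: Hc. rewrite /Rmin /Rmax. destruct (Rle_dec 0 b); intros;
    rewrite /Rabs; destruct (Rcase_abs c); destruct (Rcase_abs b); lra. }
  have H3 : (Rabs (cos c - 1) <= Rabs c)%R.
  { rewrite Rabs_minus_sym Rabs_pos_eq //.
    have Hcc : (c ^ 2 = Rabs c * Rabs c)%R by rewrite -Rabs_mult Rabs_pos_eq; nra.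
    have := Rabs_pos c. destruct (Rle_lt_dec (Rabs c) 2); nra. }
  have Hbb : (b ^ 2 = Rabs b * Rabs b)%R by rewrite -Rabs_mult Rabs_pos_eq; nra.
  have := Rabs_pos b. have := Rabs_pos (cos c - 1). nra.
Qed.

Lemma qexp_taylor : exists K : R, (0 < K)%R /\
  forall w, (Cmod w <= 1)%R -> (Cmod (qexp w - 1 - twopii * w) <= K * Cmod w ^ 2)%R.
Proof.
have Hpi := PI_RGT_0.
exists ((2 * PI) ^ 2 * exp (2 * PI) + (1 + 2 * PI) * (2 * (2 * PI) ^ 2) + (2 * PI) ^ 2)%R.
split. { have := exp_pos (2 * PI). have : (0 < (2 * PI) ^ 2)%R by apply pow_lt; lra. nra. }
intros w Hw.
set a := (- 2 * PI * Im w)%R. set b := (2 * PI * Re w)%R.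
(* With 2 pi i w = a + i b, the error splits as (exp a - 1 - a) exp(i b) + (1 + a)(exp(i b) - 1 - i
   b) + i a b, and each summand is quadratic in w. *)
have E : qexp w - 1 - twopii * w = RtoC (exp a - 1 - a) * (cos b, sin b) +
  RtoC (1 + a) * (cos b - 1, sin b - b)%R + Ci * RtoC (a * b).
{ destruct w as [x y]. rewrite /qexp -/a -/b /twopii.
  apply C_eq; rewrite /a /b /Re /Im /=; ring. }
rewrite E.
have Hy := im_le_Cmod w. have Hx := re_le_Cmod w. have Hw0 := Cmod_ge_0 w.
have Ha : (Rabs a <= 2 * PI * Cmod w)%R.
{ rewrite /a. replace (-2 * PI * Im w)%R with (- (2 * PI * Im w))%R by ring.
  rewrite Rabs_Ropp Rabs_mult (Rabs_pos_eq (2 * PI)); last lra. apply Rmult_le_compat_l; lra. }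
have Hb : (Rabs b <= 2 * PI * Cmod w)%R.
{ rewrite /b Rabs_mult (Rabs_pos_eq (2 * PI)); last lra. apply Rmult_le_compat_l; lra. }
have Ha2 : (a ^ 2 <= (2 * PI) ^ 2 * Cmod w ^ 2)%R.
{ rewrite -Rpow_mult_distr -(pow2_abs a). apply pow_incr. split; auto. apply Rabs_pos. }
have Hb2 : (b ^ 2 <= (2 * PI) ^ 2 * Cmod w ^ 2)%R.
{ rewrite -Rpow_mult_distr -(pow2_abs b). apply pow_incr. split; auto. apply Rabs_pos. }
have Hab : (Rabs (a * b) <= (2 * PI) ^ 2 * Cmod w ^ 2)%R.
{ rewrite Rabs_mult. have := Rabs_pos a. have := Rabs_pos b. nra. }
have T1 : (Cmod (RtoC (exp a - 1 - a) * (cos b, sin b)) <= (2 * PI) ^ 2 * exp (2 * PI) * Cmod w ^ 2)%R.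
{ rewrite Cmod_mult Cmod_R. have -> : Cmod (cos b, sin b) = 1%R.
  { rewrite /Cmod /fst /snd. have H1 := sin2_cos2 b. rewrite -!Rsqr_pow2 Rplus_comm H1. apply sqrt_1. }
  rewrite Rmult_1_r. apply: Rle_trans; first apply exp_taylor_bound.
  have H1 : (exp (Rabs a) <= exp (2 * PI))%R.
  { destruct (Req_dec (Rabs a) (2 * PI)) as [->|Hne]; first lra. left. apply exp_increasing. nra. }
  have := exp_pos (Rabs a). have : (0 <= a ^ 2)%R by nra. nra. }
have T2 : (Cmod (RtoC (1 + a) * (cos b - 1, sin b - b)%R) <= (1 + 2 * PI) * (2 * (2 * PI) ^ 2) * Cmod w ^ 2)%R.
{ rewrite Cmod_mult Cmod_R.
  have H1 : (Rabs (1 + a) <= 1 + 2 * PI)%R.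
  { apply: Rle_trans; first apply Rabs_triang. rewrite Rabs_R1. nra. }
  have H2 : (Cmod (cos b - 1, sin b - b)%R <= 2 * b ^ 2)%R.
  { apply: Rle_trans; first apply Cmod_le_Re_Im. rewrite /Re /Im /fst /snd.
    have := sin_taylor_bound b. have [H3 H4] := one_minus_cos_bound b.
    have := Rmin_l (b ^ 2 / 2) 2. rewrite (Rabs_minus_sym (cos b)) (Rabs_pos_eq (1 - cos b)) //. have : (0 <= b ^ 2)%R by nra. lra. }
  have := Rabs_pos (1 + a). have := Cmod_ge_0 (cos b - 1, sin b - b)%R. nra. }
have T3 : (Cmod (Ci * RtoC (a * b)) <= (2 * PI) ^ 2 * Cmod w ^ 2)%R.
{ by rewrite Cmod_mult Cmod_Ci Cmod_R Rmult_1_l. }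
apply: Rle_trans; first apply Cmod_triangle.
apply: Rle_trans; first by apply Rplus_le_compat_r, Cmod_triangle.
lra.
Qed.

(** A weak form of Jordan's inequality. Up to pi / 3 the cosine is at least 1/2 > 2/5; beyond, sin t
    >= sqrt 3 / 2 > 4/5 while t <= 2. *)
Lemma sin_ge_linear (t : R) : (0 <= t <= PI / 2)%R -> (2 / 5 * t <= sin t)%R.
Proof.
intros Ht. have Hpi := PI_4. have Hp0 := PI_RGT_0.
destruct (Rle_lt_dec t (PI / 3)) as [H|H].
- destruct (MVT_gen (fun x => sin x - x * (2 / 5))%R 0 t (fun x => cos x - 2 / 5)%R) as [c [Hc E]].
  + intros x _. auto_derive; auto; field.
  + intros x _. apply continuity_pt_minus; [apply continuity_sin |].
    apply continuity_pt_mult; [apply derivable_continuous, derivable_id | by apply continuity_pt_const => u v].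
  + rewrite Rmin_left in Hc; last lra. rewrite Rmax_right in Hc; last lra.
    have Hcos : (cos (PI / 3) <= cos c)%R.
    { apply cos_decr_1; lra. }
    rewrite cos_PI3 in Hcos. rewrite sin_0 in E. nra.
- have Hs : (sin (PI / 3) <= sin t)%R by apply sin_incr_1; lra.
  rewrite sin_PI3 in Hs. have := sqrt_pos 3. have := sqrt_sqrt 3 ltac:(lra). nra.
Qed.

(* |1 - e(w)|^2 = (1 - |e(w)|)^2 + 4 |e(w)| sin^2(pi Re w) *)
Lemma one_minus_qexp_lower (w : C) : (Rabs (Re w) <= / 2)%R ->
  (5 * Re w ^ 2 * Cmod (qexp w) <= Cmod (1 - qexp w) ^ 2)%R.
Proof.
intros Hw. have Hpi := PI_RGT_0. have Hp2 := PI2_3_2.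
rewrite Cmod_qexp Cmod2_alt. destruct w as [x y].
rewrite /Re /Im /= in Hw *. rewrite /qexp /Re /Im /=.
set e := exp _.
have He : (0 < e)%R by apply exp_pos.
have Hs : (1 - cos (2 * PI * x) = 2 * sin (PI * x) ^ 2)%R.
{ replace (2 * PI * x)%R with (2 * (PI * x))%R by ring. rewrite cos_2a_sin. ring. }
have Hsc := sin2_cos2 (2 * PI * x). rewrite /Rsqr in Hsc.
have Hb : ((2 / 5 * (PI * x)) ^ 2 <= sin (PI * x) ^ 2)%R.
{ destruct (Rle_lt_dec 0 x) as [Hx|Hx].
  - apply pow_incr. rewrite Rabs_pos_eq in Hw; auto. split; first nra. apply sin_ge_linear. nra.
  - rewrite Rabs_left in Hw; auto.
    replace (sin (PI * x) ^ 2)%R with (sin (PI * - x) ^ 2)%R.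
    + replace ((2 / 5 * (PI * x)) ^ 2)%R with ((2 / 5 * (PI * - x)) ^ 2)%R by field.
      apply pow_incr. split; first nra. apply sin_ge_linear. nra.
    + replace (PI * - x)%R with (- (PI * x))%R by ring. rewrite sin_neg. ring. }
(* From pi > 3, (2 pi / 5)^2 is at least 36/25 > 5/4. Multiplied by 4, this yields the constant 5 of
   the statement. *)
have Hx2 : (5 / 4 * x ^ 2 <= (2 / 5 * (PI * x)) ^ 2)%R.
{ replace ((2 / 5 * (PI * x)) ^ 2)%R with ((2 / 5 * PI) ^ 2 * x ^ 2)%R by field.
  apply Rmult_le_compat_r; nra. }
set c := cos _ in Hs Hsc *. set s := sin (2 * PI * x) in Hsc *.
replace ((1 + - (e * c)) * ((1 + - (e * c)) * 1) + (0 + - (e * s)) * ((0 + - (e * s)) * 1))%R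
  with ((1 - e) ^ 2 + 2 * e * (1 - c) + e ^ 2 * (s * s + c * c - 1))%R by ring.
rewrite Hsc Hs.
have H1 : (e * (5 / 4 * x ^ 2) <= e * sin (PI * x) ^ 2)%R by apply Rmult_le_compat_l; lra.
have H2 := pow2_ge_0 (1 - e). lra.
Qed.

(** These are pi cot(pi z) and, below, pi^2 / sin^2(pi z), written as rational functions of e(z). *)
Definition cotp (z : C) : C := - (twopii / RtoC 2) * ((1 + qexp z) / (1 - qexp z)).
Definition csc2 (z : C) : C := twopii ^ 2 * (qexp z / (1 - qexp z) ^ 2).

Lemma sub_neq_0 (x y : C) : x <> y -> x - y <> 0.
Proof. intros H E. apply H. replace x with (x - y + y) by ring. rewrite E. ring. Qed.

Lemma qexp_double (z : C) : qexp (z / RtoC 2) * qexp (z / RtoC 2) = qexp z.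
Proof. rewrite -qexp_plus. f_equal. field. Qed.

Lemma qexp_half_shift (z : C) : qexp ((z + 1) / RtoC 2) = - qexp (z / RtoC 2).
Proof.
replace ((z + 1) / RtoC 2) with (z / RtoC 2 + / 2) by field.
rewrite qexp_plus qexp_half. ring.
Qed.

Lemma qexp_neq_1_half (z : C) : qexp z <> 1 -> qexp (z / RtoC 2) <> 1 /\ - qexp (z / RtoC 2) <> 1.
Proof.
intros H. split; intros E; apply H; rewrite -qexp_double.
- rewrite E. ring.
- replace (qexp (z / RtoC 2) * qexp (z / RtoC 2)) with ((- qexp (z / RtoC 2)) * (- qexp (z / RtoC 2))) by ring.
  rewrite E. ring.
Qed.

(** With w = e(z / 2), the arguments z / 2 and (z + 1) / 2 correspond to w and - w, and the identity
    is rational in w. This functional equation drives Herglotz's argument. *)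
Lemma cotp_double (z : C) : qexp z <> 1 ->
  cotp z = / RtoC 2 * (cotp (z / RtoC 2) + cotp ((z + 1) / RtoC 2)).
Proof.
intros H. destruct (qexp_neq_1_half z H) as [H1 H2].
rewrite /cotp qexp_half_shift -qexp_double. rewrite -qexp_double in H.
set w := qexp _ in H H1 H2 *.
have N1 : 1 - w <> 0 by apply sub_neq_0; auto.
have N2 : 1 - - w <> 0 by apply sub_neq_0; auto.
have N3 : 1 + w <> 0 by replace (1 + w) with (1 - - w) by ring.
have N4 : 1 - w * w <> 0 by apply sub_neq_0; auto.
field. repeat split; auto. 
Qed.

Lemma csc2_double (z : C) : qexp z <> 1 ->
  csc2 z = / RtoC 4 * (csc2 (z / RtoC 2) + csc2 ((z + 1) / RtoC 2)).
Proof.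
intros H. destruct (qexp_neq_1_half z H) as [H1 H2].
rewrite /csc2 qexp_half_shift -qexp_double. rewrite -qexp_double in H.
set w := qexp _ in H H1 H2 *.
have N1 : 1 - w <> 0 by apply sub_neq_0; auto.
have N2 : 1 - - w <> 0 by apply sub_neq_0; auto.
have N3 : 1 + w <> 0 by replace (1 + w) with (1 - - w) by ring.
have N4 : 1 - w * w <> 0 by apply sub_neq_0; auto.
field. repeat split; auto.
Qed.

Definition dy (j : nat) : R := (2 ^ j)%R.

Lemma dy_pos (j : nat) : (0 < dy j)%R.
Proof. apply pow_lt. lra. Qed.

Lemma dyC_neq_0 (j : nat) : RtoC (dy j) <> 0.
Proof. apply RtoC_neq_0. have := dy_pos j. lra. Qed.

Lemma dy_S (j : nat) : RtoC (dy (S j)) = RtoC 2 * RtoC (dy j).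
Proof. by rewrite -RtoC_mult. Qed.

Lemma INR_pow2 (j : nat) : INR (2 ^ j) = dy j.
Proof. by rewrite pow_INR. Qed.

Lemma qexp_nat_shift (z : C) (n : nat) : qexp (z + INR n) = qexp z.
Proof. by rewrite qexp_plus qexp_INR Cmult_1_r. Qed.

Lemma dup_iter (f : C -> C) (c : C) :
  (forall z, qexp z <> 1 -> f z = c * (f (z / RtoC 2) + f ((z + 1) / RtoC 2))) ->
  forall z, qexp z <> 1 -> forall j,
  f z = c ^ j * csum (fun k => f ((z + INR k) / RtoC (dy j))) (2 ^ j).
Proof.
intros Hdup z Hz. elim=> [|j IH].
- rewrite /= /dy /=. replace ((z + 0) / 1) with z by field. ring.
- rewrite IH Cpow_S. replace (2 ^ S j)%nat with (2 ^ j + 2 ^ j)%nat by (simpl; lia).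
  rewrite csum_add -csum_plus (Cmult_comm c) -Cmult_assoc -(csum_scal c). f_equal.
  apply csum_ext => k Hk.
  have Hn := dyC_neq_0 j.
  rewrite Hdup.
  + rewrite dy_S plus_INR INR_pow2 RtoC_plus. f_equal. f_equal; f_equal; field; auto.
  + intros E. apply Hz. rewrite -(qexp_nat_shift z k).
    replace (z + INR k) with (RtoC (INR (2 ^ j)) * ((z + INR k) / RtoC (dy j))).
    * rewrite qexp_nat E. apply Cpow_1_l.
    * rewrite INR_pow2. field. auto.
Qed.

(** By periodicity the upper half of the 2^(j+1) arguments is moved to the left of 0. For fixed k
    every argument then tends to 0 as j grows, where f is governed by its pole. *)
Lemma dup_pairs (f : C -> C) (c : C) :
  (forall z, qexp z <> 1 -> f z = c * (f (z / RtoC 2) + f ((z + 1) / RtoC 2))) ->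
  (forall z : C, f (z + 1) = f z) ->
  forall z, qexp z <> 1 -> forall j,
  f z = csum (fun k => c ^ S j * (f ((z + INR k) / RtoC (dy (S j))) + f ((z - 1 - INR k) / RtoC (dy (S j))))) (2 ^ j).
Proof.
intros Hdup Hper z Hz j. rewrite (dup_iter f c Hdup z Hz (S j)) csum_scal csum_plus.
replace (2 ^ S j)%nat with (2 ^ j + 2 ^ j)%nat by (simpl; lia).
rewrite csum_add. f_equal. f_equal. rewrite csum_rev. apply csum_ext => k Hk.
rewrite -(Hper ((z - 1 - INR k) / _)). f_equal.
have -> : INR (2 ^ j + (2 ^ j - 1 - k)) = (dy (S j) - 1 - INR k)%R.
{ rewrite plus_INR !minus_INR; try lia. rewrite INR_pow2 /dy /=. lra. }
rewrite !RtoC_minus. field. apply dyC_neq_0.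
Qed.

Lemma is_lim_seq_inv_dy : is_lim_seq (fun j => / dy (S j))%R 0.
Proof.
apply (is_lim_seq_ext (fun j => (/ 2) ^ S j)%R).
- intros j. by rewrite /dy pow_inv.
- apply -> (is_lim_seq_incr_1 (fun j => (/ 2) ^ j)%R). apply is_lim_seq_geom. rewrite Rabs_pos_eq; lra.
Qed.

Lemma clim_inv_dy (u : C) : clim (fun j => u / RtoC (dy (S j))) 0.
Proof.
apply (clim_le _ _ (fun j => Cmod u * / dy (S j))%R).
- intros j. have Hd := dy_pos (S j).
  replace (u / RtoC (dy (S j)) - 0) with (u / RtoC (dy (S j))) by ring.
  rewrite Cmod_div; last apply dyC_neq_0. rewrite Cmod_R Rabs_pos_eq; last lra. lra.
- apply is_lim_seq_scal_0, is_lim_seq_inv_dy.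
Qed.

Lemma clim_qexp_derivative (u : C) :
  clim (fun j => RtoC (dy (S j)) * (1 - qexp (u / RtoC (dy (S j))))) (- (twopii * u)).
Proof.
destruct qexp_taylor as [K [HK H]].
have Hl := clim_inv_dy u. apply is_lim_seq_spec in Hl.
destruct (Hl (mkposreal 1 Rlt_0_1)) as [J HJ]. simpl in HJ.
apply (clim_le_loc _ _ (fun j => K * Cmod u ^ 2 * / dy (S j))%R J).
- intros j Hj. have Hd := dy_pos (S j). have Hn := dyC_neq_0 (S j).
  set w := u / RtoC (dy (S j)).
  have Hw : (Cmod w <= 1)%R.
  { have := HJ j Hj. rewrite Rminus_0_r Rabs_pos_eq; last apply Cmod_ge_0.
    replace (u / RtoC (dy (S j)) - 0) with w by (rewrite /w; ring). lra. }
  replace (RtoC (dy (S j)) * (1 - qexp w) - - (twopii * u)) with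
    (- RtoC (dy (S j)) * (qexp w - 1 - twopii * w)) by (rewrite /w; field; auto).
  rewrite Cmod_mult Cmod_opp Cmod_R Rabs_pos_eq; last lra.
  apply: Rle_trans; first by apply Rmult_le_compat_l; [lra | apply H].
  right. rewrite /w Cmod_div // Cmod_R Rabs_pos_eq; last lra. field. lra.
- apply is_lim_seq_scal_0, is_lim_seq_inv_dy.
Qed.

Lemma clim_qexp_1 (u : C) : clim (fun j => qexp (u / RtoC (dy (S j)))) 1.
Proof.
apply (clim_ext (fun j => 1 - (1 / RtoC (dy (S j))) * (RtoC (dy (S j)) * (1 - qexp (u / RtoC (dy (S j))))))).
- intros j. field. apply dyC_neq_0.
- have H := clim_minus _ _ _ _ (clim_const 1) (clim_mult _ _ _ _ (clim_inv_dy 1) (clim_qexp_derivative u)).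
  by replace (1 - 0 * - (twopii * u)) with (RtoC 1) in H by ring.
Qed.

Lemma neq_0_of_qexp (z : C) (k : Z) : qexp z <> 1 -> z + IZR k <> 0.
Proof.
intros H E. apply H. replace z with (RtoC (IZR (- k))).
- apply qexp_IZR.
- rewrite opp_IZR RtoC_opp. replace z with (z + IZR k - IZR k) by ring. rewrite E. ring.
Qed.

Lemma Cinv_mul (x y : C) : / (x * y) = / x * / y.
Proof.
have H0 : / 0 = 0 by apply C_eq; rewrite /Cinv /Re /Im /=; rewrite ?Ropp_0 /Rdiv !Rmult_0_l.
destruct (Ceq_dec x 0) as [->|Hx]; first by rewrite Cmult_0_l H0 Cmult_0_l.
destruct (Ceq_dec y 0) as [->|Hy]; first by rewrite Cmult_0_r H0 Cmult_0_r.
field. auto.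
Qed.

(** Only the double pole at 0 survives the scaling, because 2^j (1 - e(u / 2^j)) tends to - 2 pi i
    u. *)
Lemma clim_csc2 (u : C) : u <> 0 ->
  clim (fun j => (/ RtoC 4) ^ S j * csc2 (u / RtoC (dy (S j)))) (/ u ^ 2).
Proof.
intros Hu. have Ht := twopii_neq_0.
have Htu : - (twopii * u) <> 0.
{ intros E. apply (Cmult_neq_0 _ _ Ht Hu). replace (twopii * u) with (- - (twopii * u)) by ring. rewrite E. ring. }
apply (clim_ext (fun j => twopii ^ 2 * (qexp (u / RtoC (dy (S j))) *
  (/ (RtoC (dy (S j)) * (1 - qexp (u / RtoC (dy (S j))))) * / (RtoC (dy (S j)) * (1 - qexp (u / RtoC (dy (S j))))))))).
- intros j. rewrite /csc2.
  have -> : (/ RtoC 4) ^ S j = / (RtoC (dy (S j)) * RtoC (dy (S j))).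
  { rewrite -RtoC_mult /dy -Rpow_mult_distr RtoC_pow -Cpow_inv; last by apply RtoC_neq_0; lra.
    by repeat (f_equal; try lra). }
  set q := qexp _. rewrite /Cdiv /= !Cmult_1_r !Cinv_mul. ring.
- replace (/ u ^ 2) with (twopii ^ 2 * (1 * (/ (- (twopii * u)) * / (- (twopii * u))))).
  + apply clim_scal, clim_mult; first apply clim_qexp_1.
    apply clim_mult; apply clim_inv; auto; apply clim_qexp_derivative.
  + field. auto.
Qed.

Lemma clim_cotp (u : C) : u <> 0 ->
  clim (fun j => (/ RtoC 2) ^ S j * cotp (u / RtoC (dy (S j)))) (/ u).
Proof.
intros Hu. have Ht := twopii_neq_0.
have Htu : - (twopii * u) <> 0.
{ intros E. apply (Cmult_neq_0 _ _ Ht Hu). replace (twopii * u) with (- - (twopii * u)) by ring. rewrite E. ring. }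
apply (clim_ext (fun j => - (twopii / RtoC 2) * ((1 + qexp (u / RtoC (dy (S j)))) *
  / (RtoC (dy (S j)) * (1 - qexp (u / RtoC (dy (S j)))))))).
- intros j. rewrite /cotp.
  have -> : (/ RtoC 2) ^ S j = / RtoC (dy (S j)).
  { rewrite /dy RtoC_pow Cpow_inv //. apply RtoC_neq_0; lra. }
  set q := qexp _. rewrite /Cdiv !Cinv_mul. ring.
- replace (/ u) with (- (twopii / RtoC 2) * ((1 + 1) * / (- (twopii * u)))).
  + apply clim_scal, clim_mult; last by apply clim_inv; auto; apply clim_qexp_derivative.
    apply clim_plus; [apply clim_const | apply clim_qexp_1].
  + field. auto.
Qed.

Lemma ex_series_inv_square : ex_series (fun k => / INR (S k) ^ 2)%R.
Proof.
have Hp : forall k, (0 < INR (S k))%R by intros; apply lt_0_INR; lia.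
apply (ex_series_Rle _ (fun k => 2 * (/ INR (S k) - / INR (S (S k))))%R).
- intros k. have H1 := Hp k. rewrite Rabs_pos_eq; last by left; apply Rinv_0_lt_compat, pow_lt.
  rewrite (S_INR (S k)). apply (Rmult_le_reg_r (INR (S k) ^ 2 * (INR (S k) + 1))).
  + apply Rmult_lt_0_compat; [by apply pow_lt | lra].
  + field_simplify; try lra. have : (1 <= INR (S k))%R by rewrite S_INR; have := pos_INR k; lra. nra.
- apply: ex_series_scal_l. exists 1%R.
  change (is_lim_seq (sum_n (fun k => / INR (S k) - / INR (S (S k)))%R) 1).
  apply (is_lim_seq_ext (fun n => 1 - / INR (S (S n)))%R).
  + elim=> [|n IH].
    * rewrite sum_O /=. field.
    * rewrite sum_Sn -IH. rewrite /plus /=. ring.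
  + replace (Finite 1) with (Finite (1 - 0)) by (f_equal; ring).
    apply is_lim_seq_minus'; first apply is_lim_seq_const.
    apply -> (is_lim_seq_incr_1 (fun n => / INR (S n))%R).
    apply -> (is_lim_seq_incr_1 (fun n => / INR n)%R).
    replace (Finite 0) with (Rbar_inv p_infty) by reflexivity.
    apply is_lim_seq_inv; [apply is_lim_seq_INR | discriminate].
Qed.

(** The term k = 0 escapes the lower bounds of type 1 / k^2; its own bound [B0] comes from the
    convergence of that single sequence in j. *)
Definition inv_square_tail (B0 B1 : R) (k : nat) : R :=
  match k with O => B0 | S _ => (B1 * / INR k ^ 2)%R end.

Lemma ex_series_inv_square_tail (B0 B1 : R) : ex_series (inv_square_tail B0 B1).
Proof.
apply ex_series_incr_1. apply: ex_series_scal_l. apply ex_series_inv_square.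
Qed.

(* Herglotz: let the number of duplication steps tend to infinity. *)
Lemma herglotz (f g : C -> C) (c z : C) (B1 : R) :
  (forall z, qexp z <> 1 -> f z = c * (f (z / RtoC 2) + f ((z + 1) / RtoC 2))) ->
  (forall z : C, f (z + 1) = f z) ->
  (forall u : C, u <> 0 -> clim (fun j => c ^ S j * f (u / RtoC (dy (S j)))) (g u)) ->
  qexp z <> 1 ->
  (forall j k, (0 < k < 2 ^ j)%nat ->
    (Cmod (c ^ S j * (f ((z + INR k) / RtoC (dy (S j)))%C + f ((z - 1 - INR k) / RtoC (dy (S j)))%C)) <= B1 * / INR k ^ 2)%R) ->
  (0 <= B1)%R ->
  cser (fun k => g (z + INR k) + g (z - 1 - INR k)) (f z).
Proof.
intros Hdup Hper Hlim Hz Hb HB1.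
have HN : forall k, z + INR k <> 0.
{ intros k. rewrite INR_IZR_INZ. by apply neq_0_of_qexp. }
have HN' : forall k, z - 1 - INR k <> 0.
{ intros k. replace (z - 1 - INR k) with (z + IZR (- 1 - Z.of_nat k)); first by apply neq_0_of_qexp.
  rewrite minus_IZR RtoC_minus -INR_IZR_INZ. ring. }
have Hk : forall k, clim (fun j => c ^ S j * (f ((z + INR k) / RtoC (dy (S j)))%C + f ((z - 1 - INR k) / RtoC (dy (S j)))%C))
   (g (z + INR k) + g (z - 1 - INR k)).
{ intros k. apply (clim_ext (fun j => c ^ S j * f ((z + INR k) / RtoC (dy (S j)))%C + c ^ S j * f ((z - 1 - INR k) / RtoC (dy (S j)))%C)).
  - intros j. ring.
  - exact (clim_plus _ _ _ _ (Hlim _ (HN k)) (Hlim _ (HN' k))). }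
have H0 : exists B0, forall j, (Cmod (c ^ S j * (f ((z + INR 0) / RtoC (dy (S j)))%C + f ((z - 1 - INR 0) / RtoC (dy (S j)))%C)) <= B0)%R.
{ set l := g (z + INR 0) + g (z - 1 - INR 0).
  destruct (is_lim_seq_bounded _ _ (Hk 0%nat)) as [B HB]. exists (B + Cmod l)%R => j.
  have := HB j. rewrite Rabs_pos_eq; last apply Cmod_ge_0. have := Cmod_triangle_inv (c ^ S j * (f ((z + INR 0) / RtoC (dy (S j)))%C + f ((z - 1 - INR 0) / RtoC (dy (S j)))%C)) l. rewrite /l. lra. }
destruct H0 as [B0 HB0].
destruct (clim_dominated_below
  (fun j k => c ^ S j * (f ((z + INR k) / RtoC (dy (S j)))%C + f ((z - 1 - INR k) / RtoC (dy (S j)))%C))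
  (fun k => g (z + INR k) + g (z - 1 - INR k)) (inv_square_tail B0 B1) (fun j => 2 ^ j)%nat) as [H1 H2]; auto.
- intros j [|k] Hkj; [apply HB0 | apply Hb; lia].
- apply ex_series_inv_square_tail.
- intros [|k].
  + apply: Rle_trans (HB0 0%nat). apply Cmod_ge_0.
  + change (0 <= B1 * / INR (S k) ^ 2)%R. apply Rmult_le_pos; auto. left. apply Rinv_0_lt_compat, pow_lt, lt_0_INR. lia.
- intros n. exists n => j Hj. have := Nat.pow_gt_lin_r 2 j ltac:(lia). lia.
- have E : CS (fun k => g (z + INR k) + g (z - 1 - INR k)) = f z.
  { apply (clim_unique _ _ _ H1). apply (clim_ext (fun _ => f z)); last apply clim_const.
    intros j. by apply dup_pairs. }
  rewrite -E. by apply CS_cser.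
Qed.

Section Strip.
Variable z : C.
Hypotheses (Hz : (0 <= Re z <= 1)%R) (Hq : qexp z <> 1).

(** For 0 <= Re z <= 1 the real parts of z + k and z - 1 - k have absolute value between k and k +
    1. As k + 1 <= 2^j, the arguments stay within 1/2 of the imaginary axis. *)
Lemma strip_bounds (j k : nat) : (0 < k < 2 ^ j)%nat ->
  let a := (z + INR k) / RtoC (dy (S j)) in let b := (z - 1 - INR k) / RtoC (dy (S j)) in
  (5 * INR k ^ 2 / dy (S j) ^ 2 * Cmod (qexp a) <= Cmod (1 - qexp a) ^ 2)%R /\
  (5 * INR k ^ 2 / dy (S j) ^ 2 * Cmod (qexp b) <= Cmod (1 - qexp b) ^ 2)%R.
Proof.
intros Hk a b. have Hd := dy_pos (S j).
have Hk1 : (INR k + 1 <= dy (S j) / 2)%R.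
{ have -> : (dy (S j) / 2 = dy j)%R by rewrite /dy /=; field.
  rewrite -INR_pow2 -S_INR. apply le_INR. lia. }
have Hk0 : (0 <= INR k)%R by apply pos_INR.
have Ra : (Re a = (Re z + INR k) / dy (S j))%R.
{ rewrite /a. destruct z. rewrite /Re /=. field. lra. }
have Rb : (Re b = (Re z - 1 - INR k) / dy (S j))%R.
{ rewrite /b. destruct z. rewrite /Re /=. field. lra. }
have G : forall w x, (Re w = x / dy (S j))%R -> (INR k <= Rabs x)%R -> (Rabs x <= INR k + 1)%R ->
  (5 * INR k ^ 2 / dy (S j) ^ 2 * Cmod (qexp w) <= Cmod (1 - qexp w) ^ 2)%R.
{ intros w x Hw H1 H2. apply: Rle_trans; last apply one_minus_qexp_lower.
  - apply Rmult_le_compat_r; first apply Cmod_ge_0. rewrite Hw.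
    rewrite /Rdiv Rmult_assoc. apply Rmult_le_compat_l; first lra.
    rewrite Rpow_mult_distr -pow_inv. apply Rmult_le_compat_r.
    + apply pow_le. left. by apply Rinv_0_lt_compat.
    + rewrite -(pow2_abs x). apply pow_incr. lra.
  - rewrite Hw Rabs_div; last lra. rewrite (Rabs_pos_eq (dy (S j))); last lra.
    apply (Rmult_le_reg_r (dy (S j))); first lra. field_simplify; lra. }
split.
- apply (G a _ Ra); rewrite Rabs_pos_eq; lra.
- apply (G b _ Rb); rewrite Rabs_left1; lra.
Qed.

Lemma csc2_strip : cser (fun k => / (z + INR k) ^ 2 + / (z - 1 - INR k) ^ 2) (csc2 z).
Proof.
apply (herglotz csc2 (fun u => / u ^ 2) (/ RtoC 4) z (2 * Cmod (twopii ^ 2))); auto.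
- apply csc2_double.
- intros w. by rewrite /csc2 qexp_plus qexp_1 Cmult_1_r.
- apply clim_csc2.
- intros j k Hk. destruct (strip_bounds j k Hk) as [H1 H2]. simpl in H1, H2.
  have Hd := dy_pos (S j). have Hkp : (0 < INR k)%R by apply lt_0_INR; lia.
  have -> : (/ RtoC 4) ^ S j = RtoC (/ dy (S j) ^ 2).
  { rewrite /dy -pow_mult Nat.mul_comm pow_mult RtoC_inv; last by apply pow_nonzero; lra.
    rewrite Cpow_inv; last by apply RtoC_neq_0; lra. by rewrite RtoC_pow; repeat f_equal; lra. }
  rewrite Cmod_mult Cmod_R Rabs_pos_eq; last by left; apply Rinv_0_lt_compat, pow_lt.
  have G : forall w, (5 * INR k ^ 2 / dy (S j) ^ 2 * Cmod (qexp w) <= Cmod (1 - qexp w) ^ 2)%R ->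
    (Cmod (csc2 w) <= Cmod (twopii ^ 2) * (dy (S j) ^ 2 * / INR k ^ 2))%R.
  { intros w Hw. have Hqw : (0 < Cmod (qexp w))%R by apply Cmod_gt_0, qexp_neq_0.
    have Hpos : (0 < 5 * INR k ^ 2 / dy (S j) ^ 2 * Cmod (qexp w))%R.
    { apply Rmult_lt_0_compat; auto. apply Rdiv_lt_0_compat; [|by apply pow_lt].
      apply Rmult_lt_0_compat; [lra | by apply pow_lt]. }
    have Hne : 1 - qexp w <> 0.
    { intros E. rewrite E Cmod_0 in Hw. lra. }
    rewrite /csc2 Cmod_mult. apply Rmult_le_compat_l; first apply Cmod_ge_0.
    rewrite Cmod_div; last by apply Cpow_nz.
    rewrite Cmod_pow. have Hc : (0 < Cmod (1 - qexp w) ^ 2)%R by lra.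
    apply (Rmult_le_reg_r (Cmod (1 - qexp w) ^ 2)); auto.
    rewrite /Rdiv Rmult_assoc Rinv_l ?Rmult_1_r; last lra.
    apply (Rmult_le_reg_l (INR k ^ 2 / dy (S j) ^ 2)); first by apply Rdiv_lt_0_compat; apply pow_lt.
    replace (INR k ^ 2 / dy (S j) ^ 2 * (dy (S j) ^ 2 * / INR k ^ 2 * Cmod (1 - qexp w) ^ 2))%R
      with (Cmod (1 - qexp w) ^ 2)%R by (field; lra).
    have : (0 < INR k ^ 2 / dy (S j) ^ 2 * Cmod (qexp w))%R.
    { apply Rmult_lt_0_compat; auto. by apply Rdiv_lt_0_compat; apply pow_lt. }
    lra. }
  have Ga := G _ H1. have Gb := G _ H2.
  have Hi : (0 < / dy (S j) ^ 2)%R by apply Rinv_0_lt_compat, pow_lt.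
  apply: Rle_trans; first by apply Rmult_le_compat_l; [lra | apply Cmod_triangle].
  replace (2 * Cmod (twopii ^ 2) * / INR k ^ 2)%R with
    (/ dy (S j) ^ 2 * (Cmod (twopii ^ 2) * (dy (S j) ^ 2 * / INR k ^ 2) + Cmod (twopii ^ 2) * (dy (S j) ^ 2 * / INR k ^ 2)))%R
    by (field; lra).
  apply Rmult_le_compat_l; lra.
- have := Cmod_ge_0 (twopii ^ 2). lra.
Qed.

(** A single term decays only like 1 / k, so the two terms of a pair must be combined: cot a + cot b
    equals, up to a constant, (1 - e(a + b)) / ((1 - e(a))(1 - e(b))). Since a + b = (2 z - 1) /
    2^(j+1) is free of k, the numerator is of order 2^(-j), and the denominator supplies k^2. *)
Lemma cotp_strip : cser (fun k => / (z + INR k) + / (z - 1 - INR k)) (cotp z).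
Proof.
destruct (is_lim_seq_bounded _ _ (clim_qexp_derivative (RtoC 2 * z - 1))) as [B HB].
set B' := (B + Cmod (- (twopii * (RtoC 2 * z - 1))))%R.
have HB' : forall j, (dy (S j) * Cmod (1 - qexp ((RtoC 2 * z - 1) / RtoC (dy (S j)))) <= B')%R.
{ intros j. have := HB j. rewrite Rabs_pos_eq; last apply Cmod_ge_0.
  have := Cmod_triangle_inv (RtoC (dy (S j)) * (1 - qexp ((RtoC 2 * z - 1) / RtoC (dy (S j))))) (- (twopii * (RtoC 2 * z - 1))).
  rewrite Cmod_mult Cmod_R (Rabs_pos_eq (dy (S j))); last by left; apply dy_pos.
  rewrite /B'. lra. }
have HB0 : (0 <= B')%R.
{ apply: Rle_trans (HB' 0%nat). apply Rmult_le_pos; [left; apply dy_pos | apply Cmod_ge_0]. }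
(* A lower bound for |e(a)| and |e(b)|, uniform in j because |Im a| and |Im b| are at most |Im
   z|. *)
set c0 := exp (- (2 * PI * Rabs (Im z))).
have Hc0 : (0 < c0)%R by apply exp_pos.
apply (herglotz cotp (fun u => / u) (/ RtoC 2) z (Cmod twopii * (B' / (5 * c0)))); auto.
- apply cotp_double.
- intros w. by rewrite /cotp qexp_plus qexp_1 Cmult_1_r.
- apply clim_cotp.
- intros j k Hk. destruct (strip_bounds j k Hk) as [H1 H2]. simpl in H1, H2.
  have Hd := dy_pos (S j). have Hkp : (0 < INR k)%R by apply lt_0_INR; lia.
  have Hd1 : (1 <= dy (S j))%R by apply pow_R1_Rle; lra.
  have -> : (/ RtoC 2) ^ S j = RtoC (/ dy (S j)).
  { rewrite /dy RtoC_inv; last by apply pow_nonzero; lra.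
    rewrite Cpow_inv; last by apply RtoC_neq_0; lra. by rewrite RtoC_pow. }
  have G : forall w, (Im w = Im z / dy (S j))%R -> (5 * INR k ^ 2 / dy (S j) ^ 2 * Cmod (qexp w) <= Cmod (1 - qexp w) ^ 2)%R ->
     (5 * INR k ^ 2 / dy (S j) ^ 2 * c0 <= Cmod (1 - qexp w) ^ 2)%R.
  { intros w Hw Hw2. apply: Rle_trans; last exact Hw2.
    apply Rmult_le_compat_l.
    - apply Rmult_le_pos; [|left; apply Rinv_0_lt_compat, pow_lt; auto]. have : (0 <= INR k ^ 2)%R by apply pow_le; lra. lra.
    - rewrite Cmod_qexp Hw /c0.
      have Hle : (- (2 * PI * Rabs (Im z)) <= -2 * PI * (Im z / dy (S j)))%R.
      { have Hpi := PI_RGT_0. have : (Im z / dy (S j) <= Rabs (Im z))%R; last nra.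
        apply: Rle_trans; first apply Rle_abs. rewrite Rabs_div; last lra. rewrite (Rabs_pos_eq (dy _)); last lra.
        apply (Rmult_le_reg_r (dy (S j))); first lra. field_simplify; last lra. have := Rabs_pos (Im z). nra. }
      destruct Hle as [Hlt|Heq]; [left; by apply exp_increasing | rewrite Heq; lra]. }
  set a := (z + INR k) / RtoC (dy (S j)) in H1 *. set b := (z - 1 - INR k) / RtoC (dy (S j)) in H2 *.
  have Ia : (Im a = Im z / dy (S j))%R by rewrite /a; destruct z; rewrite /Im /=; field; lra.
  have Ib : (Im b = Im z / dy (S j))%R by rewrite /b; destruct z; rewrite /Im /=; field; lra.
  have Ga := G _ Ia H1. have Gb := G _ Ib H2.
  set t := (5 * INR k ^ 2 / dy (S j) ^ 2 * c0)%R in Ga Gb.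
  have Ht : (0 < t)%R.
  { apply Rmult_lt_0_compat; auto. apply Rdiv_lt_0_compat; [|by apply pow_lt].
    apply Rmult_lt_0_compat; [lra | by apply pow_lt]. }
  have Hna : 1 - qexp a <> 0 by intros E; rewrite E Cmod_0 /= in Ga; lra.
  have Hnb : 1 - qexp b <> 0 by intros E; rewrite E Cmod_0 /= in Gb; lra.
  have E : cotp a + cotp b = - twopii * ((1 - qexp ((RtoC 2 * z - 1) / RtoC (dy (S j)))) / ((1 - qexp a) * (1 - qexp b))).
  { have -> : (RtoC 2 * z - 1) / RtoC (dy (S j)) = a + b by rewrite /a /b; field; apply dyC_neq_0.
    rewrite qexp_plus /cotp. field. auto. }
  rewrite E !Cmod_mult Cmod_opp Cmod_R Rabs_pos_eq; last by left; apply Rinv_0_lt_compat.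
  rewrite Cmod_inv; last by apply Cmult_neq_0.
  rewrite Cmod_mult.
  have Hprod : (t <= Cmod (1 - qexp a) * Cmod (1 - qexp b))%R.
  { have Pa := Cmod_ge_0 (1 - qexp a). have Pb := Cmod_ge_0 (1 - qexp b).
    apply Rsqr_incr_0; [|lra|by apply Rmult_le_pos].
    rewrite Rsqr_mult !Rsqr_pow2. have : (t * t <= Cmod (1 - qexp a) ^ 2 * Cmod (1 - qexp b) ^ 2)%R by apply Rmult_le_compat; lra. lra. }
  have HX := HB' j. set X := Cmod (1 - qexp ((RtoC 2 * z - 1) / RtoC (dy (S j)))) in HX *.
  have HX0 : (0 <= X)%R by apply Cmod_ge_0.
  set Y := (Cmod (1 - qexp a) * Cmod (1 - qexp b))%R in Hprod *.
  have HXY : (X / Y <= (B' / dy (S j)) / t)%R.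
  { apply Rmult_le_compat; auto.
    - left. apply Rinv_0_lt_compat. lra.
    - apply (Rmult_le_reg_r (dy (S j))); auto. field_simplify; lra.
    - by apply Rinv_le_contravar. }
  replace (Cmod twopii * (B' / (5 * c0)) * / INR k ^ 2)%R with
    (/ dy (S j) * (Cmod twopii * (B' / dy (S j) / t)))%R by (rewrite /t; field; lra).
  apply Rmult_le_compat_l; first by left; apply Rinv_0_lt_compat.
  apply Rmult_le_compat_l; auto. apply Cmod_ge_0.
- apply Rmult_le_pos; first apply Cmod_ge_0. apply Rmult_le_pos; auto. left. apply Rinv_0_lt_compat. lra.
Qed.
End Strip.

(** * From the strip to all arguments, with symmetric pairs *)

Section Symmetric.
Variable g : C -> C.
Hypothesis Hg1 : forall z, clim (fun k => g (z + INR k)) 0.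
Hypothesis Hg2 : forall z, clim (fun k => g (z - INR k)) 0.

Definition pairsum (z : C) (K : nat) : C := csum (fun k => g (z + INR k)%C + g (z - 1 - INR k)%C) K.

Lemma pairsum_shift (z : C) (K : nat) :
  pairsum (z + 1) K = pairsum z K + g (z + INR K) - g (z - INR K).
Proof.
elim: K => [|K IH].
- rewrite /pairsum /=. replace (z + 0) with z by ring. replace (z - 0) with z by ring. ring.
- rewrite /pairsum in IH *. rewrite !csum_S IH !S_INR !RtoC_plus.
  replace (z + 1 - 1 - INR K) with (z - INR K) by ring.
  replace (z + 1 + INR K) with (z + (INR K + 1)) by ring.
  replace (z - 1 - INR K) with (z - (INR K + 1)) by ring. ring.
Qed.

Lemma pairsum_sym (z : C) (K : nat) :
  csum (fun k => g (z + INR (S k)) + g (z - INR (S k)))%C K = pairsum z K + g (z + INR K) - g z.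
Proof.
elim: K => [|K IH].
- rewrite /pairsum /=. replace (z + 0) with z by ring. ring.
- rewrite /pairsum in IH *. rewrite !csum_S IH !S_INR !RtoC_plus.
  replace (z - 1 - INR K) with (z - (INR K + 1)) by ring. ring.
Qed.

Lemma pairsum_limit_shift (z l : C) :
  clim (pairsum z) l <-> clim (pairsum (z + 1)) l.
Proof.
split => H.
- apply (clim_ext (fun K => pairsum z K + g (z + INR K) - g (z - INR K))); first by intros; rewrite pairsum_shift.
  replace l with (l + 0 - 0) by ring. by apply clim_minus; [apply clim_plus|].
- apply (clim_ext (fun K => pairsum (z + 1) K - g (z + INR K) + g (z - INR K))).
  + intros K. rewrite pairsum_shift. ring.
  + replace l with (l - 0 + 0) by ring. by apply clim_plus; [apply clim_minus|].
Qed.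

(** A shift of z by 1 alters the partial sums by boundary terms that tend to 0, so the expansion
    spreads from the strip by induction on the integer part. A boundary term also accounts for
    regrouping the pairs as z + k, z - k. *)
Lemma pairsum_all (f : C -> C) :
  (forall z, f (z + 1) = f z) ->
  (forall z, (0 <= Re z <= 1)%R -> qexp z <> 1 -> clim (pairsum z) (f z)) ->
  forall z, qexp z <> 1 ->
  clim (fun K => csum (fun k => g (z + INR (S k)) + g (z - INR (S k)))%C K) (f z - g z).
Proof.
intros Hf Hstrip z Hz.
have Hnat : forall n w, qexp w <> 1 -> (0 <= Re w + INR n <= 1 \/ 0 <= Re w - INR n <= 1)%R -> clim (pairsum w) (f w).
{ elim=> [|n IH] w Hw Hr.
  - apply Hstrip; auto. simpl in Hr. lra.
  - rewrite S_INR in Hr. destruct Hr as [Hr|Hr].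
    + apply pairsum_limit_shift. rewrite -Hf. apply IH.
      * by rewrite qexp_plus qexp_1 Cmult_1_r.
      * left. destruct w as [x y]. rewrite /Re /= in Hr *. lra.
    + replace w with ((w - 1) + 1) by ring. apply -> pairsum_limit_shift. rewrite Hf. apply IH.
      * intros E. apply Hw. replace w with ((w - 1) + 1) by ring. by rewrite qexp_plus qexp_1 Cmult_1_r.
      * right. destruct w as [x y]. rewrite /Re /= in Hr *. lra. }
have Hl : clim (pairsum z) (f z).
{ destruct (archimed (Re z)) as [H1 H2].
  destruct (Z_le_gt_dec 0 (up (Re z) - 1)) as [Hp|Hp].
  - apply (Hnat (Z.to_nat (up (Re z) - 1))); auto. right.
    rewrite INR_IZR_INZ Z2Nat.id // minus_IZR. lra.
  - apply (Hnat (Z.to_nat (1 - up (Re z)))); auto. left.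
    rewrite INR_IZR_INZ Z2Nat.id ?minus_IZR; [lra | lia]. }
apply (clim_ext (fun K => pairsum z K + g (z + INR K) - g z)); first by intros; rewrite pairsum_sym.
replace (f z - g z) with (f z + 0 - g z) by ring.
apply clim_minus; last apply clim_const. by apply clim_plus.
Qed.
End Symmetric.

Lemma is_lim_seq_inv_INR : is_lim_seq (fun k => / INR k)%R 0.
Proof.
replace (Finite 0) with (Rbar_inv p_infty) by reflexivity.
apply is_lim_seq_inv; [apply is_lim_seq_INR | discriminate].
Qed.

Lemma clim_inv_shift (z : C) : clim (fun k => / (z + INR k)) 0.
Proof.
destruct (INR_unbounded (2 * Cmod z + 1)) as [N HN].
apply (clim_le_loc _ _ (fun k => 2 * / INR k)%R N); last by apply is_lim_seq_scal_0, is_lim_seq_inv_INR.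
intros k Hk. have Hk' := le_INR _ _ Hk. have Hz := Cmod_ge_0 z.
have Hm : (INR k / 2 <= Cmod (z + INR k))%R.
{ have := Cmod_triangle_inv (INR k) (- z). rewrite Cmod_R Cmod_opp Rabs_pos_eq; last lra.
  replace (INR k - - z) with (z + INR k) by ring. lra. }
have Hn : z + INR k <> 0 by apply Cmod_gt_0; lra.
replace (/ (z + INR k) - 0) with (/ (z + INR k)) by ring. rewrite Cmod_inv //.
replace (2 * / INR k)%R with (/ (INR k / 2))%R by (field; lra). apply Rinv_le_contravar; lra.
Qed.

Lemma clim_inv_shift_neg (z : C) : clim (fun k => / (z - INR k)) 0.
Proof.
apply (clim_ext (fun k => - (1) * / (- z + INR k))).
- intros k. replace (z - INR k) with (- (1) * (- z + INR k)) by ring. rewrite Cinv_mul.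
  f_equal. field.
- replace (RtoC 0) with (- (1) * 0) by ring. apply clim_scal, clim_inv_shift.
Qed.

Lemma clim_sq_0 (u : nat -> C) : clim u 0 -> clim (fun k => u k ^ 2) 0.
Proof.
intros H. apply (clim_ext (fun k => u k * u k)); first by intros; simpl; ring.
replace (RtoC 0) with (0 * 0) by ring. by apply clim_mult.
Qed.

Lemma Cinv_sq (z : C) : / z ^ 2 = (/ z) ^ 2.
Proof. by rewrite /= !Cmult_1_r Cinv_mul. Qed.

Lemma Im_pos_qexp (z : C) : (0 < Im z)%R -> qexp z <> 1.
Proof.
intros H E. have := exp_im_range z H. rewrite -Cmod_qexp E Cmod_1. lra.
Qed.

Lemma csc2_sum (z : C) : qexp z <> 1 ->
  clim (csum (fun k => / (z + INR (S k)) ^ 2 + / (z - INR (S k)) ^ 2)) (csc2 z - / z ^ 2).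
Proof.
apply (pairsum_all (fun u => / u ^ 2)).
- intros w. apply (clim_ext (fun k => (/ (w + INR k)) ^ 2)); first by intros; rewrite Cinv_sq.
  apply clim_sq_0, clim_inv_shift.
- intros w. apply (clim_ext (fun k => (/ (w - INR k)) ^ 2)); first by intros; rewrite Cinv_sq.
  apply clim_sq_0, clim_inv_shift_neg.
- intros w. by rewrite /csc2 qexp_plus qexp_1 Cmult_1_r.
- intros w Hw Hq. by apply csc2_strip.
Qed.

Lemma cotp_sum (z : C) : qexp z <> 1 ->
  clim (csum (fun k => / (z + INR (S k)) + / (z - INR (S k)))) (cotp z - / z).
Proof.
apply (pairsum_all (fun u => / u)).
- apply clim_inv_shift.
- apply clim_inv_shift_neg.
- intros w. by rewrite /cotp qexp_plus qexp_1 Cmult_1_r.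
- intros w Hw Hq. by apply cotp_strip.
Qed.

(** * The value of zeta(2), and the series of sigma as a sum of cosecants *)

Definition zeta2 : C := CS (fun k => / RtoC (INR (S k)) ^ 2).

Lemma INR_S_neq_0 (k : nat) : RtoC (INR (S k)) <> 0.
Proof. apply RtoC_neq_0, not_0_INR. lia. Qed.

Lemma Cmod_inv_square (k : nat) : Cmod (/ RtoC (INR (S k)) ^ 2) = (/ INR (S k) ^ 2)%R.
Proof.
rewrite Cmod_inv; last by apply Cpow_nz, INR_S_neq_0.
rewrite Cmod_pow Cmod_R Rabs_pos_eq //. apply pos_INR.
Qed.

Lemma asum_zeta2 : asum (fun k => / RtoC (INR (S k)) ^ 2).
Proof.
apply (asum_le _ (fun k => / INR (S k) ^ 2)%R); last apply ex_series_inv_square.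
intros k. rewrite Cmod_inv_square. lra.
Qed.

(* The partial fraction expansion at z = 1/2 sums the odd terms. *)
Lemma zeta2_value : zeta2 = - (twopii ^ 2 / RtoC 24).
Proof.
have Hq : qexp (/ RtoC 2) <> 1.
{ rewrite qexp_half => E. have := f_equal Re E. rewrite /Re /=. lra. }
have H2 : RtoC (/ 2) = / RtoC 2 by rewrite RtoC_inv; lra || auto.
have Hre : (0 <= Re (/ RtoC 2) <= 1)%R by rewrite -H2 /Re /=; lra.
have H := csc2_strip (/ RtoC 2) Hre Hq.
have Hodd : clim (csum (fun k => / RtoC (INR (2 * k + 1)) ^ 2)) (csc2 (/ RtoC 2) / RtoC 8).
{ apply (clim_ext (fun K => / RtoC 8 * csum (fun k => / (/ RtoC 2 + INR k) ^ 2 + / (/ RtoC 2 - 1 - INR k) ^ 2) K)).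
  - intros K. rewrite -csum_scal. apply csum_ext => k _.
    have Hn : RtoC (INR (2 * k + 1)) <> 0 by apply RtoC_neq_0, not_0_INR; lia.
    have E : RtoC (INR (2 * k + 1)) = RtoC 2 * INR k + 1 by rewrite plus_INR mult_INR RtoC_plus RtoC_mult /=.
    have -> : / RtoC 2 + INR k = RtoC (INR (2 * k + 1)) / RtoC 2 by rewrite E; field.
    have -> : / RtoC 2 - 1 - INR k = - (RtoC (INR (2 * k + 1)) / RtoC 2) by rewrite E; field.
    field. auto.
  - rewrite /Cdiv Cmult_comm. by apply clim_scal. }
have HZ : clim (fun K => csum (fun k => / RtoC (INR (S k)) ^ 2) (2 * K)) zeta2.
{ apply clim_subseq; first by intros; lia. apply CS_cser, asum_zeta2. }
have HZ2 : clim (fun K => csum (fun k => / RtoC (INR (S k)) ^ 2) (2 * K)) (csc2 (/ RtoC 2) / RtoC 8 + / RtoC 4 * zeta2).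
{ apply (clim_ext (fun K => csum (fun k => / RtoC (INR (2 * k + 1)) ^ 2) K + / RtoC 4 * csum (fun k => / RtoC (INR (S k)) ^ 2) K)).
  - elim=> [|K IH]; first by simpl; ring.
    replace (2 * S K)%nat with (S (S (2 * K))) by lia.
    rewrite !csum_S -IH.
    replace (S (2 * K)) with (2 * K + 1)%nat by lia.
    replace (S (2 * K + 1)) with (2 * S K)%nat by lia.
    rewrite (mult_INR 2) RtoC_mult. have := INR_S_neq_0 K. intros.
    have Hn : RtoC (INR (2 * K + 1)) <> 0 by apply RtoC_neq_0, not_0_INR; lia.
    change (RtoC (INR 2)) with (RtoC 2). field. auto.
  - apply clim_plus; auto. apply clim_scal. apply CS_cser, asum_zeta2. }
have E := clim_unique _ _ _ HZ HZ2.
have E2 : zeta2 = csc2 (/ RtoC 2) / RtoC 6.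
{ replace (csc2 (/ RtoC 2)) with (RtoC 8 * (csc2 (/ RtoC 2) / RtoC 8)) by field.
  replace (csc2 (/ RtoC 2) / RtoC 8) with (zeta2 - / RtoC 4 * zeta2) by (rewrite {1}E; ring). field. }
rewrite E2 /csc2 qexp_half. field.
Qed.

Definition sid : series := fun n => Z.of_nat n.

Definition sones : series := fun _ => 1%Z.

Lemma conv_sones : conv sones.
Proof.
apply conv_bounded => rho Hr. exists 1%R => n. rewrite /sones Rabs_R1 Rmult_1_l -(pow1 n).
apply pow_incr. lra.
Qed.

Lemma sid_sones : sid = smul sX (smul sones sones).
Proof.
apply functional_extensionality => [[|n]]; first by rewrite smul_coef0.
rewrite sX_mul /smul /sones /sid (zsum_ext _ (fun _ => 1%Z)); last by [].
elim: n => [|n IH] //. change (zsum ?f (S ?n)) with (zsum f n + f n)%Z. rewrite -IH. lia.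
Qed.

Lemma conv_sid : conv sid.
Proof. rewrite sid_sones. repeat apply conv_smul; [apply conv_sX | apply conv_sones..]. Qed.

Lemma conv_coef_bounded (a : series) (rho : R) : conv a -> (0 <= rho < 1)%R ->
  exists K, forall n, (Rabs (IZR (a n)) * rho ^ n <= K)%R.
Proof.
intros Ha Hr. destruct (is_lim_seq_bounded _ _ (ex_series_lim_0 _ (Ha rho Hr))) as [K HK].
exists K => n. apply: Rle_trans (HK n). apply Rle_abs.
Qed.

Definition sD (a : series) : series := fun n => (Z.of_nat n * a n)%Z.

Lemma conv_sD (a : series) : conv a -> conv (sD a).
Proof.
intros Ha. apply conv_bounded => rho Hr.
have Hs : (0 <= sqrt rho < 1)%R.
{ split; first apply sqrt_pos. rewrite -sqrt_1. apply sqrt_lt_1; lra. }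
destruct (conv_coef_bounded a _ Ha Hs) as [K1 HK1].
destruct (conv_coef_bounded sid _ conv_sid Hs) as [K2 HK2].
exists (K2 * K1)%R => n. rewrite /sD mult_IZR Rabs_mult.
have -> : (rho ^ n = sqrt rho ^ n * sqrt rho ^ n)%R by rewrite -Rpow_mult_distr sqrt_sqrt; lra.
have Hp : (0 <= sqrt rho ^ n)%R by apply pow_le, sqrt_pos.
have H1 := HK1 n. have H2 := HK2 n. rewrite /sid in H2.
have P1 := Rabs_pos (IZR (a n)). have P2 := Rabs_pos (IZR (Z.of_nat n)).
replace (Rabs (IZR (Z.of_nat n)) * Rabs (IZR (a n)) * (sqrt rho ^ n * sqrt rho ^ n))%R with
  ((Rabs (IZR (Z.of_nat n)) * sqrt rho ^ n) * (Rabs (IZR (a n)) * sqrt rho ^ n))%R by ring.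
apply Rmult_le_compat; auto; by apply Rmult_le_pos.
Qed.

(** The series of n x^n is x times the square of the geometric series, hence x / (1 - x)^2. *)
Lemma qval_sid (z : C) : (0 < Im z)%R -> csc2 z = twopii ^ 2 * qval sid z.
Proof.
intros Hz. have Hq := Im_pos_qexp z Hz.
have E1 : smul (ssub s1 sX) sones = s1.
{ apply functional_extensionality => [[|n]].
  - by rewrite smul_coef0.
  - have -> : smul (ssub s1 sX) sones = ssub sones (smul sX sones) by ring.
    rewrite /ssub /sadd /sopp sX_mul. reflexivity. }
have E2 : (1 - qexp z) * qval sones z = 1.
{ rewrite -(qval_s1 z) -{2}E1 -qval_sX -qval_ssub //; try apply conv_s1; try apply conv_sX.
  rewrite qval_smul //; [apply conv_ssub; [apply conv_s1 | apply conv_sX] | apply conv_sones]. }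
rewrite /csc2 sid_sones !qval_smul //; [| apply conv_sones | apply conv_sones | apply conv_sX | apply conv_smul; apply conv_sones].
rewrite qval_sX. have Hn : 1 - qexp z <> 0 by apply sub_neq_0; auto.
replace (qval sones z) with (/ (1 - qexp z) * ((1 - qexp z) * qval sones z)) by (field; auto).
rewrite E2. field. auto.
Qed.

(* sigma_1 *)
Definition ssig : series := fun n => zsum (fun m => dilate (S m) sid n) n.

Definition ssig_trunc (M : nat) : series := fun n => zsum (fun m => dilate (S m) sid n) M.

Lemma dilate_sid_bound (m n : nat) : (0 <= dilate (S m) sid n <= Z.of_nat n)%Z.
Proof.
rewrite /dilate /sid. destruct (Nat.eqb_spec (n mod S m) 0); last lia.
have := Nat.Div0.div_le_upper_bound n (S m) n. nia.
Qed.

Lemma dilate_sid_large (m n : nat) : (n <= m)%nat -> dilate (S m) sid n = 0%Z.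
Proof.
intros H. rewrite /dilate. destruct n as [|n]; first by rewrite Nat.Div0.mod_0_l Nat.Div0.div_0_l.
rewrite Nat.mod_small; [reflexivity | lia].
Qed.

Lemma zsum_extend (f : nat -> Z) (n m : nat) :
  (n <= m)%nat -> (forall k, (n <= k)%nat -> f k = 0%Z) -> zsum f m = zsum f n.
Proof.
intros H Hf. elim: H => [|p Hp IH] //=. rewrite IH Hf //. lia.
Qed.

Lemma ssig_trunc_eq (M n : nat) : (n <= M)%nat -> ssig_trunc M n = ssig n.
Proof. intros H. apply zsum_extend => // k. apply dilate_sid_large. Qed.

Lemma zsum_bound (f : nat -> Z) (b : Z) (n : nat) :
  (forall k, (k < n)%nat -> (0 <= f k <= b)%Z) -> (0 <= zsum f n <= Z.of_nat n * b)%Z.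
Proof.
elim: n => [|n IH] H; first by simpl; lia.
change (zsum f (S n)) with (zsum f n + f n)%Z.
have := IH (fun k Hk => H k (Nat.lt_lt_succ_r _ _ Hk)). have := H n (Nat.lt_succ_diag_r n). lia.
Qed.

Lemma ssig_bound (n : nat) : (0 <= ssig n <= sD sid n)%Z.
Proof. apply zsum_bound => k _. apply dilate_sid_bound. Qed.

Lemma ssig_trunc_bound (M n : nat) : (0 <= ssig_trunc M n <= sD sid n)%Z.
Proof.
destruct (Nat.le_gt_cases n M) as [H|H].
- rewrite ssig_trunc_eq //. apply ssig_bound.
- have := zsum_bound (fun m => dilate (S m) sid n) (Z.of_nat n) M (fun k _ => dilate_sid_bound k n).
  rewrite /ssig_trunc /sD /sid. nia.
Qed.

Lemma conv_ssig : conv ssig.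
Proof.
apply (conv_le _ (sD sid)); last by apply conv_sD, conv_sid.
intros n. have := ssig_bound n. lia.
Qed.

Lemma clim_qval (u : nat -> series) (v b : series) (z : C) :
  (forall M n, (n < M)%nat -> u M n = v n) ->
  (forall M n, (Z.abs (u M n) <= b n)%Z) -> (forall n, (Z.abs (v n) <= b n)%Z) -> conv b ->
  (0 < Im z)%R -> clim (fun M => qval (u M) z) (qval v z).
Proof.
intros He Hu Hv Hb Hz.
have Hs := conv_asum b z Hb Hz. rewrite /asum in Hs.
have Hle : forall (a : series) n, (Z.abs (a n) <= b n)%Z -> (Cmod (qpow a z n) <= Cmod (qpow b z n))%R.
{ intros a n Ha. rewrite !Cmod_qpow. apply Rmult_le_compat_r; first by apply pow_le; left; apply exp_pos.
  rewrite -!abs_IZR. apply IZR_le. lia. }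
apply (clim_le _ _ (fun M => Series (fun k => Cmod (qpow b z (M + k))) + Series (fun k => Cmod (qpow b z (M + k))))%R).
- intros M. rewrite !qval_CS.
  rewrite (CS_split (qpow (u M) z) M); last by apply (asum_le _ (fun n => Cmod (qpow b z n))); auto.
  rewrite (CS_split (qpow v z) M); last by apply (asum_le _ (fun n => Cmod (qpow b z n))); auto.
  rewrite (csum_ext (qpow (u M) z) (qpow v z)); last by intros k Hk; rewrite /qpow He.
  have Hs' : ex_series (fun k => Cmod (qpow b z (M + k))) by apply (ex_series_incr_n (fun k => Cmod (qpow b z k))).
  have T1 : (Cmod (CS (fun k => qpow (u M) z (M + k))) <= Series (fun k => Cmod (qpow b z (M + k))))%R by apply Cmod_CS_le; auto.
  have T2 : (Cmod (CS (fun k => qpow v z (M + k))) <= Series (fun k => Cmod (qpow b z (M + k))))%R by apply Cmod_CS_le; auto.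
  set X := csum _ _. set Y := CS (fun k => qpow (u M) z (M + k)) in T1 *. set W := CS (fun k => qpow v z (M + k)) in T2 *.
  replace (X + Y - (X + W)) with (Y + - W) by ring.
  apply: Rle_trans; first apply Cmod_triangle. rewrite Cmod_opp. lra.
- apply is_lim_seq_plus_0; by apply (Series_tail (fun k => Cmod (qpow b z k))).
Qed.

Lemma Im_nat_mul (n : nat) (z : C) : Im (RtoC (INR n) * z) = (INR n * Im z)%R.
Proof. destruct z. rewrite /Im /=. ring. Qed.

(** The Lambert series of sigma: the sum over m of the sums of n x^(mn). The truncations at m < M
    agree with sigma up to exponent M and share the majorant n^2. *)
Lemma csum_csc2 (z : C) : (0 < Im z)%R ->
  clim (csum (fun m => csc2 (RtoC (INR (S m)) * z))) (twopii ^ 2 * qval ssig z).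
Proof.
intros Hz.
have Hd : forall m, conv (dilate (S m) sid) by intros; apply conv_dilate; [lia | apply conv_sid].
have Hc : forall M, conv (ssig_trunc M).
{ intros M. apply (conv_le _ (sD sid)); last by apply conv_sD, conv_sid.
  intros n. have := ssig_trunc_bound M n. lia. }
apply (clim_ext (fun M => twopii ^ 2 * qval (ssig_trunc M) z)).
- elim=> [|M IH].
  + rewrite /= (qval_finite _ 0); last by []. rewrite /=. ring.
  + change (ssig_trunc (S M)) with (sadd (ssig_trunc M) (dilate (S M) sid)).
    rewrite csum_S -IH qval_sadd // qval_dilate //; [|lia|apply conv_sid].
    rewrite qval_sid; first ring. rewrite Im_nat_mul. apply Rmult_lt_0_compat; auto. apply lt_0_INR; lia.
- apply clim_scal. apply (clim_qval _ _ (sD sid)); auto.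
  + intros M n Hn. apply ssig_trunc_eq. lia.
  + intros M n. have := ssig_trunc_bound M n. lia.
  + intros n. have := ssig_bound n. lia.
  + apply conv_sD, conv_sid.
Qed.

(** * The inversion law of E_2 *)

Lemma Im_linear (r x : R) (z : C) : Im (RtoC r * z + RtoC x) = (r * Im z)%R.
Proof. destruct z. rewrite /Im /=. ring. Qed.

Section EisensteinWeightTwo.
Variable z : C.
Hypothesis Hz : (0 < Im z)%R.

Definition lb_const : R := (Im z / (2 * Cmod z))%R.

Lemma Cmod_z_ge : (Im z <= Cmod z)%R.
Proof. have := im_le_Cmod z. rewrite Rabs_pos_eq; lra. Qed.

Lemma lb_const_pos : (0 < lb_const)%R.
Proof. have := Cmod_z_ge. intros. apply Rdiv_lt_0_compat; lra. Qed.

Lemma lattice_lower_Im (m : nat) (x : R) :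
  (INR (S m) * Im z <= Cmod (RtoC (INR (S m)) * z + RtoC x))%R.
Proof.
apply: Rle_trans; last apply im_le_Cmod.
rewrite Im_linear. apply Rle_abs.
Qed.

(** If m |z| <= |x| / 2 the real number x dominates and the modulus is at least |x| / 2; otherwise
    the imaginary part m Im z already exceeds [lb_const] |x|. *)
Lemma lattice_lower_Re (m : nat) (x : R) :
  (lb_const * Rabs x <= Cmod (RtoC (INR (S m)) * z + RtoC x))%R.
Proof.
have Hzz := Cmod_z_ge. have Hm : (0 < INR (S m))%R by apply lt_0_INR; lia.
have Hx := Rabs_pos x.
have Hc : (lb_const * (2 * Cmod z) = Im z)%R by rewrite /lb_const; field; lra.
have Hc0 := lb_const_pos.
destruct (Rle_lt_dec (INR (S m) * Cmod z) (Rabs x / 2)) as [H|H].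
- have H1 := Cmod_triangle_inv (RtoC x) (- (RtoC (INR (S m)) * z)).
  replace (RtoC x - - (RtoC (INR (S m)) * z)) with (RtoC (INR (S m)) * z + RtoC x) in H1 by ring.
  rewrite Cmod_opp Cmod_mult !Cmod_R (Rabs_pos_eq (INR (S m))) in H1; last lra.
  have Hc1 : (lb_const <= / 2)%R.
  { apply (Rmult_le_reg_r (2 * Cmod z)); lra. }
  nra.
- apply: Rle_trans; last apply lattice_lower_Im. nra.
Qed.

Definition pr2 (w : C) (n : nat) : C := / (w + INR (S n)) ^ 2 + / (w - INR (S n)) ^ 2.
(** The double series of 1 / (m z + n)^2 does not converge absolutely, which forbids exchanging the
    sums. The increments [tele n w - tele (S n) w] replace 1 / v^2, for v = w + n + 1 and v = w - n
    - 1, by 1 / (v - 1/2) - 1 / (v + 1/2) = 1 / (v^2 - 1/4). The midpoints make the error of fourth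
    order in 1 / v, hence summable over m and n together. *)
Definition tele (N : nat) (w : C) : C := / (RtoC (INR N + / 2) + w) + / (RtoC (INR N + / 2) - w).
Definition lb2 : R := (/ (lb_const ^ 2 * Im z ^ 2))%R.

Lemma tele_term (v : C) (c : R) : (0 < c)%R ->
  (c <= Cmod v * Cmod v * (Cmod (v - RtoC (/ 2)) * Cmod (v + RtoC (/ 2))))%R ->
  (Cmod (/ v ^ 2 - (/ (v - RtoC (/ 2)) - / (v + RtoC (/ 2)))) <= / (4 * c))%R.
Proof.
have -> : RtoC (/ 2) = / RtoC 2 by rewrite RtoC_inv; lra || auto.
intros Hc H.
have Hv : v <> 0 by intros E; rewrite E Cmod_0 in H; lra.
have H1 : v - / RtoC 2 <> 0 by intros E; rewrite E Cmod_0 in H; lra.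
have H2 : v + / RtoC 2 <> 0 by intros E; rewrite E Cmod_0 in H; lra.
have H12 : v * RtoC 2 - 1 <> 0.
{ intros E. apply H1. replace (v - / RtoC 2) with ((v * RtoC 2 - 1) / RtoC 2) by field. rewrite E. field. }
have H22 : v * RtoC 2 + 1 <> 0.
{ intros E. apply H2. replace (v + / RtoC 2) with ((v * RtoC 2 + 1) / RtoC 2) by field. rewrite E. field. }
replace (/ v ^ 2 - (/ (v - / RtoC 2) - / (v + / RtoC 2))) with
  (- / (RtoC 4 * (v * v * ((v - / RtoC 2) * (v + / RtoC 2))))) by (field; repeat split; auto).
rewrite Cmod_opp Cmod_inv.
- rewrite !Cmod_mult Cmod_R Rabs_pos_eq; last lra. apply Rinv_le_contravar; lra.
- repeat apply Cmult_neq_0; auto. apply RtoC_neq_0. lra.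
Qed.

(** Of the two factors |v| one is bounded below by m and the other by n; |v - 1/2| is bounded by m
    and |v + 1/2| by n. The product is therefore of order m^2 n^2. *)
Lemma lattice_product (m n : nat) (x : R) : Rabs x = INR (S n) ->
  let v := RtoC (INR (S m)) * z + RtoC x in
  (lb_const ^ 2 * Im z ^ 2 * INR (S m) ^ 2 * INR (S n) ^ 2 / 2 <=
   Cmod v * Cmod v * (Cmod (v - RtoC (/ 2)) * Cmod (v + RtoC (/ 2))))%R.
Proof.
intros Hx v. have Hc := lb_const_pos.
have Hm : (0 < INR (S m))%R by apply lt_0_INR; lia.
have Hn : (1 <= INR (S n))%R by rewrite S_INR; have := pos_INR n; lra.
have V1 : (INR (S m) * Im z <= Cmod v)%R by apply lattice_lower_Im.
have V2 : (lb_const * INR (S n) <= Cmod v)%R by rewrite -Hx; apply lattice_lower_Re.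
have V3 : (INR (S m) * Im z <= Cmod (v - RtoC (/ 2)))%R.
{ replace (v - RtoC (/ 2)) with (RtoC (INR (S m)) * z + RtoC (x - / 2)) by (rewrite /v RtoC_minus; ring).
  apply lattice_lower_Im. }
have V4 : (lb_const * (INR (S n) / 2) <= Cmod (v + RtoC (/ 2)))%R.
{ replace (v + RtoC (/ 2)) with (RtoC (INR (S m)) * z + RtoC (x + / 2)) by (rewrite /v RtoC_plus; ring).
  apply: Rle_trans; last apply lattice_lower_Re. apply Rmult_le_compat_l; first lra.
  have := Rabs_triang_inv x (- / 2). rewrite Rabs_Ropp (Rabs_pos_eq (/ 2)); last lra.
  replace (x - - / 2)%R with (x + / 2)%R by ring. lra. }
have P1 : (0 <= INR (S m) * Im z)%R by apply Rmult_le_pos; lra.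
have P2 : (0 <= lb_const * INR (S n))%R by apply Rmult_le_pos; lra.
have P3 : (0 <= lb_const * (INR (S n) / 2))%R by apply Rmult_le_pos; lra.
replace (lb_const ^ 2 * Im z ^ 2 * INR (S m) ^ 2 * INR (S n) ^ 2 / 2)%R with
  (((INR (S m) * Im z) * (lb_const * INR (S n))) * ((INR (S m) * Im z) * (lb_const * (INR (S n) / 2))))%R by field.
apply Rmult_le_compat; try by apply Rmult_le_pos.
- by apply Rmult_le_compat.
- by apply Rmult_le_compat.
Qed.

Lemma tele_step (m n : nat) :
  let w := RtoC (INR (S m)) * z in
  (Cmod (pr2 w n - (tele n w - tele (S n) w)) <= lb2 * / INR (S m) ^ 2 * / INR (S n) ^ 2)%R.
Proof.
intros w. have Hc := lb_const_pos.
have Hm : (0 < INR (S m))%R by apply lt_0_INR; lia.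
have Hn : (0 < INR (S n))%R by apply lt_0_INR; lia.
have Hpos : (0 < lb_const ^ 2 * Im z ^ 2 * INR (S m) ^ 2 * INR (S n) ^ 2 / 2)%R.
{ apply Rdiv_lt_0_compat; last lra. by repeat (assumption || apply pow_lt || apply Rmult_lt_0_compat). }
set v := w + RtoC (INR (S n)). set v' := w + RtoC (- INR (S n)).
have B1 := tele_term v _ Hpos (lattice_product m n (INR (S n)) (Rabs_pos_eq _ (Rlt_le _ _ Hn))).
have B2 := tele_term v' _ Hpos (lattice_product m n (- INR (S n)) ltac:(rewrite Rabs_Ropp Rabs_pos_eq; lra)).
have Nn : forall x, RtoC (INR (S m)) * z + RtoC x <> 0.
{ intros x. apply Cmod_gt_0. apply: Rlt_le_trans; last apply lattice_lower_Im. by apply Rmult_lt_0_compat. }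
have E : pr2 w n - (tele n w - tele (S n) w) =
  (/ v ^ 2 - (/ (v - RtoC (/ 2)) - / (v + RtoC (/ 2)))) + (/ v' ^ 2 - (/ (v' - RtoC (/ 2)) - / (v' + RtoC (/ 2)))).
{ rewrite /pr2 /tele.
  replace (w + INR (S n)) with v by reflexivity.
  replace (w - INR (S n)) with v' by (rewrite /v' RtoC_opp; ring).
  have Hh : RtoC 1 = RtoC (/ 2) + RtoC (/ 2) by rewrite -RtoC_plus; f_equal; lra.
  have -> : RtoC (INR n + / 2) + w = v - RtoC (/ 2) by rewrite /v S_INR !RtoC_plus Hh; ring.
  have -> : RtoC (INR (S n) + / 2) + w = v + RtoC (/ 2) by rewrite /v !RtoC_plus; ring.
  have -> : RtoC (INR n + / 2) - w = - (1) * (v' + RtoC (/ 2)).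
  { rewrite /v' S_INR RtoC_opp !RtoC_plus. 
    transitivity (RtoC (INR n) + (RtoC 1 - RtoC (/ 2)) - w); [rewrite Hh; ring | ring]. }
  have -> : RtoC (INR (S n) + / 2) - w = - (1) * (v' - RtoC (/ 2)) by rewrite /v' RtoC_opp !RtoC_plus; ring.
  rewrite !Cinv_mul. replace (/ - (1)) with (- (1)) by field. ring. }
rewrite E. apply: Rle_trans; first apply Cmod_triangle.
apply: Rle_trans; first apply (Rplus_le_compat _ _ _ _ B1 B2).
right. rewrite /lb2. field. repeat split; lra.
Qed.

Lemma clim_tele (w : C) : clim (fun N => tele N w) 0.
Proof.
replace (RtoC 0) with (0 + - (1) * 0) by ring.
apply (clim_ext (fun N => / ((w + RtoC (/ 2)) + INR N) + - (1) * / ((w - RtoC (/ 2)) - INR N))).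
- intros N. rewrite /tele RtoC_plus. f_equal.
  + f_equal. ring.
  + replace (RtoC (INR N) + RtoC (/ 2) - w) with (- (1) * (w - RtoC (/ 2) - INR N)) by ring.
    rewrite Cinv_mul. f_equal. field.
- apply clim_plus; [apply clim_inv_shift | apply clim_scal, clim_inv_shift_neg].
Qed.

Definition zeta2_tail (N : nat) : R := Series (fun k => / INR (S (N + k)) ^ 2)%R.

(** Past column N the row m telescopes to [tele N w], up to an error summable in m. *)
Lemma tail_bound (m N : nat) :
  let w := RtoC (INR (S m)) * z in
  (Cmod (csc2 w - / w ^ 2 - csum (pr2 w) N - tele N w) <= lb2 * / INR (S m) ^ 2 * zeta2_tail N)%R.
Proof.
intros w.
have Hm : (0 < INR (S m))%R by apply lt_0_INR; lia.
have Hw : qexp w <> 1.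
{ apply Im_pos_qexp. rewrite Im_nat_mul. by apply Rmult_lt_0_compat. }
have Hs : ex_series (fun k => / INR (S (N + k)) ^ 2)%R.
{ apply (ex_series_incr_n (fun k => / INR (S k) ^ 2)%R). apply ex_series_inv_square. }
apply (clim_Cmod_le (fun K => csum (fun k => pr2 w (N + k) - (tele (N + k) w - tele (S (N + k)) w)) K) _ _ 0).
- apply (clim_ext (fun K => csum (pr2 w) (N + K) - csum (pr2 w) N - tele N w + tele (N + K) w)).
  + elim=> [|K IH]; first by rewrite Nat.add_0_r /=; ring.
    rewrite csum_S -IH Nat.add_succ_r csum_S. ring.
  + replace (csc2 w - / w ^ 2 - csum (pr2 w) N - tele N w) with
      (csc2 w - / w ^ 2 - csum (pr2 w) N - tele N w + 0) by ring.
    apply clim_plus.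
    * apply clim_minus; last apply clim_const. apply clim_minus; last apply clim_const.
      apply (clim_subseq (csum (pr2 w)) _ (fun K => N + K)%nat); [lia | by apply csc2_sum].
    * apply (clim_subseq (fun K => tele K w) _ (fun K => N + K)%nat); [lia | apply clim_tele].
- intros K _. rewrite /zeta2_tail -Series_scal_l.
  apply Cmod_csum_le_Series.
  + intros k. apply tele_step.
  + apply: ex_series_scal_l. exact Hs.
Qed.

Definition minv : C := - / z.

Lemma z_neq_0 : z <> 0.
Proof. by apply Im_pos_neq_0. Qed.

Lemma Im_minv : (0 < Im minv)%R.
Proof.
have Hn := z_neq_0.
have Hd : (0 < Re z * Re z + Im z * Im z)%R by nra.
have -> : Im minv = (Im z / (Re z * Re z + Im z * Im z))%R.
{ rewrite /minv. destruct z as [x y]. rewrite /Re /Im /= in Hd *. field. lra. }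
by apply Rdiv_lt_0_compat.
Qed.

(** Since m z + n = - z (n (-1/z) - m), a column of the lattice of z is, up to scaling, a row of the
    lattice of -1/z. *)
Lemma column_sum (n : nat) :
  clim (csum (fun m => pr2 (RtoC (INR (S m)) * z) n))
    (/ z ^ 2 * csc2 (RtoC (INR (S n)) * minv) - / RtoC (INR (S n)) ^ 2).
Proof.
have Hn := z_neq_0. have Hi := Im_minv.
set w := RtoC (INR (S n)) * minv.
have Hw : qexp w <> 1.
{ apply Im_pos_qexp. rewrite Im_nat_mul. apply Rmult_lt_0_compat; auto. apply lt_0_INR; lia. }
have Hnn := INR_S_neq_0 n.
apply (clim_ext (fun M => / z ^ 2 * csum (fun k => / (w + INR (S k)) ^ 2 + / (w - INR (S k)) ^ 2) M)).
- intros M. rewrite -csum_scal. apply csum_ext => k _. rewrite /pr2.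
  have E1 : RtoC (INR (S k)) * z + INR (S n) = - (z * (w - INR (S k))).
  { rewrite /w /minv. field. auto. }
  have E2 : RtoC (INR (S k)) * z - INR (S n) = z * (w + INR (S k)).
  { rewrite /w /minv. field. auto. }
  rewrite E1 E2.
  replace ((- (z * (w - INR (S k)))) ^ 2) with (z ^ 2 * (w - INR (S k)) ^ 2) by ring.
  rewrite Cpow_mult_l !Cinv_mul. ring.
- replace (/ z ^ 2 * csc2 w - / RtoC (INR (S n)) ^ 2) with (/ z ^ 2 * (csc2 w - / w ^ 2)).
  + apply clim_scal. by apply csc2_sum.
  + have E : / w ^ 2 = z ^ 2 / RtoC (INR (S n)) ^ 2.
    { rewrite /w /minv. field. auto. }
    rewrite E. field. auto.
Qed.

(** After division by z the summands are 1 / (w + m) and 1 / (w - m) at w = (N + 1/2)(-1/z), so the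
    cotangent expansion applies. *)
Lemma tele_sum (N : nat) :
  let a := RtoC (INR N + / 2) in
  clim (csum (fun m => tele N (RtoC (INR (S m)) * z))) (- (/ z * cotp (a * minv)) - / a).
Proof.
intros a. have Hn := z_neq_0. have Hi := Im_minv.
have Ha : a <> 0. { apply RtoC_neq_0. have := pos_INR N. lra. }
set w := a * minv.
have Hw : qexp w <> 1.
{ apply Im_pos_qexp. have -> : Im w = ((INR N + / 2) * Im minv)%R by rewrite /w /a; destruct minv; rewrite /Im /=; ring.
  apply Rmult_lt_0_compat; auto. have := pos_INR N. lra. }
apply (clim_ext (fun M => - / z * csum (fun k => / (w + INR (S k)) + / (w - INR (S k))) M)).
- intros M. rewrite -csum_scal. apply csum_ext => k _. rewrite /tele -/a.
  have E1 : a + RtoC (INR (S k)) * z = - (1) * z * (w - INR (S k)).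
  { rewrite /w /minv. field. auto. }
  have E2 : a - RtoC (INR (S k)) * z = - (1) * z * (w + INR (S k)).
  { rewrite /w /minv. field. auto. }
  rewrite E1 E2 !Cinv_mul. replace (/ - (1)) with (- (1)) by field. ring.
- replace (- (/ z * cotp w) - / a) with (- / z * (cotp w - / w)).
  + apply clim_scal. by apply cotp_sum.
  + have E : / w = - (z / a) by rewrite /w /minv; field; auto.
    rewrite E. field. auto.
Qed.

(** The first N columns are summed over m one by one, and the rest of each row is replaced by its
    telescoped value. The sum of these values over m is a cotangent that does not tend to 0 as N
    grows: the term 2 pi i / (2 z) originates here. *)
Lemma lattice_identity (N : nat) :
  let a := RtoC (INR N + / 2) in
  (Cmod (twopii ^ 2 * qval ssig z - / z ^ 2 * zeta2
     - (/ z ^ 2 * csum (fun n => csc2 (RtoC (INR (S n)) * minv)) N - csum (fun n => / RtoC (INR (S n)) ^ 2)%C N)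
     - (- (/ z * cotp (a * minv)) - / a)) <= lb2 * Series (fun k => / INR (S k) ^ 2) * zeta2_tail N)%R.
Proof.
intros a. have Hn := z_neq_0.
apply (clim_Cmod_le (fun M => csum (fun m => csc2 (RtoC (INR (S m)) * z) - / (RtoC (INR (S m)) * z) ^ 2
   - csum (pr2 (RtoC (INR (S m)) * z)) N - tele N (RtoC (INR (S m)) * z)) M) _ _ 0).
- apply (clim_ext (fun M => csum (fun m => csc2 (RtoC (INR (S m)) * z)) M - / z ^ 2 * csum (fun m => / RtoC (INR (S m)) ^ 2) M
    - csum (fun n => csum (fun m => pr2 (RtoC (INR (S m)) * z) n) M) N
    - csum (fun m => tele N (RtoC (INR (S m)) * z)) M)).
  + intros M. rewrite -csum_scal (csum_swap (fun n m => pr2 (RtoC (INR (S m)) * z) n)) -!csum_minus.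
    apply csum_ext => k _. rewrite Cpow_mult_l Cinv_mul.
    by rewrite (Cmult_comm (/ z ^ 2)).
  + apply clim_minus; last apply tele_sum. apply clim_minus.
    * apply clim_minus; first by apply csum_csc2. apply clim_scal. apply CS_cser, asum_zeta2.
    * rewrite -csum_scal -csum_minus. elim: N {a} => [|N IH]; first exact (clim_const 0).
      rewrite csum_S. apply clim_plus; [exact IH | apply column_sum].
- intros M _.
  replace (lb2 * Series (fun k => / INR (S k) ^ 2) * zeta2_tail N)%R with
    (Series (fun k => lb2 * zeta2_tail N * / INR (S k) ^ 2))%R by (rewrite Series_scal_l; ring).
  apply Cmod_csum_le_Series.
  + intros k. apply: Rle_trans; first apply tail_bound. right. ring.
  + apply: ex_series_scal_l. apply ex_series_inv_square.
Qed.

(** The argument tends to infinity along the ray through -1/z, where e tends to 0 and pi cot tends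
    to - pi i. *)
Lemma clim_cotp_infty : clim (fun N => cotp (RtoC (INR N + / 2) * minv)) (- (twopii / RtoC 2)).
Proof.
have Hi := Im_minv.
have Hq : clim (fun N => qexp (RtoC (INR N + / 2) * minv)) 0.
{ apply (clim_le _ _ (fun N => Cmod (qexp (RtoC (/ 2) * minv)) * Cmod (qexp minv) ^ N)%R).
  - intros N. rewrite RtoC_plus Cmult_plus_distr_r qexp_plus qexp_nat.
    replace (qexp minv ^ N * qexp (RtoC (/ 2) * minv) - 0) with (qexp minv ^ N * qexp (RtoC (/ 2) * minv)) by ring.
    rewrite Cmod_mult Cmod_pow. lra.
  - apply is_lim_seq_scal_0, is_lim_seq_geom. rewrite Rabs_pos_eq; last apply Cmod_ge_0.
    rewrite Cmod_qexp. by apply exp_im_range. }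
have E0 : 1 - 0 <> 0 by replace (1 - 0) with (RtoC 1) by ring; apply RtoC_neq_0; lra.
have H1 := clim_scal (- (twopii / RtoC 2)) _ _ (clim_mult _ _ _ _ (clim_plus _ _ _ _ (clim_const 1) Hq)
  (clim_inv _ _ E0 (clim_minus _ _ _ _ (clim_const 1) Hq))).
replace (- (twopii / RtoC 2) * ((1 + 0) * / (1 - 0))) with (- (twopii / RtoC 2)) in H1 by (field; auto).
exact H1.
Qed.

Lemma sigma_inversion :
  twopii ^ 2 * qval ssig z - / z ^ 2 * zeta2 =
  / z ^ 2 * (twopii ^ 2 * qval ssig minv) - zeta2 + twopii / (RtoC 2 * z).
Proof.
have Hn := z_neq_0. have Hi := Im_minv.
set X := twopii ^ 2 * qval ssig z - / z ^ 2 * zeta2.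
apply (clim_unique (fun _ => X)); first apply clim_const.
set R := fun N : nat => / z ^ 2 * csum (fun n => csc2 (RtoC (INR (S n)) * minv)) N - csum (fun n => / RtoC (INR (S n)) ^ 2) N
  + (- (/ z * cotp (RtoC (INR N + / 2) * minv)) - / RtoC (INR N + / 2)).
have HR : clim R (/ z ^ 2 * (twopii ^ 2 * qval ssig minv) - zeta2 + twopii / (RtoC 2 * z)).
{ apply clim_plus.
  - apply clim_minus; last by apply CS_cser, asum_zeta2. apply clim_scal. by apply csum_csc2.
  - replace (twopii / (RtoC 2 * z)) with (- (/ z * - (twopii / RtoC 2)) - 0) by (field; auto).
    apply clim_minus.
    + apply (clim_ext (fun N => - / z * cotp (RtoC (INR N + / 2) * minv))); first by intros; ring.
      replace (- (/ z * - (twopii / RtoC 2))) with (- / z * - (twopii / RtoC 2)) by ring.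
      apply clim_scal, clim_cotp_infty.
    + apply (clim_ext (fun N => / (RtoC (/ 2) + INR N))); last apply clim_inv_shift.
      intros N. by rewrite Cplus_comm -RtoC_plus. }
have HD : clim (fun N => X - R N) 0.
{ apply (clim_le _ _ (fun N => lb2 * Series (fun k => / INR (S k) ^ 2) * zeta2_tail N)%R).
  - intros N. have := lattice_identity N. cbv zeta. rewrite -/X.
    replace (X - R N - 0) with (X - (/ z ^ 2 * csum (fun n : nat => csc2 (INR (S n) * minv)) N -
      csum (fun n : nat => / INR (S n) ^ 2) N) - (- (/ z * cotp (RtoC (INR N + / 2) * minv)) - / RtoC (INR N + / 2))) by (rewrite /R; ring).
    auto.
  - apply is_lim_seq_scal_0. apply (Series_tail (fun k => / INR (S k) ^ 2)%R). apply ex_series_inv_square. }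
apply (clim_ext (fun N => (X - R N) + R N)); first by intros; ring.
have H := clim_plus _ _ _ _ HD HR. by rewrite Cplus_0_l in H.
Qed.
End EisensteinWeightTwo.

Definition sE2 : series := ssub s1 (smul (sC 24) ssig).

Lemma qval_sE2 (z : C) : (0 < Im z)%R -> qval sE2 z = 1 - RtoC 24 * qval ssig z.
Proof.
intros Hz. rewrite /sE2 qval_ssub //; [|apply conv_s1 | apply conv_smul; [apply conv_sC | apply conv_ssig]].
rewrite qval_s1 qval_smul //; [|apply conv_sC|apply conv_ssig]. by rewrite qval_sC.
Qed.

Theorem E2_inversion (z : C) : (0 < Im z)%R ->
  qval sE2 (- / z) = z ^ 2 * qval sE2 z + RtoC 12 * z / twopii.
Proof.
intros Hz. have H := sigma_inversion z Hz. have Hn := z_neq_0 z Hz. have Hi := Im_minv z Hz.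
have Ht := twopii_neq_0.
rewrite !qval_sE2 //. rewrite zeta2_value /minv in H.
set S1 := qval ssig z in H *. set S2 := qval ssig (- / z) in H *.
have E : S2 = z ^ 2 / twopii ^ 2 * (twopii ^ 2 * S1 - / z ^ 2 * - (twopii ^ 2 / RtoC 24) - (- - (twopii ^ 2 / RtoC 24)) - twopii / (RtoC 2 * z)).
{ rewrite H. field. auto. }
rewrite E. field. auto.
Qed.

(** * The eta function *)

Lemma smul_ext_le (a a' b b' : series) (n : nat) :
  (forall k, (k <= n)%nat -> a k = a' k) -> (forall k, (k <= n)%nat -> b k = b' k) ->
  smul a b n = smul a' b' n.
Proof.
intros Ha Hb. apply zsum_ext => k Hk. rewrite Ha; last lia. rewrite Hb; last lia. reflexivity.
Qed.

Definition sXn (k : nat) : series := fun n => if Nat.eqb n k then 1%Z else 0%Z.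

Fixpoint eta_fin (K : nat) : series :=
  match K with O => s1 | S k => smul (eta_fin k) (ssub s1 (sXn (S k))) end.

Fixpoint part_fin (K : nat) : series :=
  match K with O => s1 | S k => smul (part_fin k) (dilate (S k) sones) end.

Lemma zsum_product_single (f : nat -> Z) (a : series) (n k : nat) : (k <= n)%nat ->
  (forall i, (i <= n)%nat -> i <> k -> f i = 0%Z) ->
  zsum (fun i => f i * a (n - i)%nat)%Z (S n) = (f k * a (n - k)%nat)%Z.
Proof.
intros Hk H. apply (zsum_single (fun i => f i * a (n - i)%nat)%Z); first lia.
intros i Hi Hne. rewrite H //. lia.
Qed.

Lemma sXn_mul (k n : nat) (a : series) :
  smul (sXn k) a n = if Nat.leb k n then a (n - k)%nat else 0%Z.
Proof.
rewrite /smul. destruct (Nat.leb_spec k n) as [H|H].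
- rewrite (zsum_product_single (sXn k) a n k) //.
  + rewrite /sXn Nat.eqb_refl. apply Z.mul_1_l.
  + intros i Hi Hne. rewrite /sXn. by destruct (Nat.eqb_spec i k).
- apply zsum_0 => i Hi. rewrite /sXn. destruct (Nat.eqb_spec i k); [lia | reflexivity].
Qed.

Lemma geometric_dilate (k : nat) : smul (ssub s1 (sXn (S k))) (dilate (S k) sones) = s1.
Proof.
have -> : smul (ssub s1 (sXn (S k))) (dilate (S k) sones) =
  ssub (dilate (S k) sones) (smul (sXn (S k)) (dilate (S k) sones)) by ring.
apply functional_extensionality => n. rewrite /ssub /sadd /sopp sXn_mul.
destruct (Nat.leb_spec (S k) n) as [H|H].
- have E : dilate (S k) sones n = dilate (S k) sones (n - S k)%nat.
  { rewrite /dilate. have -> : (n mod S k = (n - S k) mod S k)%nat; last by [].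
    replace n with ((n - S k) + 1 * S k)%nat at 1 by lia. by rewrite Nat.Div0.mod_add. }
  rewrite E. destruct n; [lia | rewrite /s1 /=; lia].
- rewrite /dilate Nat.mod_small //. by destruct n.
Qed.

Lemma eta_fin_stable (n K : nat) : (n <= K)%nat -> eta_fin K n = eta_fin n n.
Proof.
intros H. elim: H => [|p Hp IH] //. rewrite -IH.
change (eta_fin (S p)) with (smul (eta_fin p) (ssub s1 (sXn (S p)))).
have -> : smul (eta_fin p) (ssub s1 (sXn (S p))) = ssub (eta_fin p) (smul (sXn (S p)) (eta_fin p)) by ring.
rewrite /ssub /sadd /sopp sXn_mul. destruct (Nat.leb_spec (S p) n); lia.
Qed.

Lemma eta_part_fin (K : nat) : smul (eta_fin K) (part_fin K) = s1.
Proof.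
elim: K => [|K IH]; first by simpl; ring.
change (smul (smul (eta_fin K) (ssub s1 (sXn (S K)))) (smul (part_fin K) (dilate (S K) sones)) = s1).
transitivity (smul (smul (eta_fin K) (part_fin K)) (smul (ssub s1 (sXn (S K))) (dilate (S K) sones))); first ring.
rewrite IH geometric_dilate. ring.
Qed.

Lemma part_fin_stable (n K : nat) : (n <= K)%nat -> part_fin K n = part_fin n n.
Proof.
intros H. elim: H => [|p Hp IH] //. rewrite -IH.
change (part_fin (S p)) with (smul (part_fin p) (dilate (S p) sones)).
have -> : smul (part_fin p) (dilate (S p) sones) n = smul (part_fin p) s1 n.
{ apply smul_ext_le => // k Hk. rewrite /dilate /s1 Nat.mod_small; last lia. by destruct k. }
have -> : smul (part_fin p) s1 = part_fin p by ring. reflexivity.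
Qed.

(* prod (1 - x^n) and its inverse *)
Definition seta : series := fun n => eta_fin n n.
Definition spart : series := fun n => part_fin n n.

Lemma seta_spart : smul seta spart = s1.
Proof.
apply functional_extensionality => n. rewrite -(eta_part_fin n).
apply smul_ext_le => k Hk; [rewrite /seta eta_fin_stable // | rewrite /spart part_fin_stable //].
Qed.

Lemma sD_smul (a b : series) : sD (smul a b) = sadd (smul (sD a) b) (smul a (sD b)).
Proof.
apply functional_extensionality => n. rewrite /sD /sadd /smul -zsum_plus -zsum_scal.
apply zsum_ext => k Hk. replace (Z.of_nat n) with (Z.of_nat k + Z.of_nat (n - k))%Z by lia. ring.
Qed.

Lemma sD_sadd (a b : series) : sD (sadd a b) = sadd (sD a) (sD b).
Proof. apply functional_extensionality => n. rewrite /sD /sadd. lia. Qed.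

Lemma sD_s1 : sD s1 = s0.
Proof. by apply functional_extensionality => [[|n]]. Qed.

(** The series d x^d / (1 - x^d) for d = k + 1, as the sum over j >= 1 of d x^(dj). The range j < n
    loses nothing, as d j = n forces j <= n. *)
Definition lambert (k : nat) : series :=
  fun n => zsum (fun j => if Nat.eqb (S k * S j) n then Z.of_nat (S k) else 0%Z) n.

Lemma lambert_dilate (k : nat) : lambert k = smul (sC (Z.of_nat (S k))) (ssub (dilate (S k) sones) s1).
Proof.
apply functional_extensionality => n. rewrite sC_mul /ssub /sadd /sopp /lambert.
destruct n as [|n].
- rewrite /dilate /s1 Nat.Div0.mod_0_l /=. lia.
- have -> : s1 (S n) = 0%Z by []. rewrite /dilate.
  destruct (Nat.eqb_spec (S n mod S k) 0) as [E|E].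
  + have Hd := Nat.div_mod_eq (S n) (S k). rewrite E in Hd.
    set q := (S n / S k)%nat in Hd *.
    have Hq : (0 < q)%nat by destruct q; lia.
    rewrite (zsum_single _ _ (q - 1)); last first.
    * intros j Hj Hne. destruct (Nat.eqb_spec (S k * S j) (S n)) as [E2|E2]; last by [].
      exfalso. apply Hne. nia.
    * nia.
    * replace (S (q - 1)) with q by lia.
      have -> : (S k * q = S n)%nat by rewrite Hd Nat.add_0_r. rewrite Nat.eqb_refl /sones. lia.
  + rewrite zsum_0; first lia. intros j Hj. destruct (Nat.eqb_spec (S k * S j) (S n)) as [E2|E2]; last by [].
    exfalso. apply E. rewrite -E2 Nat.mul_comm. apply Nat.Div0.mod_mul.
Qed.

Lemma zsum_swap (u : nat -> nat -> Z) (n m : nat) :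
  zsum (fun i => zsum (fun j => u i j) m) n = zsum (fun j => zsum (fun i => u i j) n) m.
Proof.
elim: n => [|n IH] /=; first by rewrite zsum_0.
by rewrite IH zsum_plus.
Qed.

Lemma ssig_lambert (n : nat) : zsum (fun k => lambert k n) n = ssig n.
Proof.
rewrite /lambert zsum_swap. apply zsum_ext => j Hj. rewrite /dilate /sid.
destruct (Nat.eqb_spec (n mod S j) 0) as [E|E].
- have Hd := Nat.div_mod_eq n (S j). rewrite E in Hd. set q := (n / S j)%nat in Hd *.
  have Hq : (0 < q)%nat by destruct q; lia.
  rewrite (zsum_single _ _ (q - 1)); last first.
  + intros k Hk Hne. destruct (Nat.eqb_spec (S k * S j) n) as [E2|E2]; last by [].
    exfalso. apply Hne. nia.
  + nia.
  + replace (S (q - 1)) with q by lia.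
    have -> : (q * S j = n)%nat by rewrite Nat.mul_comm Hd Nat.add_0_r. by rewrite Nat.eqb_refl.
- apply zsum_0 => k Hk. destruct (Nat.eqb_spec (S k * S j) n) as [E2|E2]; last by [].
  exfalso. apply E. rewrite -E2. apply Nat.Div0.mod_mul.
Qed.

Lemma sD_eta_fin (K : nat) :
  sD (eta_fin K) = sopp (smul (eta_fin K) (fun n => zsum (fun k => lambert k n) K)).
Proof.
elim: K => [|K IH].
- simpl. rewrite sD_s1. apply functional_extensionality => n. rewrite /sopp /smul zsum_0 //.
  intros; lia.
- change (eta_fin (S K)) with (smul (eta_fin K) (ssub s1 (sXn (S K)))).
  change (fun n => zsum (fun k => lambert k n) (S K)) with (sadd (fun n => zsum (fun k => lambert k n) K) (lambert K)).
  rewrite sD_smul IH.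
  set L := fun n => zsum (fun k => lambert k n) K.
  have E : sD (ssub s1 (sXn (S K))) = sopp (smul (ssub s1 (sXn (S K))) (lambert K)).
  { rewrite lambert_dilate.
    transitivity (sopp (smul (sC (Z.of_nat (S K))) (ssub (smul (ssub s1 (sXn (S K))) (dilate (S K) sones)) (ssub s1 (sXn (S K)))))); last ring.
    rewrite geometric_dilate.
    apply functional_extensionality => n. rewrite /sopp sC_mul /sD /ssub /sadd /sopp /sXn.
    destruct (Nat.eqb_spec n (S K)) as [->|Hne].
    - rewrite /s1 /=. lia.
    - destruct n; rewrite /s1 /=; lia. }
  rewrite E. ring.
Qed.

(** Logarithmic differentiation of the product: each factor 1 - x^k contributes - k x^k / (1 - x^k),
    and these add up to minus the series of sigma. The coefficient n involves only the first n
    factors. *)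
Lemma sD_seta : sD seta = sopp (smul seta ssig).
Proof.
apply functional_extensionality => n.
transitivity (sD (eta_fin n) n); first by reflexivity.
rewrite sD_eta_fin /sopp. f_equal. apply smul_ext_le => k Hk.
- by rewrite /seta eta_fin_stable.
- rewrite -ssig_lambert. apply zsum_extend => // j Hj. apply zsum_0 => i Hi.
  destruct (Nat.eqb_spec (S j * S i) k); [nia | reflexivity].
Qed.

Lemma sD_spart : sD spart = smul spart ssig.
Proof.
have H := f_equal sD seta_spart. rewrite sD_smul sD_s1 sD_seta in H.
transitivity (smul (smul seta spart) (sD spart)); first by rewrite seta_spart; ring.
transitivity (smul spart (sadd (sadd (smul (sopp (smul seta ssig)) spart) (smul seta (sD spart))) (smul (smul seta ssig) spart))); first ring.
rewrite H. transitivity (smul (smul seta spart) (smul spart ssig)); first ring.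
rewrite seta_spart. ring.
Qed.

Lemma Rabs_zsum (f : nat -> Z) (n : nat) :
  (Rabs (IZR (zsum f (S n))) <= sum_f_R0 (fun k => Rabs (IZR (f k))) n)%R.
Proof.
elim: n => [|n IH].
- change (zsum f 1) with (0 + f 0%nat)%Z. rewrite Z.add_0_l /=. lra.
- change (zsum f (S (S n))) with (zsum f (S n) + f (S n))%Z. rewrite plus_IZR tech5.
  apply: Rle_trans; first apply Rabs_triang. by apply Rplus_le_compat_r.
Qed.

(* A solution of n a_n = sum_{k <= n} s_k a_{n-k} grows subexponentially when s does: once
   n >= sum |s_k| rho^k, the bound on |a_j| rho^j for j < n propagates to n. *)
Lemma conv_log_derivative (a s : series) (e : Z) :
  (Z.abs e <= 1)%Z -> s 0%nat = 0%Z -> conv s -> sD a = smul (sC e) (smul s a) -> conv a.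
Proof.
intros He Hs0 Hs HD. apply conv_bounded => rho Hr.
set A := Series (fun n => Rabs (IZR (s n)) * rho ^ n)%R.
destruct (INR_unbounded A) as [N HN].
have Hex : exists K, forall n, (n <= N)%nat -> (Rabs (IZR (a n)) * rho ^ n <= K)%R.
{ elim: {HN} N => [|N [K HK]].
  - exists (Rabs (IZR (a 0%nat)) * rho ^ 0)%R => n Hn. have -> : n = 0%nat by lia. lra.
  - exists (Rmax K (Rabs (IZR (a (S N))) * rho ^ S N)) => n Hn.
    destruct (Nat.eq_dec n (S N)) as [->|]; first apply Rmax_r.
    apply: Rle_trans; [apply HK; lia | apply Rmax_l]. }
destruct Hex as [K HK].
have P : forall (c : series) k, (0 <= Rabs (IZR (c k)) * rho ^ k)%R.
{ intros c k. apply Rmult_le_pos; [apply Rabs_pos | apply pow_le; lra]. }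
have HA : (0 <= A)%R by apply Series_ge_0; [apply P | apply Hs; lra].
exists K => n. elim/(well_founded_induction lt_wf): n => n IH.
destruct (Nat.le_gt_cases n N) as [Hn|Hn]; first by apply HK.
have HnR : (A < INR n)%R by apply: Rlt_trans; [exact HN | apply lt_INR].
have HK0 : (0 <= K)%R by apply: Rle_trans (IH 0%nat ltac:(lia)).
apply (Rmult_le_reg_l (INR n)); first lra.
have E : (INR n * (Rabs (IZR (a n)) * rho ^ n) <= Rabs (IZR (smul s a n)) * rho ^ n)%R.
{ rewrite -Rmult_assoc. apply Rmult_le_compat_r; first by apply pow_le; lra.
  have E := f_equal (fun f => f n) HD. rewrite sC_mul /sD in E.
  rewrite INR_IZR_INZ -(Rabs_pos_eq (IZR (Z.of_nat n))); last by apply (IZR_le 0); lia.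
  rewrite -Rabs_mult -mult_IZR E mult_IZR Rabs_mult -abs_IZR.
  have := IZR_le _ _ He. have := Rabs_pos (IZR (smul s a n)). have := IZR_le 0 _ (Z.abs_nonneg e). nra. }
apply: Rle_trans; first exact E.
apply: Rle_trans; first by apply Rmult_le_compat_r; [apply pow_le; lra | apply Rabs_zsum].
rewrite Rmult_comm scal_sum.
apply (Rle_trans _ (sum_f_R0 (fun k => (Rabs (IZR (s k)) * rho ^ k) * K)%R n)).
- apply sum_Rle => k Hk. rewrite mult_IZR Rabs_mult.
  destruct k as [|k].
  + rewrite Hs0 Rabs_R0. simpl. lra.
  + have Hind := IH (n - S k)%nat ltac:(lia).
    replace (rho ^ n)%R with (rho ^ S k * rho ^ (n - S k))%R by (rewrite -pow_add; f_equal; lia).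
    have := P s (S k). intros Ps.
    replace (Rabs (IZR (s (S k))) * Rabs (IZR (a (n - S k)%nat)) * (rho ^ S k * rho ^ (n - S k)))%R with
     ((Rabs (IZR (s (S k))) * rho ^ S k) * (Rabs (IZR (a (n - S k)%nat)) * rho ^ (n - S k)))%R by ring.
    by apply Rmult_le_compat_l.
- rewrite -scal_sum Rmult_comm. apply Rmult_le_compat_r; auto.
  apply: Rle_trans; last by left; exact HnR.
  apply sum_f_R0_le_Series; [apply P | apply Hs; lra].
Qed.

Lemma sC_opp1 (a : series) : smul (sC (-1)) a = sopp a.
Proof. apply functional_extensionality => n. rewrite sC_mul /sopp. lia. Qed.

Lemma conv_seta : conv seta.
Proof.
apply (conv_log_derivative seta ssig (-1)); auto; [lia | apply conv_ssig |].
rewrite sC_opp1 sD_seta. ring.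
Qed.

Lemma conv_spart : conv spart.
Proof.
apply (conv_log_derivative spart ssig 1); auto; [lia | apply conv_ssig |].
rewrite sD_spart. change (sC 1) with s1. ring.
Qed.

(* f'(z) = l, with a quadratic error term. *)
Definition sd (f : C -> C) (z l : C) : Prop :=
  exists K d : R, (0 <= K)%R /\ (0 < d)%R /\
    forall w, (Cmod w < d)%R -> (Cmod (f (z + w)%C - f z - l * w) <= K * Cmod w ^ 2)%R.

Lemma sd_ext (f g : C -> C) (z l : C) : (0 < Im z)%R ->
  (forall u, (0 < Im u)%R -> f u = g u) -> sd f z l -> sd g z l.
Proof.
intros Hz H (K & d & HK & Hd & B). exists K, (Rmin d (Im z)). split; auto.
split; first by apply Rmin_pos. intros w Hw.
have H1 := Rmin_l d (Im z). have H2 := Rmin_r d (Im z).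
rewrite -!H //; first by apply B; lra.
have := im_le_Cmod w. have := Rle_abs (- Im w). rewrite Rabs_Ropp.
have -> : Im (z + w) = (Im z + Im w)%R by []. lra.
Qed.

Lemma sd_value (f : C -> C) (z l m : C) : l = m -> sd f z l -> sd f z m.
Proof. by move=> ->. Qed.

Lemma sd_mult (f g : C -> C) (z l m : C) :
  sd f z l -> sd g z m -> sd (fun u => f u * g u) z (f z * m + l * g z).
Proof.
intros (K1 & d1 & HK1 & Hd1 & B1) (K2 & d2 & HK2 & Hd2 & B2).
exists (Cmod (f z) * K2 + K1 * Cmod (g z) + (Cmod l + K1) * (Cmod m + K2))%R, (Rmin 1 (Rmin d1 d2)).
have P1 := Cmod_ge_0 (f z). have P2 := Cmod_ge_0 (g z). have P3 := Cmod_ge_0 l. have P4 := Cmod_ge_0 m.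
split; [|split].
- repeat apply Rplus_le_le_0_compat; apply Rmult_le_pos; lra.
- apply Rmin_pos; first lra. by apply Rmin_pos.
- intros w Hw. have H1 := Rmin_l 1 (Rmin d1 d2). have H2 := Rmin_r 1 (Rmin d1 d2).
  have H3 := Rmin_l d1 d2. have H4 := Rmin_r d1 d2. have Hw0 := Cmod_ge_0 w.
  have E1 := B1 w ltac:(lra). have E2 := B2 w ltac:(lra).
  set r1 := f (z + w)%C - f z - l * w in E1. set r2 := g (z + w)%C - g z - m * w in E2.
  have Ww : (Cmod w ^ 2 <= Cmod w)%R by nra.
  have A1 : (Cmod (l * w + r1) <= (Cmod l + K1) * Cmod w)%R.
  { apply: Rle_trans; first apply Cmod_triangle. rewrite Cmod_mult. nra. }
  have A2 : (Cmod (m * w + r2) <= (Cmod m + K2) * Cmod w)%R.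
  { apply: Rle_trans; first apply Cmod_triangle. rewrite Cmod_mult. nra. }
  replace (f (z + w)%C * g (z + w)%C - f z * g z - (f z * m + l * g z) * w) with
    (f z * r2 + r1 * g z + (l * w + r1) * (m * w + r2)) by (rewrite /r1 /r2; ring).
  apply: Rle_trans; first apply Cmod_triangle.
  apply: Rle_trans; first by apply Rplus_le_compat_r, Cmod_triangle.
  rewrite !Cmod_mult.
  have T1 : (Cmod (f z) * Cmod r2 <= Cmod (f z) * (K2 * Cmod w ^ 2))%R by apply Rmult_le_compat_l.
  have T2 : (Cmod r1 * Cmod (g z) <= (K1 * Cmod w ^ 2) * Cmod (g z))%R by apply Rmult_le_compat_r.
  have T3 : (Cmod (l * w + r1) * Cmod (m * w + r2) <= ((Cmod l + K1) * Cmod w) * ((Cmod m + K2) * Cmod w))%R.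
  { apply Rmult_le_compat; auto; apply Cmod_ge_0. }
  lra.
Qed.

Lemma Cmod_half (z w : C) : (Cmod w < Cmod z / 2)%R -> (Cmod z / 2 <= Cmod (z + w))%R.
Proof.
intros H. have := Cmod_triangle_inv z (- w). rewrite Cmod_opp.
replace (z - - w) with (z + w) by ring. lra.
Qed.

Lemma inv_increment (z w : C) : z <> 0 -> (Cmod w < Cmod z / 2)%R ->
  z + w <> 0 /\
  (Cmod (/ (z + w) - / z + / z ^ 2 * w) <= 2 / Cmod z ^ 3 * Cmod w ^ 2)%R.
Proof.
intros Hz Hw. have Hz0 : (0 < Cmod z)%R by apply Cmod_gt_0.
have H := Cmod_half z w Hw.
have Hzw : z + w <> 0 by apply Cmod_gt_0; lra.
split; auto.
replace (/ (z + w) - / z + / z ^ 2 * w) with (w ^ 2 * / (z ^ 2 * (z + w))) by (field; auto).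
rewrite Cmod_mult Cmod_inv; last by apply Cmult_neq_0; [apply Cpow_nz|].
rewrite Cmod_mult !Cmod_pow Rmult_comm. apply Rmult_le_compat_r; first by apply pow_le, Cmod_ge_0.
replace (2 / Cmod z ^ 3)%R with (/ (Cmod z ^ 2 * (Cmod z / 2)))%R by (field; lra).
have Hp : (0 < Cmod z ^ 2)%R by apply pow_lt.
apply Rinv_le_contravar; [apply Rmult_lt_0_compat; lra | apply Rmult_le_compat_l; lra].
Qed.

Lemma sd_inv (z : C) : z <> 0 -> sd (fun u => / u) z (- / z ^ 2).
Proof.
intros Hz. have Hz0 : (0 < Cmod z)%R by apply Cmod_gt_0.
exists (2 / Cmod z ^ 3)%R, (Cmod z / 2)%R. split; [|split].
- left. apply Rdiv_lt_0_compat; [lra | by apply pow_lt].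
- lra.
- intros w Hw. replace (/ (z + w) - / z - - / z ^ 2 * w) with (/ (z + w) - / z + / z ^ 2 * w) by ring.
  by apply inv_increment.
Qed.

Lemma sd_comp_inv (f : C -> C) (z l : C) : z <> 0 ->
  sd f (- / z) l -> sd (fun u => f (- / u)) z (l * / z ^ 2).
Proof.
intros Hz (K & d & HK & Hd & B). have Hz0 : (0 < Cmod z)%R by apply Cmod_gt_0.
have Hp2 : (0 < Cmod z ^ 2)%R by apply pow_lt. have Hp3 : (0 < Cmod z ^ 3)%R by apply pow_lt.
exists (K * (2 / Cmod z ^ 2) ^ 2 + Cmod l * (2 / Cmod z ^ 3))%R, (Rmin (Cmod z / 2) (d * (Cmod z ^ 2 / 2))).
have Pl := Cmod_ge_0 l.
split; [|split].
- apply Rplus_le_le_0_compat; apply Rmult_le_pos; auto.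
  + apply pow_le. left. apply Rdiv_lt_0_compat; lra.
  + left. apply Rdiv_lt_0_compat; lra.
- apply Rmin_pos; first lra. apply Rmult_lt_0_compat; lra.
- intros w Hw. have H1 := Rmin_l (Cmod z / 2) (d * (Cmod z ^ 2 / 2)). have H2 := Rmin_r (Cmod z / 2) (d * (Cmod z ^ 2 / 2)).
  destruct (inv_increment z w Hz ltac:(lra)) as [Hzw Hinc].
  have Hhalf := Cmod_half z w ltac:(lra).
  set w' := w / (z * (z + w)).
  have Ew : - / (z + w) = - / z + w' by rewrite /w'; field; auto.
  have Bw : (Cmod w' <= 2 / Cmod z ^ 2 * Cmod w)%R.
  { rewrite /w' Cmod_div; last by apply Cmult_neq_0. rewrite Cmod_mult.
    replace (2 / Cmod z ^ 2 * Cmod w)%R with (Cmod w * / (Cmod z * (Cmod z / 2)))%R by (field; lra).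
    apply Rmult_le_compat_l; first apply Cmod_ge_0.
    apply Rinv_le_contravar; [apply Rmult_lt_0_compat; lra | apply Rmult_le_compat_l; lra]. }
  have Bd : (Cmod w' < d)%R.
  { apply: Rle_lt_trans; first exact Bw.
    apply (Rmult_lt_reg_r (Cmod z ^ 2 / 2)); first lra.
    replace (2 / Cmod z ^ 2 * Cmod w * (Cmod z ^ 2 / 2))%R with (Cmod w) by (field; lra). lra. }
  have Hf := B w' Bd. rewrite Ew.
  replace (f (- / z + w') - f (- / z) - l * / z ^ 2 * w) with
    ((f (- / z + w') - f (- / z) - l * w') + l * (w' - / z ^ 2 * w)) by ring.
  apply: Rle_trans; first apply Cmod_triangle. rewrite Rmult_plus_distr_r. apply Rplus_le_compat.
  + apply: Rle_trans; first exact Hf. rewrite Rmult_assoc. apply Rmult_le_compat_l; auto.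
    rewrite -Rpow_mult_distr. apply pow_incr. split; auto. apply Cmod_ge_0.
  + rewrite Cmod_mult Rmult_assoc. apply Rmult_le_compat_l; auto.
    replace (w' - / z ^ 2 * w) with (- (/ (z + w) - / z + / z ^ 2 * w)).
    * by rewrite Cmod_opp.
    * rewrite /w'. field. auto.
Qed.

Lemma sd_qexp (c z : C) : sd (fun u => qexp (c * u)) z (twopii * c * qexp (c * z)).
Proof.
destruct qexp_taylor as [K [HK B]].
have Pc := Cmod_ge_0 c.
exists (Cmod (qexp (c * z)) * (K * Cmod c ^ 2))%R, (/ (Cmod c + 1))%R. split; [|split].
- apply Rmult_le_pos; first apply Cmod_ge_0. apply Rmult_le_pos; [lra | apply pow_le; lra].
- apply Rinv_0_lt_compat. lra.
- intros w Hw. have Hw0 := Cmod_ge_0 w.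
  have Hcw : (Cmod (c * w) <= 1)%R.
  { rewrite Cmod_mult. apply (Rmult_lt_compat_r (Cmod c + 1)) in Hw; last lra.
    rewrite Rinv_l in Hw; last lra. nra. }
  have E := B _ Hcw.
  replace (qexp (c * (z + w)) - qexp (c * z) - twopii * c * qexp (c * z) * w) with
    (qexp (c * z) * (qexp (c * w) - 1 - twopii * (c * w))).
  + rewrite Cmod_mult Rmult_assoc. apply Rmult_le_compat_l; first apply Cmod_ge_0.
    apply: Rle_trans; first exact E. rewrite Cmod_mult Rpow_mult_distr. lra.
  + rewrite Cmult_plus_distr_l qexp_plus. ring.
Qed.

(** The exponential factor admits large w, as is needed for the arguments n w with n unbounded. *)
Lemma qexp_taylor_global : exists K : R, (0 < K)%R /\
  forall w, (Cmod (qexp w - 1 - twopii * w) <= K * Cmod w ^ 2 * exp (2 * PI * Cmod w))%R.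
Proof.
destruct qexp_taylor as [K [HK B]]. have Hpi := PI_RGT_0.
exists (K + (2 + 2 * PI))%R. split; first lra. intros w. have Hw := Cmod_ge_0 w.
have He : (1 <= exp (2 * PI * Cmod w))%R.
{ rewrite -exp_0. destruct (Req_dec (2 * PI * Cmod w) 0) as [->|Hne]; first lra. left. apply exp_increasing. nra. }
have Hw2 : (0 <= Cmod w ^ 2)%R by apply pow_le.
destruct (Rle_lt_dec (Cmod w) 1) as [H|H].
- apply: Rle_trans; first by apply B.
  have : (0 <= K * Cmod w ^ 2)%R by apply Rmult_le_pos; lra.
  have : (0 <= (2 + 2 * PI) * Cmod w ^ 2)%R by apply Rmult_le_pos; lra. nra.
- have Ht : Cmod twopii = (2 * PI)%R.
  { replace twopii with (Ci * RtoC (2 * PI)) by (apply C_eq; rewrite /Re /Im /=; ring).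
    rewrite Cmod_mult Cmod_Ci Cmod_R Rabs_pos_eq; lra. }
  apply: Rle_trans; first apply Cmod_triangle.
  apply: Rle_trans; first by apply Rplus_le_compat_r, Cmod_triangle.
  rewrite !Cmod_opp Cmod_mult Cmod_1 Ht Cmod_qexp.
  have Hq : (exp (-2 * PI * Im w) <= exp (2 * PI * Cmod w))%R.
  { have := im_le_Cmod w. have := Rle_abs (- Im w). rewrite Rabs_Ropp. intros.
    destruct (Req_dec (-2 * PI * Im w) (2 * PI * Cmod w)) as [->|Hne]; first lra. left. apply exp_increasing. nra. }
  set X := exp (2 * PI * Cmod w) in He Hq *. set Y := exp (- 2 * PI * Im w) in Hq *.
  have H2 : (Cmod w <= Cmod w ^ 2)%R by nra.
  have H3 : (1 <= Cmod w ^ 2)%R by lra.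
  have H4 : (0 <= K * Cmod w ^ 2 * X)%R by apply Rmult_le_pos; [apply Rmult_le_pos|]; lra.
  have H5 : (X <= Cmod w ^ 2 * X)%R by nra.
  have H6 : (Cmod w <= Cmod w ^ 2 * X)%R by nra.
  nra.
Qed.

(** The error of the term of index n is a_n e(n z)(e(n w) - 1 - 2 pi i n w), at most of order n^2
    |w|^2 exp(2 pi n |w|). For |w| < Im z / 2 the exponential uses up only half of the decay of e(n
    z). *)
Lemma sd_qval (a : series) (z : C) : conv a -> (0 < Im z)%R ->
  sd (qval a) z (twopii * qval (sD a) z).
Proof.
intros Ha Hz. destruct qexp_taylor_global as [K [HK B]]. have Hpi := PI_RGT_0.
set rho := exp (- 2 * PI * (Im z / 2)).
have Hrho : (0 <= rho < 1)%R.
{ apply (exp_im_range (0%R, (Im z / 2)%R)). change (0 < Im z / 2)%R. lra. }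
have HD := conv_sD a Ha. have HDD := conv_sD _ HD.
exists (K * Series (fun n => Rabs (IZR (sD (sD a) n)) * rho ^ n))%R, (Im z / 2)%R. split; [|split].
- apply Rmult_le_pos; first lra. apply Series_ge_0; last by apply HDD.
  intros k. apply Rmult_le_pos; [apply Rabs_pos | apply pow_le; lra].
- lra.
- intros w Hw.
  have Hzw : (0 < Im (z + w))%R.
  { have := im_le_Cmod w. have := Rle_abs (- Im w). rewrite Rabs_Ropp.
    have -> : Im (z + w) = (Im z + Im w)%R by []. lra. }
  have A1 := conv_asum a (z + w) Ha Hzw. have A2 := conv_asum a z Ha Hz. have A3 := conv_asum _ z HD Hz.
  have E : qval a (z + w)%C - qval a z - twopii * qval (sD a) z * w =
    CS (fun n => qpow a (z + w) n + (- (1) * qpow a z n + (- (twopii * w)) * qpow (sD a) z n)).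
  { rewrite !qval_CS CS_plus; auto; last by apply asum_plus; apply asum_scal.
    rewrite CS_plus; try by apply asum_scal. rewrite !CS_scal //. ring. }
  rewrite E.
  replace (K * Series (fun n => Rabs (IZR (sD (sD a) n)) * rho ^ n) * Cmod w ^ 2)%R with
    (Series (fun n => (K * Cmod w ^ 2) * (Rabs (IZR (sD (sD a) n)) * rho ^ n)))%R by (rewrite Series_scal_l; ring).
  apply Cmod_CS_le; last by apply: ex_series_scal_l; apply HDD.
  intros n.
  have -> : qpow a (z + w) n + (- (1) * qpow a z n + (- (twopii * w)) * qpow (sD a) z n) =
    qpow a z n * (qexp (INR n * w) - 1 - twopii * (INR n * w)).
  { rewrite /qpow /sD qexp_plus Cpow_mult_l qexp_nat mult_IZR -INR_IZR_INZ RtoC_mult. ring. }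
  rewrite Cmod_mult Cmod_qpow.
  have Bn := B (INR n * w). have Pn := pos_INR n. have Pw := Cmod_ge_0 w.
  rewrite Cmod_mult Cmod_R (Rabs_pos_eq (INR n)) // in Bn.
  apply (Rle_trans _ (Rabs (IZR (a n)) * exp (-2 * PI * Im z) ^ n * (K * (INR n * Cmod w) ^ 2 * exp (2 * PI * (INR n * Cmod w))))).
  { apply Rmult_le_compat_l; auto. apply Rmult_le_pos; [apply Rabs_pos | apply pow_le; left; apply exp_pos]. }
  have Ee : (exp (-2 * PI * Im z) ^ n * exp (2 * PI * (INR n * Cmod w)) <= rho ^ n)%R.
  { have -> : exp (2 * PI * (INR n * Cmod w)) = (exp (2 * PI * Cmod w) ^ n)%R.
    { rewrite -(exp_ln (exp (2 * PI * Cmod w) ^ n)); last by apply pow_lt, exp_pos.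
      rewrite ln_pow; last by apply exp_pos. rewrite ln_exp. f_equal. ring. }
    rewrite -Rpow_mult_distr -exp_plus. apply pow_incr. split; first by left; apply exp_pos.
    rewrite /rho. left. apply exp_increasing. nra. }
  replace (K * Cmod w ^ 2 * (Rabs (IZR (sD (sD a) n)) * rho ^ n))%R with
    (Rabs (IZR (a n)) * (K * (INR n * Cmod w) ^ 2) * rho ^ n)%R.
  + replace (Rabs (IZR (a n)) * exp (-2 * PI * Im z) ^ n * (K * (INR n * Cmod w) ^ 2 * exp (2 * PI * (INR n * Cmod w))))%R with
     (Rabs (IZR (a n)) * (K * (INR n * Cmod w) ^ 2) * (exp (-2 * PI * Im z) ^ n * exp (2 * PI * (INR n * Cmod w))))%R by ring.
    apply Rmult_le_compat_l; auto. apply Rmult_le_pos; first apply Rabs_pos.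
    apply Rmult_le_pos; [lra | apply pow_le, Rmult_le_pos; auto].
  + rewrite /sD !mult_IZR !Rabs_mult -INR_IZR_INZ (Rabs_pos_eq (INR n)) //. ring.
Qed.

(** Along the segment from z1 to z2 the real and imaginary parts of f have real derivative 0, read
    off directly from the quadratic error term. *)
Lemma sd_zero_constant (f : C -> C) : (forall z, (0 < Im z)%R -> sd f z 0) ->
  forall z1 z2, (0 < Im z1)%R -> (0 < Im z2)%R -> f z1 = f z2.
Proof.
intros H z1 z2 H1 H2.
set d := z2 - z1.
have Hpt : forall t, (0 <= t <= 1)%R -> (0 < Im (z1 + RtoC t * d))%R.
{ intros t Ht. have -> : Im (z1 + RtoC t * d) = ((1 - t) * Im z1 + t * Im z2)%R.
  { rewrite /d. destruct z1, z2. rewrite /Im /=. ring. }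
  destruct (Rle_lt_dec t (/ 2)); nra. }
have Hder : forall P : C -> R, (forall u v, (P (u - v)%C = P u - P v)%R) -> (forall u, (Rabs (P u) <= Cmod u)%R) ->
  P (f z1) = P (f z2).
{ intros P Plin Pbd.
  replace z2 with (z1 + RtoC 1 * d) by (rewrite /d; ring).
  replace z1 with (z1 + RtoC 0 * d) at 1 by ring.
  apply (eq_is_derive (fun t => P (f (z1 + RtoC t * d)%C)) 0 1); last lra.
  intros t Ht. apply is_derive_Reals. intros eps Heps.
  destruct (H _ (Hpt t Ht)) as (K & dl & HK & Hdl & B).
  have Pd := Cmod_ge_0 d.
  have Hq : (0 < K * Cmod d ^ 2 + 1)%R.
  { have : (0 <= K * Cmod d ^ 2)%R by apply Rmult_le_pos; [|apply pow_le]. lra. }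
  have Hmin : (0 < Rmin (dl / (Cmod d + 1)) (eps / (K * Cmod d ^ 2 + 1)))%R.
  { apply Rmin_pos; apply Rdiv_lt_0_compat; lra. }
  exists (mkposreal _ Hmin). intros h Hh0 Hh.
  change (Rabs h < Rmin (dl / (Cmod d + 1)) (eps / (K * Cmod d ^ 2 + 1)))%R in Hh.
  have M1 := Rmin_l (dl / (Cmod d + 1)) (eps / (K * Cmod d ^ 2 + 1)).
  have M2 := Rmin_r (dl / (Cmod d + 1)) (eps / (K * Cmod d ^ 2 + 1)).
  have Hw : (Cmod (RtoC h * d) < dl)%R.
  { rewrite Cmod_mult Cmod_R. have Hh1 : (Rabs h < dl / (Cmod d + 1))%R by lra.
    apply (Rmult_lt_compat_r (Cmod d + 1)) in Hh1; last lra.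
    replace (dl / (Cmod d + 1) * (Cmod d + 1))%R with dl in Hh1 by (field; lra).
    have := Rabs_pos h. nra. }
  have E := B _ Hw.
  replace (f (z1 + RtoC t * d + RtoC h * d)%C - f (z1 + RtoC t * d)%C - 0 * (RtoC h * d)) with
    (f (z1 + RtoC (t + h) * d)%C - f (z1 + RtoC t * d)%C) in E.
  2:{ rewrite RtoC_plus. replace (z1 + (RtoC t + RtoC h) * d) with (z1 + RtoC t * d + RtoC h * d) by ring. ring. }
  rewrite -Plin Rminus_0_r Rabs_div //.
  have Hh' : (0 < Rabs h)%R by apply Rabs_pos_lt.
  apply (Rmult_lt_reg_r (Rabs h)); auto.
  rewrite /Rdiv Rmult_assoc Rinv_l ?Rmult_1_r; last lra.
  apply: Rle_lt_trans; first apply Pbd. apply: Rle_lt_trans; first exact E.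
  rewrite Cmod_mult Cmod_R Rpow_mult_distr.
  have Hh2 : (Rabs h < eps / (K * Cmod d ^ 2 + 1))%R by lra.
  apply (Rmult_lt_compat_r (K * Cmod d ^ 2 + 1)) in Hh2; last lra.
  replace (eps / (K * Cmod d ^ 2 + 1) * (K * Cmod d ^ 2 + 1))%R with eps in Hh2 by (field; lra).
  nra. }
apply C_eq; apply Hder.
- intros u v. destruct u, v. rewrite /Re /=. ring.
- intros u. apply re_le_Cmod.
- intros u v. destruct u, v. rewrite /Im /=. ring.
- intros u. apply im_le_Cmod.
Qed.

(* eta^2 and its inverse *)
Definition heta (z : C) : C := qexp (z / RtoC 12) * (qval seta z * qval seta z).
Definition hetai (z : C) : C := qexp (- z / RtoC 12) * (qval spart z * qval spart z).

Lemma qval_seta_spart (z : C) : (0 < Im z)%R -> qval seta z * qval spart z = 1.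
Proof.
intros Hz. rewrite -qval_smul ?seta_spart ?qval_s1 //; [apply conv_seta | apply conv_spart].
Qed.

Lemma heta_hetai (z : C) : (0 < Im z)%R -> heta z * hetai z = 1.
Proof.
intros Hz. rewrite /heta /hetai.
transitivity (qexp (z / RtoC 12 + - z / RtoC 12) * (qval seta z * qval spart z) * (qval seta z * qval spart z)).
- rewrite qexp_plus. ring.
- rewrite qval_seta_spart //. replace (z / RtoC 12 + - z / RtoC 12) with (RtoC 0) by field.
  rewrite qexp_0. ring.
Qed.

Lemma sd_heta (z : C) : (0 < Im z)%R -> sd heta z (twopii / RtoC 12 * qval sE2 z * heta z).
Proof.
intros Hz.
have H1 := sd_qval seta z conv_seta Hz.
have E1 : qval (sD seta) z = - (qval seta z * qval ssig z).
{ rewrite sD_seta qval_sopp ?qval_smul //; [apply conv_seta | apply conv_ssig | by apply conv_smul; [apply conv_seta | apply conv_ssig]]. }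
apply (sd_ext (fun u => qexp (/ RtoC 12 * u) * (qval seta u * qval seta u)) heta z _ Hz).
{ intros u _. by rewrite /heta /Cdiv Cmult_comm (Cmult_comm u) Cmult_comm. }
apply: sd_value; last exact (sd_mult _ _ _ _ _ (sd_qexp (/ RtoC 12) z) (sd_mult _ _ _ _ _ H1 H1)).
rewrite E1 qval_sE2 // /heta. replace (z / RtoC 12) with (/ RtoC 12 * z) by (rewrite /Cdiv; ring).
field.
Qed.

Lemma sd_hetai (z : C) : (0 < Im z)%R -> sd hetai z (- (twopii / RtoC 12) * qval sE2 z * hetai z).
Proof.
intros Hz.
have H1 := sd_qval spart z conv_spart Hz.
have E1 : qval (sD spart) z = qval spart z * qval ssig z.
{ rewrite sD_spart qval_smul //; [apply conv_spart | apply conv_ssig]. }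
apply (sd_ext (fun u => qexp (- / RtoC 12 * u) * (qval spart u * qval spart u)) hetai z _ Hz).
{ intros u _. rewrite /hetai. by replace (- u / RtoC 12) with (- / RtoC 12 * u) by (rewrite /Cdiv; ring). }
apply: sd_value; last exact (sd_mult _ _ _ _ _ (sd_qexp (- / RtoC 12) z) (sd_mult _ _ _ _ _ H1 H1)).
rewrite E1 qval_sE2 // /hetai. replace (- z / RtoC 12) with (- / RtoC 12 * z) by (rewrite /Cdiv; ring).
field.
Qed.

(** The quotient of [heta (- / u)] by [u * heta u] has derivative 0, because the term 12 z / (2 pi
    i) in the law of E_2 cancels the logarithmic derivative of u. At the fixed point u = i the
    quotient is 1 / i = - i. *)
Theorem heta_inversion (z : C) : (0 < Im z)%R -> heta (- / z) = - Ci * z * heta z.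
Proof.
set k := fun u => heta (- / u) * (/ u * hetai u).
have Hk : forall u, (0 < Im u)%R -> sd k u 0.
{ intros u Hu. have Hn := z_neq_0 u Hu. have Hi := Im_minv u Hu. have Ht := twopii_neq_0.
  apply: sd_value; last exact (sd_mult _ _ _ _ _ (sd_comp_inv heta u _ Hn (sd_heta _ Hi)) (sd_mult _ _ _ _ _ (sd_inv u Hn) (sd_hetai u Hu))).
  rewrite /minv E2_inversion //. field. auto. }
intros Hz.
have Hi1 : (0 < Im Ci)%R by rewrite /Im /=; lra.
have E := sd_zero_constant k Hk z Ci Hz Hi1. rewrite /k in E.
have Ni : Ci <> 0 by apply Im_pos_neq_0.
have Ei : - / Ci = Ci by rewrite Ci_inv; ring.
rewrite Ei in E. have Hn := z_neq_0 z Hz.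
have Eh := heta_hetai z Hz. have Ehi := heta_hetai Ci Hi1.
transitivity (z * heta z * (heta (- / z) * (/ z * hetai z))).
- transitivity (heta (- / z) * (heta z * hetai z)); [rewrite Eh; ring | field; auto].
- rewrite E. transitivity (z * heta z * (/ Ci * (heta Ci * hetai Ci))); first ring.
  rewrite Ehi Ci_inv. ring.
Qed.

Lemma heta_shift (z : C) (n : Z) : heta (z + IZR n) = qexp (RtoC (IZR n) / RtoC 12) * heta z.
Proof.
rewrite /heta qval_shift. replace ((z + IZR n) / RtoC 12) with (RtoC (IZR n) / RtoC 12 + z / RtoC 12) by field.
rewrite qexp_plus. ring.
Qed.

(** * Generators of Gamma_0(5) *)

Section Generation.
Variable k : nat.
Hypothesis Hk : forall x : C, (- x) ^ k = x ^ k.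

Definition law (phi : C -> C) (al be ga de : Z) : Prop :=
  forall z, (0 < Im z)%R -> phi (mobius al be ga de z) = autfac ga de k z * phi z.

Variables (phi psi : C -> C) (kappa kappa' : C).
Hypothesis phi_T : forall n z, phi (z + RtoC (IZR n)) = phi z.
Hypothesis psi_T : forall n z, psi (z + RtoC (IZR n)) = psi z.
Hypothesis phi_g : law phi 2 (-1) 5 (-2).
Hypothesis psi_g : law psi 2 (-1) 5 (-2).
Hypothesis phi_W : forall z, (0 < Im z)%R -> phi (mobius 0 (-1) 5 0 z) = kappa * autfac 5 0 k z * psi z.
Hypothesis psi_W : forall z, (0 < Im z)%R -> psi (mobius 0 (-1) 5 0 z) = kappa' * autfac 5 0 k z * phi z.
Hypothesis Hkk : kappa * kappa' * RtoC 5 ^ k = 1.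

Lemma law_mul (a b c d al be ga de : Z) :
  (a * d - b * c = 1)%Z -> (al * de - be * ga = 1)%Z -> law phi a b c d -> law phi al be ga de ->
  law phi (a * al + b * ga) (a * be + b * de) (c * al + d * ga) (c * be + d * de).
Proof.
intros D1 D2 H1 H2 z Hz.
have Hv : (0 < Im (mobius al be ga de z))%R by apply Im_mobius_pos; auto; lia.
have N1 : RtoC (IZR ga) * z + RtoC (IZR de) <> 0 by apply linear_neq_0; auto; nia.
have N2 : RtoC (IZR c) * mobius al be ga de z + RtoC (IZR d) <> 0 by apply linear_neq_0; auto; nia.
rewrite -mobius_comp // H1 // H2 // /autfac Cmult_assoc -Cpow_mult_l. f_equal. f_equal.
rewrite /mobius !plus_IZR !mult_IZR !RtoC_plus !RtoC_mult. field. auto.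
Qed.

Lemma law_opp (al be ga de : Z) : (al * de - be * ga = 1)%Z -> law phi al be ga de -> law phi (- al) (- be) (- ga) (- de).
Proof.
intros D H z Hz.
have N1 : RtoC (IZR ga) * z + RtoC (IZR de) <> 0 by apply linear_neq_0; auto; nia.
have N2 : - RtoC (IZR ga) * z + - RtoC (IZR de) <> 0.
{ replace (- RtoC (IZR ga) * z + - RtoC (IZR de)) with (- (1) * (RtoC (IZR ga) * z + RtoC (IZR de))) by ring.
  apply Cmult_neq_0; auto. intros E. have := f_equal Re E. rewrite /Re /=. lra. }
have E : mobius (- al) (- be) (- ga) (- de) z = mobius al be ga de z.
{ rewrite /mobius !opp_IZR !RtoC_opp. field. auto. }
rewrite E H // /autfac !opp_IZR !RtoC_opp. f_equal.
replace (- RtoC (IZR ga) * z + - RtoC (IZR de)) with (- (RtoC (IZR ga) * z + RtoC (IZR de))) by ring.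
by rewrite Hk.
Qed.

Lemma law_T (n : Z) : law phi 1 n 0 1.
Proof.
intros z Hz. have -> : mobius 1 n 0 1 z = z + RtoC (IZR n) by rewrite /mobius; field.
rewrite phi_T /autfac. replace (0 * z + 1) with (RtoC 1) by ring. rewrite Cpow_1_l. ring.
Qed.

Lemma W_point (z : C) : (0 < Im z)%R -> mobius 0 (-1) 5 0 z = - (1) / (RtoC 5 * z) /\ (0 < Im (mobius 0 (-1) 5 0 z))%R.
Proof.
intros Hz. have Hn := Im_pos_neq_0 z Hz. split; last by apply Im_mobius_pos; auto; lia.
rewrite /mobius. field. auto.
Qed.

(** W squares to the scalar matrix -5; the constants of two applications of W cancel against the
    power (-5)^k. *)
Lemma kk_pow (x y : C) : x = - (RtoC 5 * y) -> kappa * kappa' * x ^ k = y ^ k.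
Proof.
move=> ->. rewrite Hk Cpow_mult_l. transitivity (kappa * kappa' * RtoC 5 ^ k * y ^ k); first ring.
rewrite Hkk. ring.
Qed.

(** The matrix (1 0; 5n 1) is the conjugate of T^(-n) by W, so its law for [phi] comes from the
    periodicity of [psi]. *)
Lemma law_V (n : Z) : law phi 1 0 (5 * n) 1.
Proof.
intros z Hz. destruct (W_point z Hz) as [E HW]. have Hn := Im_pos_neq_0 z Hz.
set u := mobius 0 (-1) 5 0 z in E HW.
have Hu : (0 < Im (u + RtoC (IZR (- n))))%R.
{ have -> : Im (u + RtoC (IZR (- n))) = (Im u + 0)%R by []. lra. }
have Nu := Im_pos_neq_0 _ Hu.
have N1 : RtoC 5 * RtoC (IZR n) * z + 1 <> 0.
{ have := linear_neq_0 (5 * n) 1 z Hz ltac:(lia). by rewrite mult_IZR RtoC_mult. }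
have -> : mobius 1 0 (5 * n) 1 z = mobius 0 (-1) 5 0 (u + RtoC (IZR (- n))).
{ destruct (W_point _ Hu) as [E2 _]. rewrite E2. rewrite E opp_IZR RtoC_opp in Nu *.
  rewrite /mobius mult_IZR RtoC_mult.
  have N3 : - (1) - RtoC 5 * z * RtoC (IZR n) <> 0.
  { intros E0. apply N1. transitivity (- (- (1) - RtoC 5 * z * RtoC (IZR n))); [ring | rewrite E0; ring]. }
  field. repeat split; auto.
  all: try (intros E0; apply N1; rewrite -E0; ring).
  all: try (intros E0; apply N3; rewrite -E0; ring). }
rewrite phi_W // psi_T psi_W // /autfac.
transitivity (kappa * kappa' * ((RtoC 5 * (u + RtoC (IZR (- n))) + 0) * (RtoC 5 * z + 0)) ^ k * phi z).
- rewrite Cpow_mult_l. ring.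
- rewrite (kk_pow _ (RtoC (IZR (5 * n)) * z + 1)) //.
  rewrite E mult_IZR RtoC_mult opp_IZR RtoC_opp. field. auto.
Qed.

(** The matrix (-2 -1; 5 2) is the conjugate of g by W, so its law for [phi] comes from the law of g
    for [psi]. *)
Lemma law_g' : law phi (-2) (-1) 5 2.
Proof.
intros z Hz. destruct (W_point z Hz) as [E HW]. have Hn := Im_pos_neq_0 z Hz.
set u := mobius 0 (-1) 5 0 z in E HW.
have Hv : (0 < Im (mobius 2 (-1) 5 (-2) u))%R by apply Im_mobius_pos; auto; lia.
have N1 : RtoC 5 * u + RtoC (-2) <> 0 by apply linear_neq_0; auto; lia.
have N2 : RtoC 5 * z + RtoC 2 <> 0 by apply linear_neq_0; auto; lia.
have Nv : RtoC 2 * u + RtoC (-1) <> 0 by apply linear_neq_0; auto; lia.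
have Emul : (RtoC 2 * u + RtoC (-1)) * (RtoC 5 * z) = - (RtoC 5 * z + RtoC 2).
{ rewrite E. field. auto. }
have -> : mobius (-2) (-1) 5 2 z = mobius 0 (-1) 5 0 (mobius 2 (-1) 5 (-2) u).
{ destruct (W_point _ Hv) as [E2 _]. rewrite E2 /mobius.
  have E5 : (RtoC 5 * u + RtoC (-2)) * (RtoC 5 * z) = RtoC 5 * (RtoC (-2) * z + RtoC (-1)).
  { rewrite E. field. auto. }
  transitivity (- (1) * ((RtoC 5 * u + RtoC (-2)) * (RtoC 5 * z)) / (RtoC 5 * ((RtoC 2 * u + RtoC (-1)) * (RtoC 5 * z)))).
  - rewrite E5 Emul. field. auto.
  - field. auto. }
rewrite phi_W // psi_g // psi_W // /autfac.
transitivity (kappa * kappa' * ((RtoC 5 * mobius 2 (-1) 5 (-2) u + 0) * (RtoC 5 * u + RtoC (-2)) * (RtoC 5 * z + 0)) ^ k * phi z).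
- rewrite !Cpow_mult_l. ring.
- rewrite (kk_pow _ (RtoC 5 * z + RtoC 2)) //.
  transitivity (RtoC 5 * ((RtoC 2 * u + RtoC (-1)) * (RtoC 5 * z))).
  + rewrite /mobius. field. auto.
  + rewrite Emul. ring.
Qed.

(* Let V = (1 0; 5 1), g = (2 -1; 5 -2) and g' = (-2 -1; 5 2). Right multiplication by T^n makes
   |d| <= 5|c|/2 for the lower row (5c, d); then one of V, V^-1 (when |d| < 2|c|) and g, g' (when
   |d| >= 2|c|) decreases |c|. *)
Theorem gamma05_law (al be ga de : Z) : (al * de - be * ga = 1)%Z -> (5 | ga)%Z -> law phi al be ga de.
Proof.
intros D [c Hc]. rewrite Z.mul_comm in Hc.
remember (Z.to_nat (Z.abs c)) as n eqn:En.
move: al be ga de c D Hc En. elim/(well_founded_induction lt_wf): n => n IH al be ga de c D Hc En.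
destruct (Z.eq_dec c 0) as [Hc0|Hc0].
- have Hga : ga = 0%Z by lia. rewrite Hga Z.mul_0_r Z.sub_0_r in D. rewrite Hga.
  destruct (Z.eq_mul_1 al de D) as [E|E]; rewrite E in D *.
  + have -> : de = 1%Z by lia. apply law_T.
  + have -> : de = (-1)%Z by lia.
    have := law_opp 1 (- be) 0 1 ltac:(lia) (law_T (- be)). by rewrite Z.opp_involutive.
- have Hred : exists j, (2 * Z.abs (de + 5 * c * j) <= 5 * Z.abs c)%Z.
  (* Division rounded to the nearest integer: the remainder mod 10 |c|, diminished by 5 |c|, is
     twice the reduced lower right entry. *)
  { set q := ((2 * de + 5 * Z.abs c) / (10 * Z.abs c))%Z.
    have Hm := Z.div_mod (2 * de + 5 * Z.abs c) (10 * Z.abs c) ltac:(lia).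
    have Hb := Z.mod_pos_bound (2 * de + 5 * Z.abs c) (10 * Z.abs c) ltac:(lia).
    rewrite -/q in Hm. destruct (Z.abs_spec c) as [[H1 H2]|[H1 H2]]; rewrite H2 in Hm Hb *.
    - exists (- q)%Z. lia.
    - exists q. lia. }
  destruct Hred as [j Hj].
  set d := (de + 5 * c * j)%Z in Hj. set b := (be + al * j)%Z.
  have Db : (al * d - b * ga = 1)%Z by rewrite /d /b Hc; nia.
  suff Hmain : law phi al b ga d.
  { have H := law_mul al b ga d 1 (- j) 0 1 Db ltac:(lia) Hmain (law_T (- j)).
    replace (al * 1 + b * 0)%Z with al in H by ring.
    replace (al * - j + b * 1)%Z with be in H by (rewrite /b; ring).
    replace (ga * 1 + d * 0)%Z with ga in H by ring.
    replace (ga * - j + d * 1)%Z with de in H by (rewrite /d Hc; ring). exact H. }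
  (* Otherwise 5 would divide the determinant 1. *)
  have Hd0 : (d <> 0)%Z.
  { intros E0. rewrite E0 Hc in Db. have : (5 * (- (b * c)) = 1)%Z by nia. lia. }
  have step_V : forall e : Z, (e = 1 \/ e = -1)%Z -> (Z.abs (c + e * d) < Z.abs c)%Z -> law phi al b ga d.
  { intros e He Hlt.
    have H1 : law phi (al + 5 * e * b) b (ga + 5 * e * d) d.
    { apply (IH (Z.to_nat (Z.abs (c + e * d))) ltac:(lia) _ _ _ _ (c + e * d)%Z); auto.
      - etransitivity; [|exact Db]; ring.
      - rewrite Hc. ring. }
    have H := law_mul (al + 5 * e * b) b (ga + 5 * e * d) d 1 0 (5 * - e) 1 ltac:(etransitivity; [|exact Db]; ring) ltac:(lia) H1 (law_V (- e)).
    replace ((al + 5 * e * b) * 1 + b * (5 * - e))%Z with al in H by ring.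
    replace ((al + 5 * e * b) * 0 + b * 1)%Z with b in H by ring.
    replace ((ga + 5 * e * d) * 1 + d * (5 * - e))%Z with ga in H by ring.
    replace ((ga + 5 * e * d) * 0 + d * 1)%Z with d in H by ring. exact H. }
  have step_g : (Z.abs (2 * c + d) < Z.abs c)%Z -> law phi al b ga d.
  { intros Hlt.
    have H1 : law phi (2 * al + 5 * b) (- al - 2 * b) (2 * ga + 5 * d) (- ga - 2 * d).
    { apply (IH (Z.to_nat (Z.abs (2 * c + d))) ltac:(lia) _ _ _ _ (2 * c + d)%Z); auto.
      - etransitivity; [|exact Db]; ring.
      - rewrite Hc. ring. }
    have H := law_opp ((2 * al + 5 * b) * 2 + (- al - 2 * b) * 5) ((2 * al + 5 * b) * (-1) + (- al - 2 * b) * (-2)) ((2 * ga + 5 * d) * 2 + (- ga - 2 * d) * 5) ((2 * ga + 5 * d) * (-1) + (- ga - 2 * d) * (-2)) ltac:(etransitivity; [|exact Db]; ring) (law_mul (2 * al + 5 * b) (- al - 2 * b) (2 * ga + 5 * d) (- ga - 2 * d) 2 (-1) 5 (-2) ltac:(etransitivity; [|exact Db]; ring) ltac:(lia) H1 phi_g).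
    replace (- ((2 * al + 5 * b) * 2 + (- al - 2 * b) * 5))%Z with al in H by ring.
    replace (- ((2 * al + 5 * b) * -1 + (- al - 2 * b) * -2))%Z with b in H by ring.
    replace (- ((2 * ga + 5 * d) * 2 + (- ga - 2 * d) * 5))%Z with ga in H by ring.
    replace (- ((2 * ga + 5 * d) * -1 + (- ga - 2 * d) * -2))%Z with d in H by ring. exact H. }
  have step_g' : (Z.abs (d - 2 * c) < Z.abs c)%Z -> law phi al b ga d.
  { intros Hlt.
    have H1 : law phi (- 2 * al + 5 * b) (- al + 2 * b) (- 2 * ga + 5 * d) (- ga + 2 * d).
    { apply (IH (Z.to_nat (Z.abs (d - 2 * c))) ltac:(lia) _ _ _ _ (d - 2 * c)%Z); auto.
      - etransitivity; [|exact Db]; ring.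
      - rewrite Hc. ring. }
    have H := law_opp ((- 2 * al + 5 * b) * (-2) + (- al + 2 * b) * 5) ((- 2 * al + 5 * b) * (-1) + (- al + 2 * b) * 2) ((- 2 * ga + 5 * d) * (-2) + (- ga + 2 * d) * 5) ((- 2 * ga + 5 * d) * (-1) + (- ga + 2 * d) * 2) ltac:(etransitivity; [|exact Db]; ring) (law_mul (- 2 * al + 5 * b) (- al + 2 * b) (- 2 * ga + 5 * d) (- ga + 2 * d) (-2) (-1) 5 2 ltac:(etransitivity; [|exact Db]; ring) ltac:(lia) H1 law_g').
    replace (- ((-2 * al + 5 * b) * -2 + (- al + 2 * b) * 5))%Z with al in H by ring.
    replace (- ((-2 * al + 5 * b) * -1 + (- al + 2 * b) * 2))%Z with b in H by ring.
    replace (- ((-2 * ga + 5 * d) * -2 + (- ga + 2 * d) * 5))%Z with ga in H by ring.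
    replace (- ((-2 * ga + 5 * d) * -1 + (- ga + 2 * d) * 2))%Z with d in H by ring. exact H. }
  (* If 0 < |d| < 2 |c|, adding or subtracting d according to the sign of c d lowers |c|. Otherwise
     2 |c| <= |d| <= 5 |c| / 2, and |d| - 2 |c| is at most |c| / 2. *)
  destruct (Z_lt_dec (Z.abs d) (2 * Z.abs c)) as [Hsmall|Hbig].
  + destruct (Z_lt_dec 0 (c * d)) as [Hs|Hs].
    * apply (step_V (-1)%Z); [auto|]. destruct (Z.lt_trichotomy c 0) as [H|[H|H]]; nia.
    * apply (step_V 1%Z); [auto|]. destruct (Z.lt_trichotomy c 0) as [H|[H|H]]; nia.
  + destruct (Z_lt_dec 0 (c * d)) as [Hs|Hs].
    * apply step_g'. destruct (Z.lt_trichotomy c 0) as [H|[H|H]]; nia.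
    * apply step_g. destruct (Z.lt_trichotomy c 0) as [H|[H|H]]; nia.
Qed.
End Generation.

(** * Forms on Gamma_0(5) *)

Definition W_ (z : C) : C := mobius 0 (-1) 5 0 z.
Definition g_ (z : C) : C := mobius 2 (-1) 5 (-2) z.

Lemma W_val (z : C) : (0 < Im z)%R -> W_ z = - / (RtoC 5 * z).
Proof. intros Hz. have Hn := Im_pos_neq_0 z Hz. rewrite /W_ /mobius. field. auto. Qed.

Lemma five_W (z : C) : (0 < Im z)%R -> RtoC 5 * W_ z = - / z.
Proof. intros Hz. have Hn := Im_pos_neq_0 z Hz. rewrite W_val //. field. auto. Qed.

Lemma Im_W (z : C) : (0 < Im z)%R -> (0 < Im (W_ z))%R.
Proof. intros Hz. apply Im_mobius_pos; auto; lia. Qed.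

Lemma Im_g (z : C) : (0 < Im z)%R -> (0 < Im (g_ z))%R.
Proof. intros Hz. apply Im_mobius_pos; auto; lia. Qed.

Lemma Im_5 (z : C) : (0 < Im z)%R -> (0 < Im (RtoC 5 * z))%R.
Proof. intros Hz. destruct z. rewrite /Im /= in Hz *. lra. Qed.

Lemma W_W (z : C) : (0 < Im z)%R -> W_ (W_ z) = z.
Proof.
intros Hz. have Hn := Im_pos_neq_0 z Hz. rewrite W_val; last by apply Im_W.
rewrite five_W //. field. auto.
Qed.

Lemma Im_shift (z : C) (n : Z) : Im (z + RtoC (IZR n)) = Im z.
Proof. destruct z. rewrite /Im /=. ring. Qed.

(* g = S T^-2 S T^2 S, and 5 g(z) = T^2 S T^-2 (5 z) *)
Lemma g_word (z : C) : (0 < Im z)%R ->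
  let u3 := - / z + RtoC 2 in let u1 := - / u3 + RtoC (-2) in
  (0 < Im u3)%R /\ (0 < Im u1)%R /\ g_ z = - / u1 /\ u1 * u3 * z = - (RtoC 5 * z + RtoC (-2)) /\
  u3 * z = RtoC 2 * z - 1.
Proof.
intros Hz u3 u1. have Hn := Im_pos_neq_0 z Hz.
have H3 : (0 < Im u3)%R by rewrite /u3 (Im_shift _ 2); apply Im_minv.
have H1 : (0 < Im u1)%R by rewrite /u1 (Im_shift _ (-2)); apply Im_minv.
have N3 := Im_pos_neq_0 _ H3. have N1 := Im_pos_neq_0 _ H1.
have E3 : u3 * z = RtoC 2 * z - 1 by rewrite /u3; field.
have E1 : u1 * u3 * z = - (RtoC 5 * z + RtoC (-2)).
{ transitivity (- z + RtoC (-2) * (u3 * z)); first by rewrite /u1; field.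
  rewrite E3. ring. }
have Nd : RtoC 5 * z + RtoC (-2) <> 0 by apply linear_neq_0; auto; lia.
repeat split; auto.
transitivity (- (u3 * z) / (u1 * u3 * z)); last by field; auto.
rewrite E3 E1 /g_ /mobius. field. intros E0. apply Nd. rewrite -E0. ring.
Qed.

Lemma five_g (z : C) : (0 < Im z)%R ->
  let w := RtoC 5 * z + RtoC (-2) in
  (0 < Im w)%R /\ RtoC 5 * g_ z = - / w + RtoC 2.
Proof.
intros Hz w. have Hw : (0 < Im w)%R by rewrite /w (Im_shift _ (-2)); apply Im_5.
split; auto. have Nw := Im_pos_neq_0 _ Hw. rewrite /g_ /mobius -/w. 
transitivity ((RtoC 2 * w - 1) / w); last by field.
replace (RtoC 2 * w - 1) with (RtoC 5 * (RtoC 2 * z + RtoC (-1))) by (rewrite /w; ring).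
field. auto.
Qed.

(** The word for g contains T^2 and T^(-2) once each, so the roots of unity e(2/12) and e(-2/12)
    cancel. The three inversions leave (-i)^3, and the product of their arguments is - (5 z - 2). *)
Lemma heta_g (z : C) : (0 < Im z)%R -> heta (g_ z) = - Ci * (RtoC 5 * z + RtoC (-2)) * heta z.
Proof.
intros Hz. destruct (g_word z Hz) as (H3 & H1 & Eg & E1 & E3).
set u3 := - / z + RtoC 2 in H3 H1 Eg E1 E3. set u1 := - / u3 + RtoC (-2) in H1 Eg E1.
rewrite Eg heta_inversion // {2}/u1 heta_shift heta_inversion // {2}/u3 heta_shift heta_inversion //.
transitivity (- Ci * (Ci * Ci) * (u1 * u3 * z) * heta z * (qexp (RtoC (-2) / RtoC 12) * qexp (RtoC 2 / RtoC 12))).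
- ring.
- rewrite -qexp_plus E1. replace (RtoC (-2) / RtoC 12 + RtoC 2 / RtoC 12) with (RtoC 0) by field.
  rewrite qexp_0. have -> : Ci * Ci = - (1) by apply C_eq; rewrite /Re /Im /=; ring. ring.
Qed.

Lemma heta_5g (z : C) : (0 < Im z)%R ->
  heta (RtoC 5 * g_ z) = - Ci * (RtoC 5 * z + RtoC (-2)) * heta (RtoC 5 * z).
Proof.
intros Hz. destruct (five_g z Hz) as [Hw E]. set w := RtoC 5 * z + RtoC (-2) in Hw E *.
rewrite E heta_shift heta_inversion // {2}/w heta_shift.
transitivity (- Ci * w * heta (RtoC 5 * z) * (qexp (RtoC 2 / RtoC 12) * qexp (RtoC (-2) / RtoC 12))); first ring.
rewrite -qexp_plus. replace (RtoC 2 / RtoC 12 + RtoC (-2) / RtoC 12) with (RtoC 0) by field.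
rewrite qexp_0. ring.
Qed.

Lemma heta_W (z : C) : (0 < Im z)%R -> heta (W_ z) = - Ci * (RtoC 5 * z) * heta (RtoC 5 * z).
Proof. intros Hz. rewrite W_val // heta_inversion //. by apply Im_5. Qed.

Lemma heta_5W (z : C) : (0 < Im z)%R -> heta (RtoC 5 * W_ z) = - Ci * z * heta z.
Proof. intros Hz. by rewrite five_W // heta_inversion. Qed.

Lemma heta_neq_0 (z : C) : (0 < Im z)%R -> heta z <> 0.
Proof.
intros Hz E. have := heta_hetai z Hz. rewrite E Cmult_0_l. intros H.
have := f_equal Re H. rewrite /Re /=. lra.
Qed.

Lemma hetai_val (z : C) : (0 < Im z)%R -> hetai z = / heta z.
Proof.
intros Hz. have Hn := heta_neq_0 z Hz. rewrite -(Cmult_1_r (/ heta z)) -(heta_hetai z Hz). field. auto.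
Qed.

(* The expansions of eta(z)^5 / eta(5 z) and eta(5 z)^5 / eta(z). *)
Definition sP : series := smul (spow seta 5) (dilate 5 spart).
Definition sQ : series := smul sX (smul (spow (dilate 5 seta) 5) spart).

Lemma conv_sP : conv sP.
Proof. apply conv_smul; [apply conv_spow, conv_seta | apply conv_dilate; [lia | apply conv_spart]]. Qed.

Lemma conv_sQ : conv sQ.
Proof.
apply conv_smul; [apply conv_sX | apply conv_smul; [apply conv_spow, conv_dilate; [lia | apply conv_seta] | apply conv_spart]].
Qed.

Lemma qval_sP (z : C) : (0 < Im z)%R -> qval sP z = qval seta z ^ 5 * qval spart (RtoC 5 * z).
Proof.
intros Hz. rewrite qval_smul //; [|apply conv_spow, conv_seta | apply conv_dilate; [lia | apply conv_spart]].
rewrite qval_spow //; last apply conv_seta. rewrite qval_dilate //; [|lia|apply conv_spart].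
by rewrite INR_IZR_INZ.
Qed.

Lemma qval_sQ (z : C) : (0 < Im z)%R -> qval sQ z = qexp z * (qval seta (RtoC 5 * z) ^ 5 * qval spart z).
Proof.
intros Hz. have C5 : conv (dilate 5 seta) by apply conv_dilate; [lia | apply conv_seta].
rewrite qval_smul //; [|apply conv_sX | apply conv_smul; [by apply conv_spow | apply conv_spart]].
rewrite qval_sX qval_smul //; [|by apply conv_spow | apply conv_spart].
rewrite qval_spow // qval_dilate //; [|lia|apply conv_seta]. by rewrite INR_IZR_INZ.
Qed.

Lemma qval_sPP (z : C) : (0 < Im z)%R -> qval (smul sP sP) z = heta z ^ 5 / heta (RtoC 5 * z).
Proof.
intros Hz. have H5 := Im_5 z Hz. rewrite /Cdiv -hetai_val // qval_smul ?qval_sP //; try apply conv_sP.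
rewrite /heta /hetai !Cpow_mult_l -qexp_nat.
have -> : RtoC (INR 5) * (z / RtoC 12) = RtoC 5 * z / RtoC 12 by rewrite INR_IZR_INZ /=; field.
transitivity (qexp (RtoC 5 * z / RtoC 12 + - (RtoC 5 * z) / RtoC 12) * (qval seta z ^ 5 * qval spart (RtoC 5 * z) * (qval seta z ^ 5 * qval spart (RtoC 5 * z)))).
- replace (RtoC 5 * z / RtoC 12 + - (RtoC 5 * z) / RtoC 12) with (RtoC 0) by field. rewrite qexp_0. ring.
- rewrite qexp_plus. ring.
Qed.

Lemma qval_sQQ (z : C) : (0 < Im z)%R -> qval (smul sQ sQ) z = heta (RtoC 5 * z) ^ 5 / heta z.
Proof.
intros Hz. have H5 := Im_5 z Hz. rewrite /Cdiv -hetai_val // qval_smul ?qval_sQ //; try apply conv_sQ.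
rewrite /heta /hetai !Cpow_mult_l -qexp_nat.
have -> : qexp (RtoC (INR 5) * (RtoC 5 * z / RtoC 12)) = qexp z * qexp z * qexp (z / RtoC 12).
{ rewrite -!qexp_plus. f_equal. rewrite INR_IZR_INZ /=. field. }
transitivity (qexp (z / RtoC 12 + - z / RtoC 12) * (qexp z * qexp z * (qval seta (RtoC 5 * z) ^ 5 * qval spart z * (qval seta (RtoC 5 * z) ^ 5 * qval spart z)))).
- replace (z / RtoC 12 + - z / RtoC 12) with (RtoC 0) by field. rewrite qexp_0. ring.
- rewrite qexp_plus. ring.
Qed.

Lemma qval_sPQ (z : C) : (0 < Im z)%R -> qval (smul sP sQ) z = heta z ^ 2 * heta (RtoC 5 * z) ^ 2.
Proof.
intros Hz. have H5 := Im_5 z Hz. rewrite qval_smul ?qval_sQ ?qval_sP //; [|apply conv_sP|apply conv_sQ].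
have E1 := qval_seta_spart z Hz. have E5 := qval_seta_spart _ H5.
rewrite /heta !Cpow_mult_l -!qexp_nat.
have -> : qexp z = qexp (RtoC (INR 2) * (z / RtoC 12)) * qexp (RtoC (INR 2) * (RtoC 5 * z / RtoC 12)).
{ rewrite -qexp_plus. f_equal. rewrite INR_IZR_INZ /=. field. }
set X1 := qval seta z in E1 *. set X5 := qval seta (RtoC 5 * z) in E5 *.
set Y1 := qval spart z in E1 *. set Y5 := qval spart (RtoC 5 * z) in E5 *.
set e1 := qexp _. set e2 := qexp _.
transitivity (e1 * e2 * X1 ^ 4 * X5 ^ 4 * (X1 * Y1) * (X5 * Y5)); first ring.
rewrite E1 E5. ring.
Qed.

(* b is the expansion of the Fricke transform of a, scaled by 5^m to be integral. *)
Record is_form (m : nat) (a b : series) : Prop := {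
  form_conv_l : conv a;
  form_conv_r : conv b;
  form_g_l : forall z, (0 < Im z)%R -> qval a (g_ z) = (RtoC 5 * z + RtoC (-2)) ^ (4 * m) * qval a z;
  form_g_r : forall z, (0 < Im z)%R -> qval b (g_ z) = (RtoC 5 * z + RtoC (-2)) ^ (4 * m) * qval b z;
  form_W : forall z, (0 < Im z)%R -> RtoC 5 ^ m * qval a (W_ z) = z ^ (4 * m) * qval b z }.

Lemma five_pow_neq_0 (m : nat) : RtoC 5 ^ m <> 0.
Proof. apply Cpow_nz, RtoC_neq_0. lra. Qed.

Lemma form_W' (m : nat) (a b : series) : is_form m a b ->
  forall z, (0 < Im z)%R -> qval b (W_ z) = RtoC 5 ^ m * (RtoC 5 * z) ^ (4 * m) * qval a z.
Proof.
intros H z Hz. have Hn := Im_pos_neq_0 z Hz. have HW := Im_W z Hz.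
have E := form_W _ _ _ H _ HW. rewrite W_W // in E.
rewrite (Cmult_comm (RtoC 5 ^ m)) -Cmult_assoc E Cmult_assoc -Cpow_mult_l.
have -> : (RtoC 5 * z * W_ z) ^ (4 * m) = 1; last ring.
rewrite W_val //. replace (RtoC 5 * z * - / (RtoC 5 * z)) with (- (1)) by (field; auto).
rewrite Cpow_mult_r. replace ((- (1)) ^ 4) with (RtoC 1) by (simpl; ring). apply Cpow_1_l.
Qed.

Lemma is_form_mul (m m' : nat) (a b a' b' : series) :
  is_form m a b -> is_form m' a' b' -> is_form (m + m') (smul a a') (smul b b').
Proof.
intros H H'. have Ca := form_conv_l _ _ _ H. have Cb := form_conv_r _ _ _ H.
have Ca' := form_conv_l _ _ _ H'. have Cb' := form_conv_r _ _ _ H'.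
split; try by apply conv_smul.
- intros z Hz. have Hg := Im_g z Hz. rewrite !qval_smul // (form_g_l _ _ _ H) // (form_g_l _ _ _ H') //.
  rewrite Nat.mul_add_distr_l Cpow_add_r. ring.
- intros z Hz. have Hg := Im_g z Hz. rewrite !qval_smul // (form_g_r _ _ _ H) // (form_g_r _ _ _ H') //.
  rewrite Nat.mul_add_distr_l Cpow_add_r. ring.
- intros z Hz. have HW := Im_W z Hz. rewrite !qval_smul // Cpow_add_r.
  transitivity ((RtoC 5 ^ m * qval a (W_ z)) * (RtoC 5 ^ m' * qval a' (W_ z))); first ring.
  rewrite (form_W _ _ _ H) // (form_W _ _ _ H') // Nat.mul_add_distr_l Cpow_add_r. ring.
Qed.

Lemma is_form_sub (m : nat) (a b a' b' : series) :
  is_form m a b -> is_form m a' b' -> is_form m (ssub a a') (ssub b b').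
Proof.
intros H H'. have Ca := form_conv_l _ _ _ H. have Cb := form_conv_r _ _ _ H.
have Ca' := form_conv_l _ _ _ H'. have Cb' := form_conv_r _ _ _ H'.
split; try by apply conv_ssub.
- intros z Hz. have Hg := Im_g z Hz. rewrite !qval_ssub // (form_g_l _ _ _ H) // (form_g_l _ _ _ H') //. ring.
- intros z Hz. have Hg := Im_g z Hz. rewrite !qval_ssub // (form_g_r _ _ _ H) // (form_g_r _ _ _ H') //. ring.
- intros z Hz. have HW := Im_W z Hz. rewrite !qval_ssub //.
  transitivity ((RtoC 5 ^ m * qval a (W_ z)) - (RtoC 5 ^ m * qval a' (W_ z))); first ring.
  rewrite (form_W _ _ _ H) // (form_W _ _ _ H') //. ring.
Qed.

Lemma is_form_const (c : Z) : is_form 0 (sC c) (sC c).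
Proof.
split; try apply conv_sC; intros z Hz; rewrite !qval_sC /=; ring.
Qed.

Lemma is_form_scal (m : nat) (c : Z) (a b : series) :
  is_form m a b -> is_form m (smul (sC c) a) (smul (sC c) b).
Proof. exact (is_form_mul 0 m _ _ _ _ (is_form_const c)). Qed.

Lemma Ci_pow4 : Ci ^ 4 = 1.
Proof. apply C_eq; rewrite /Re /Im /=; ring. Qed.

Lemma qval_sC_mul (c : Z) (a : series) (z : C) : conv a -> (0 < Im z)%R ->
  qval (smul (sC c) a) z = RtoC (IZR c) * qval a z.
Proof. intros Ha Hz. rewrite qval_smul // ?qval_sC //. apply conv_sC. Qed.

Lemma g_factor_neq_0 (z : C) : (0 < Im z)%R -> RtoC 5 * z + RtoC (-2) <> 0.
Proof. intros Hz. apply linear_neq_0; auto; lia. Qed.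

(** In weight 4 the factor - i from the laws of eta^2 disappears. *)
Lemma mCi_mul (x : C) : x <> 0 -> - Ci * x <> 0 /\ (- Ci * x) ^ 4 = x ^ 4.
Proof.
intros Hx. split.
- apply Cmult_neq_0; auto. intros E. have := f_equal Im E. rewrite /Im /=. intros. lra.
- have H4 : forall u : C, (- u) ^ 4 = u ^ 4 by intros; ring.
  rewrite Cpow_mult_l H4 Ci_pow4. ring.
Qed.

Section GeneratorLaws.
Variable z : C.
Hypothesis Hz : (0 < Im z)%R.

Lemma PP_g : qval (smul sP sP) (g_ z) = (RtoC 5 * z + RtoC (-2)) ^ 4 * qval (smul sP sP) z.
Proof.
have Hg := Im_g z Hz. destruct (mCi_mul _ (g_factor_neq_0 z Hz)) as [Hc <-].
have N1 := heta_neq_0 z Hz. have N5 := heta_neq_0 _ (Im_5 z Hz).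
rewrite !qval_sPP // heta_g // heta_5g //. set c := - Ci * _ in Hc *. field. auto.
Qed.

Lemma QQ_g : qval (smul sQ sQ) (g_ z) = (RtoC 5 * z + RtoC (-2)) ^ 4 * qval (smul sQ sQ) z.
Proof.
have Hg := Im_g z Hz. destruct (mCi_mul _ (g_factor_neq_0 z Hz)) as [Hc <-].
have N1 := heta_neq_0 z Hz. have N5 := heta_neq_0 _ (Im_5 z Hz).
rewrite !qval_sQQ // heta_g // heta_5g //. set c := - Ci * _ in Hc *. field. auto.
Qed.

Lemma PQ_g : qval (smul sP sQ) (g_ z) = (RtoC 5 * z + RtoC (-2)) ^ 4 * qval (smul sP sQ) z.
Proof.
have Hg := Im_g z Hz. destruct (mCi_mul _ (g_factor_neq_0 z Hz)) as [Hc <-].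
rewrite !qval_sPQ // heta_g // heta_5g //. ring.
Qed.

(** The fifth power of [heta_W] contributes 5^5, and the scaling factor on the left makes it 5^6 =
    15625. *)
Lemma PP_W : RtoC 5 * qval (smul sP sP) (W_ z) = RtoC 15625 * z ^ 4 * qval (smul sQ sQ) z.
Proof.
have HW := Im_W z Hz. destruct (mCi_mul z (Im_pos_neq_0 z Hz)) as [Hc <-].
have N1 := heta_neq_0 z Hz. have N5 := heta_neq_0 _ (Im_5 z Hz).
rewrite qval_sPP // qval_sQQ // heta_W // heta_5W //.
replace (- Ci * (RtoC 5 * z)) with (RtoC 5 * (- Ci * z)) by ring.
set c := - Ci * z in Hc *. field. auto.
Qed.

(** Here the quotient of the laws of eta^2 contributes 1/5; the scaling by 5^m in [form_W] clears
    this denominator. *)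
Lemma QQ_W : RtoC 5 * qval (smul sQ sQ) (W_ z) = z ^ 4 * qval (smul sP sP) z.
Proof.
have HW := Im_W z Hz. destruct (mCi_mul z (Im_pos_neq_0 z Hz)) as [Hc <-].
have N1 := heta_neq_0 z Hz. have N5 := heta_neq_0 _ (Im_5 z Hz).
rewrite qval_sPP // qval_sQQ // heta_W // heta_5W //.
replace (- Ci * (RtoC 5 * z)) with (RtoC 5 * (- Ci * z)) by ring.
set c := - Ci * z in Hc *. field. auto.
Qed.

Lemma PQ_W : RtoC 5 * qval (smul sP sQ) (W_ z) = RtoC 125 * z ^ 4 * qval (smul sP sQ) z.
Proof.
have HW := Im_W z Hz. destruct (mCi_mul z (Im_pos_neq_0 z Hz)) as [Hc <-].
rewrite !qval_sPQ // heta_W // heta_5W //. ring.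
Qed.
End GeneratorLaws.

Lemma Cpow_1 (x : C) : x ^ 1 = x.
Proof. simpl. ring. Qed.

Lemma is_form_PP : is_form 1 (smul sP sP) (smul (sC 15625) (smul sQ sQ)).
Proof.
have CP := conv_smul _ _ conv_sP conv_sP. have CQ := conv_smul _ _ conv_sQ conv_sQ.
split; auto; try (apply conv_smul; [apply conv_sC | auto]); intros z Hz; rewrite ?Nat.mul_1_r.
- by apply PP_g.
- have Hg := Im_g z Hz. rewrite !qval_sC_mul // QQ_g //. ring.
- rewrite qval_sC_mul // Cpow_1 PP_W //. ring.
Qed.

Lemma is_form_QQ : is_form 1 (smul sQ sQ) (smul sP sP).
Proof.
have CP := conv_smul _ _ conv_sP conv_sP. have CQ := conv_smul _ _ conv_sQ conv_sQ.
split; auto; intros z Hz; rewrite ?Nat.mul_1_r.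
- by apply QQ_g.
- by apply PP_g.
- rewrite Cpow_1 QQ_W //.
Qed.

Lemma is_form_PQ : is_form 1 (smul sP sQ) (smul (sC 125) (smul sP sQ)).
Proof.
have CPQ := conv_smul _ _ conv_sP conv_sQ.
split; auto; try (apply conv_smul; [apply conv_sC | auto]); intros z Hz; rewrite ?Nat.mul_1_r.
- by apply PQ_g.
- have Hg := Im_g z Hz. rewrite !qval_sC_mul // PQ_g //. ring.
- rewrite qval_sC_mul // Cpow_1 PQ_W //. ring.
Qed.

Definition mono (a b : nat) : series := smul (spow sP a) (spow sQ b).

Lemma mono_step (a b a' b' : nat) : mono (a + a') (b + b') = smul (mono a b) (mono a' b').
Proof. rewrite /mono !spow_add. ring. Qed.

(** The total degree is even, so a factor P^2 or Q^2 can be split off while an exponent is at least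
    2. What is left over is the case of exponents 1 and 1, that is, PQ. *)
Lemma is_form_mono (m a b : nat) : (a + b = 2 * m)%nat -> exists c, is_form m (mono a b) c.
Proof.
elim: m a b => [|m IH] a b H.
- exists s1. have -> : a = 0%nat by lia. have -> : b = 0%nat by lia.
  have -> : mono 0 0 = s1 by rewrite /mono /=; ring. exact (is_form_const 1).
- destruct (Nat.le_gt_cases 2 a) as [Ha|Ha]; [|destruct (Nat.le_gt_cases 2 b) as [Hb|Hb]].
  + destruct (IH (a - 2)%nat b ltac:(lia)) as [c Hc].
    have -> : mono a b = smul (smul sP sP) (mono (a - 2) b).
    { have {1}-> : a = (2 + (a - 2))%nat by lia. have {1}-> : b = (0 + b)%nat by lia.
      rewrite mono_step /mono /=. ring. }
    exists (smul (smul (sC 15625) (smul sQ sQ)) c). exact (is_form_mul 1 m _ _ _ _ is_form_PP Hc).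
  + destruct (IH a (b - 2)%nat ltac:(lia)) as [c Hc].
    have -> : mono a b = smul (smul sQ sQ) (mono a (b - 2)).
    { have {1}-> : b = (2 + (b - 2))%nat by lia. have {1}-> : a = (0 + a)%nat by lia.
      rewrite mono_step /mono /=. ring. }
    exists (smul (smul sP sP) c). exact (is_form_mul 1 m _ _ _ _ is_form_QQ Hc).
  + destruct (IH (a - 1)%nat (b - 1)%nat ltac:(lia)) as [c Hc].
    have -> : mono a b = smul (smul sP sQ) (mono (a - 1) (b - 1)).
    { have {1}-> : a = (1 + (a - 1))%nat by lia. have {1}-> : b = (1 + (b - 1))%nat by lia.
      rewrite mono_step /mono /=. ring. }
    exists (smul (smul (sC 125) (smul sP sQ)) c). exact (is_form_mul 1 m _ _ _ _ is_form_PQ Hc).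
Qed.

(* The expansion of (5 E_2(5 z) - E_2(z)) / 4. *)
Definition sE5 : series := sadd s1 (ssub (smul (sC 6) ssig) (smul (sC 30) (dilate 5 ssig))).

Lemma conv_sE5 : conv sE5.
Proof.
have H5 : conv (dilate 5 ssig) by apply conv_dilate; [lia | apply conv_ssig].
apply conv_sadd; first apply conv_s1.
apply conv_ssub; (apply conv_smul; [apply conv_sC | auto; apply conv_ssig]).
Qed.

Lemma qval_sE5 (z : C) : (0 < Im z)%R ->
  qval sE5 z = (RtoC 5 * qval sE2 (RtoC 5 * z) - qval sE2 z) / RtoC 4.
Proof.
intros Hz. have C5 : conv (dilate 5 ssig) by apply conv_dilate; [lia | apply conv_ssig].
rewrite qval_sadd //; [|apply conv_s1|apply conv_ssub; (apply conv_smul; [apply conv_sC | auto; apply conv_ssig])].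
rewrite qval_ssub //; try (apply conv_smul; [apply conv_sC | auto; apply conv_ssig]).
rewrite !qval_sC_mul //; last apply conv_ssig. rewrite qval_dilate //; [|lia|apply conv_ssig].
rewrite qval_s1 !qval_sE2 //; last by apply Im_5. rewrite INR_IZR_INZ /=. field.
Qed.

Lemma E2_shift (z : C) (n : Z) : qval sE2 (z + RtoC (IZR n)) = qval sE2 z.
Proof. apply qval_shift. Qed.

(** With w = 5 z - 2, five times the correction 12 w / (2 pi i) of E_2(5z) cancels the correction 60
    w / (2 pi i) of E_2(z). *)
Lemma E5_g (z : C) : (0 < Im z)%R ->
  qval sE5 (g_ z) = (RtoC 5 * z + RtoC (-2)) ^ 2 * qval sE5 z.
Proof.
intros Hz. have Hg := Im_g z Hz. have Hn := Im_pos_neq_0 z Hz. have Ht := twopii_neq_0.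
destruct (g_word z Hz) as (H3 & H1 & Eg & E1 & E3).
set u3 := - / z + RtoC 2 in H3 H1 Eg E1 E3. set u1 := - / u3 + RtoC (-2) in H1 Eg E1.
have N3 := Im_pos_neq_0 _ H3.
destruct (five_g z Hz) as [Hw E5]. set w := RtoC 5 * z + RtoC (-2) in Hw E5 E1 *.
rewrite !qval_sE5 //.
have X1 : qval sE2 (RtoC 5 * g_ z) = w ^ 2 * qval sE2 (RtoC 5 * z) + RtoC 12 * w / twopii.
{ rewrite E5 E2_shift E2_inversion // {2}/w E2_shift //. }
have X2 : qval sE2 (g_ z) = w ^ 2 * qval sE2 z + RtoC 60 * w / twopii.
{ have Y3 : qval sE2 u3 = z ^ 2 * qval sE2 z + RtoC 12 * z / twopii by rewrite /u3 E2_shift E2_inversion.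
  have Y1 : qval sE2 u1 = u3 ^ 2 * qval sE2 u3 + RtoC 12 * u3 / twopii by rewrite /u1 E2_shift E2_inversion.
  rewrite Eg E2_inversion // Y1 Y3.
  transitivity ((u1 * u3 * z) ^ 2 * qval sE2 z + RtoC 12 / twopii * (u1 ^ 2 * u3 ^ 2 * z + u1 ^ 2 * u3 + u1)); first by field.
  rewrite E1. have Eu1 : u1 = - w / (u3 * z).
  { transitivity (u1 * u3 * z / (u3 * z)); [field; auto | by rewrite E1]. }
  have Ex : u1 ^ 2 * u3 ^ 2 * z + u1 ^ 2 * u3 + u1 = RtoC 5 * w.
  { have Nd : RtoC 2 * z - 1 <> 0 by rewrite -E3; apply Cmult_neq_0.
    have Eu3 : u3 = (RtoC 2 * z - 1) / z by rewrite -E3; field.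
    rewrite Eu1 E3 Eu3 /w. field. auto. }
  rewrite Ex. field. auto. }
rewrite X1 X2. field. auto.
Qed.

Lemma E5_W (z : C) : (0 < Im z)%R -> qval sE5 (W_ z) = - RtoC 5 * z ^ 2 * qval sE5 z.
Proof.
intros Hz. have HW := Im_W z Hz. have Hn := Im_pos_neq_0 z Hz. have Ht := twopii_neq_0.
rewrite !qval_sE5 // five_W // W_val // !E2_inversion //; last by apply Im_5. field. auto.
Qed.

(** The square removes the sign in [E5_W] and brings the weight to 4. The constant is 5 * (-5)^2. *)
Lemma is_form_E5 : is_form 1 (smul sE5 sE5) (smul (sC 125) (smul sE5 sE5)).
Proof.
have CE := conv_sE5. have CEE := conv_smul _ _ CE CE.
split; auto; try (apply conv_smul; [apply conv_sC | auto]); intros z Hz; rewrite ?Nat.mul_1_r.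
- have Hg := Im_g z Hz. rewrite !qval_smul // E5_g //. ring.
- have Hg := Im_g z Hz. rewrite !qval_sC_mul // !qval_smul // E5_g //. ring.
- have HW := Im_W z Hz. rewrite qval_sC_mul // !qval_smul // E5_W //. ring.
Qed.

Lemma Cpow_even_opp (m : nat) (x : C) : (- x) ^ (4 * m) = x ^ (4 * m).
Proof. rewrite !Cpow_mult_r. f_equal. ring. Qed.

(** The laws under g and W, with periodicity, give the law of all of Gamma_0(5) by [gamma05_law].
    The automorphy factor of W is 5 z instead of z, so the constant 5^(-m) of [form_W] becomes
    5^(-5m). *)
Lemma form_weight (m : nat) (a b : series) : is_form m a b -> weight (4 * m) (qval a) /\ weight (4 * m) (qval b).
Proof.
intros H.
have HW : forall z, (0 < Im z)%R -> qval a (mobius 0 (-1) 5 0 z) = / RtoC 5 ^ (5 * m) * autfac 5 0 (4 * m) z * qval b z.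
{ intros z Hz. have E := form_W _ _ _ H z Hz. have N := five_pow_neq_0 m. have N5 := five_pow_neq_0 (5 * m).
  have -> : qval a (mobius 0 (-1) 5 0 z) = / RtoC 5 ^ m * (RtoC 5 ^ m * qval a (W_ z)) by rewrite /W_; field.
  rewrite E /autfac. replace (RtoC 5 * z + RtoC 0) with (RtoC 5 * z) by ring.
  rewrite Cpow_mult_l. replace (5 * m)%nat with (4 * m + m)%nat by lia. rewrite Cpow_add_r. field.
  split; auto. apply five_pow_neq_0. }
have HW' : forall z, (0 < Im z)%R -> qval b (mobius 0 (-1) 5 0 z) = RtoC 5 ^ m * autfac 5 0 (4 * m) z * qval a z.
{ intros z Hz. have E := form_W' _ _ _ H z Hz. rewrite /W_ in E. rewrite E /autfac.
  by replace (RtoC 5 * z + RtoC 0) with (RtoC 5 * z) by ring. }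
have Hkk : / RtoC 5 ^ (5 * m) * RtoC 5 ^ m * RtoC 5 ^ (4 * m) = 1.
{ replace (5 * m)%nat with (m + 4 * m)%nat by lia. rewrite Cpow_add_r. field. split; apply five_pow_neq_0. }
have Hkk' : RtoC 5 ^ m * / RtoC 5 ^ (5 * m) * RtoC 5 ^ (4 * m) = 1 by rewrite -Hkk; ring.
split; intros al be ga de D H5 z Hz.
- apply (gamma05_law (4 * m) (Cpow_even_opp m) (qval a) (qval b) (/ RtoC 5 ^ (5 * m)) (RtoC 5 ^ m)); auto.
  + intros n w. apply qval_shift.
  + intros n w. apply qval_shift.
  + intros w Hw. by rewrite /autfac (form_g_l _ _ _ H).
  + intros w Hw. by rewrite /autfac (form_g_r _ _ _ H).
- apply (gamma05_law (4 * m) (Cpow_even_opp m) (qval b) (qval a) (RtoC 5 ^ m) (/ RtoC 5 ^ (5 * m))); auto.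
  + intros n w. apply qval_shift.
  + intros n w. apply qval_shift.
  + intros w Hw. by rewrite /autfac (form_g_r _ _ _ H).
  + intros w Hw. by rewrite /autfac (form_g_l _ _ _ H).
Qed.

Theorem is_form_hecke (p m : nat) (a b : series) : prime (Z.of_nat p) -> p <> 5%nat ->
  is_form m a b -> is_form m (hecke_series p (4 * m) a) (hecke_series p (4 * m) b).
Proof.
intros Hp Hp5 H. destruct (form_weight m a b H) as [Wa Wb].
have Ca := form_conv_l _ _ _ H. have Cb := form_conv_r _ _ _ H.
have WTa := hecke_weight p Hp Hp5 (4 * m) _ Wa. have WTb := hecke_weight p Hp Hp5 (4 * m) _ Wb.
split; try by apply conv_hecke_series.
- intros z Hz. have Hg := Im_g z Hz. rewrite -!hecke_qval // (WTa 2%Z (-1)%Z 5%Z (-2)%Z) //. by exists 1%Z.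
- intros z Hz. have Hg := Im_g z Hz. rewrite -!hecke_qval // (WTb 2%Z (-1)%Z 5%Z (-2)%Z) //. by exists 1%Z.
- intros z Hz. have HW := Im_W z Hz. rewrite -!hecke_qval //.
  have N5 := five_pow_neq_0 m. have N20 := five_pow_neq_0 (4 * m).
  rewrite (hecke_fricke p Hp Hp5 (4 * m) (qval a) (qval b) (/ (RtoC 5 ^ m * RtoC 5 ^ (4 * m)))) //.
  + rewrite /autfac. replace (RtoC 5 * z + RtoC 0) with (RtoC 5 * z) by ring. rewrite Cpow_mult_l. field. auto.
  + intros u Hu. have E := form_W _ _ _ H u Hu. rewrite /W_ in E.
    transitivity (/ RtoC 5 ^ m * (RtoC 5 ^ m * qval a (mobius 0 (-1) 5 0 u))); first by field.
    rewrite E /autfac. replace (RtoC 5 * u + RtoC 0) with (RtoC 5 * u) by ring. rewrite Cpow_mult_l. field. auto.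
Qed.

(** * A Sturm bound *)

(** Low enough that W, g or g' raises every point of the strip |Re z| <= 1/2 below it, and high
    enough that exp(-2 pi (low - 1/100)) < 1/2. The first demand is critical at Re z = 1/2, where |5
    z - 2|^2 = 1/4 + 25 (Im z)^2 must be less than 1: [low] lies just below sqrt 3 / 10. *)
Definition low : R := (17 / 100)%R.

(** With modulus M + n + 1, the only exponent below M congruent to n is n itself. *)
Lemma clim_residue (a : series) (n : nat) (z : C) : conv a -> (0 < Im z)%R ->
  clim (fun M => qval (residue (M + n + 1) n a) z) (qpow a z n).
Proof.
intros Ha Hz.
set v : series := fun l => if Nat.eqb l n then a n else 0%Z.
have Ev : qval v z = qpow a z n.
{ rewrite (qval_finite v (S n)).
  - rewrite csum_S (csum_ext _ (fun _ => 0)).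
    + rewrite csum_const /qpow /v Nat.eqb_refl. ring.
    + intros k Hk. rewrite /qpow /v. destruct (Nat.eqb_spec k n); [lia | ring].
  - intros k Hk. rewrite /v. destruct (Nat.eqb_spec k n); [lia | reflexivity]. }
rewrite -Ev. apply (clim_qval _ _ (fun l => Z.abs (a l))); auto.
- intros M l Hl. rewrite /residue /v.
  destruct (Nat.eqb_spec l n) as [->|Hne]; first by rewrite Z.sub_diag.
  destruct (Z.eqb_spec ((Z.of_nat l - Z.of_nat n) mod Z.of_nat (M + n + 1)) 0) as [E|E]; last by [].
  exfalso. apply Z.mod_divide in E; last lia. destruct E as [e He].
  destruct (Z.lt_trichotomy e 0) as [H|[H|H]]; nia.
- intros M l. rewrite /residue. destruct (Z.eqb _ _); lia.
- intros l. rewrite /v. destruct (Nat.eqb_spec l n); [subst; lia | lia].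
- apply (conv_scal 1 a); auto. intros k. lia.
Qed.

(* Cauchy's estimate, through averages over z + k/N. *)
Lemma cauchy_estimate (a : series) (K : R) : conv a ->
  (forall z, (0 < Im z)%R -> (Cmod (qval a z) <= K)%R) ->
  forall n z, (0 < Im z)%R -> (Cmod (qpow a z n) <= K)%R.
Proof.
intros Ha HK n z Hz. apply (clim_Cmod_le _ _ _ 0 (clim_residue a n z Ha Hz)) => M _.
set N := (M + n + 1)%nat. have HN : (0 < N)%nat by rewrite /N; lia.
have HNR := lt_0_INR _ HN.
have E := qval_residue N n a z HN Ha Hz.
apply (Rmult_le_reg_l (INR N)); auto.
rewrite -{1}(Rabs_pos_eq (INR N)); last lra. rewrite -Cmod_R -Cmod_mult -E.
apply Cmod_csum_const => k Hk.
rewrite Cmod_mult Cmod_qexp.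
have -> : Im (RtoC (- INR n / INR N) * INR k) = 0%R by rewrite /Im /=; ring.
rewrite Rmult_0_r exp_0 Rmult_1_l. apply HK. rewrite /= Rplus_0_r. exact Hz.
Qed.

Section CuspFunctions.
Variables a b : series.
Hypotheses (Ha : conv a) (Hb : conv b) (Ha0 : a 0%nat = 0%Z) (Hb0 : b 0%nat = 0%Z).
Hypothesis HW : forall z, (0 < Im z)%R -> qval a (W_ z) = qval b z.
Hypothesis Hga : forall z, (0 < Im z)%R -> qval a (g_ z) = qval a z.
Hypothesis Hgb : forall z, (0 < Im z)%R -> qval b (g_ z) = qval b z.

Lemma cusp_W' (z : C) : (0 < Im z)%R -> qval b (W_ z) = qval a z.
Proof. intros Hz. rewrite -HW; last by apply Im_W. by rewrite W_W. Qed.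

(** This is [law_g'] in weight 0 with both constants equal to 1, applied to the pair in either
    order. *)
Lemma cusp_g' (z : C) : (0 < Im z)%R ->
  qval a (mobius (-2) (-1) 5 2 z) = qval a z /\ qval b (mobius (-2) (-1) 5 2 z) = qval b z.
Proof.
intros Hz.
have G : forall f h : C -> C, (forall n z, f (z + RtoC (IZR n)) = f z) -> (forall n z, h (z + RtoC (IZR n)) = h z) ->
  (forall z, (0 < Im z)%R -> f (g_ z) = f z) -> (forall z, (0 < Im z)%R -> h (g_ z) = h z) ->
  (forall z, (0 < Im z)%R -> f (W_ z) = h z) -> (forall z, (0 < Im z)%R -> h (W_ z) = f z) ->
  f (mobius (-2) (-1) 5 2 z) = f z.
{ intros f h H1 H2 H3 H4 H5 H6.
  have H := law_g' 0 (fun x => eq_refl) f h 1 1.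
  rewrite H; auto.
  - rewrite /autfac /=. ring.
  - intros w Hw. rewrite /autfac /= Cmult_1_l. by apply H4.
  - intros w Hw. rewrite /autfac /= !Cmult_1_l. by apply H5.
  - intros w Hw. rewrite /autfac /= !Cmult_1_l. by apply H6.
  - ring. }
split.
- apply (G _ (qval b)); auto; try apply cusp_W'; intros n w; apply qval_shift.
- apply (G _ (qval a)); auto; try apply cusp_W'; intros n w; apply qval_shift.
Qed.

Definition size (c : series) : R := Series (fun n => Rabs (IZR (c n)) * exp (- 2 * PI * low) ^ n)%R.
Definition bnd : R := Rmax (size a) (size b).

Lemma cusp_bound_high (z : C) : (low <= Im z)%R -> (Cmod (qval a z) <= bnd /\ Cmod (qval b z) <= bnd)%R.
Proof.
intros Hz. have Hl : (0 < low)%R by rewrite /low; lra.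
split.
- apply (Rle_trans _ (size a)); last apply Rmax_l. by apply qval_le.
- apply (Rle_trans _ (size b)); last apply Rmax_r. by apply qval_le.
Qed.

Lemma Im_grows (al be ga de : Z) (z : C) : (0 < Im z)%R -> (0 < al * de - be * ga)%Z ->
  (103 / 100 * Cmod (RtoC (IZR ga) * z + RtoC (IZR de)) ^ 2 <= 101 / 100 * IZR (al * de - be * ga))%R ->
  (101 / 100 * Im z <= Im (mobius al be ga de z))%R.
Proof.
intros Hz HD H.
have Hn : RtoC (IZR ga) * z + RtoC (IZR de) <> 0 by apply linear_neq_0; auto; nia.
rewrite Im_mobius //. have Hc : (0 < Cmod (RtoC (IZR ga) * z + RtoC (IZR de)) ^ 2)%R by apply pow_lt, Cmod_gt_0.
set c := (Cmod _ ^ 2)%R in H Hc *.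
apply (Rmult_le_reg_r c); auto. replace (IZR (al * de - be * ga) * Im z / c * c)%R with (IZR (al * de - be * ga) * Im z)%R by (field; lra).
apply (Rle_trans _ (101 / 100 * c * Im z)); first by right; ring. apply Rmult_le_compat_r; lra.
Qed.

Lemma Cmod2_linear (ga de : Z) (z : C) :
  (Cmod (RtoC (IZR ga) * z + RtoC (IZR de)) ^ 2 = (IZR ga * Re z + IZR de) ^ 2 + (IZR ga * Im z) ^ 2)%R.
Proof. rewrite Cmod2_alt. destruct z as [x y]. rewrite /Re /Im /=. ring. Qed.

(** Below [low], (5 Im z)^2 is at most 25 * 29/1000 = 29/40, which leaves a condition on the real
    part alone. *)
Lemma raise_ineq (de D : Z) (z : C) : (0 < Im z < low)%R ->
  ((5 * Re z + IZR de) ^ 2 <= 101 / 103 * IZR D - 29 / 40)%R ->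
  (103 / 100 * Cmod (RtoC 5 * z + RtoC (IZR de)) ^ 2 <= 101 / 100 * IZR D)%R.
Proof.
intros Hz H. rewrite (Cmod2_linear 5). have : (Im z * Im z <= 29 / 1000)%R by rewrite /low in Hz; nra.
have -> : ((5 * Im z) ^ 2 = 25 * (Im z * Im z))%R by ring. lra.
Qed.

(* Below height 17/100, one of W, g, g' raises a point of the strip |Re z| <= 1/2 by the factor 101/100. *)
Lemma cusp_bound_reach (n : nat) (z : C) : (0 < Im z)%R -> (low <= (101 / 100) ^ n * Im z)%R ->
  (Cmod (qval a z) <= bnd /\ Cmod (qval b z) <= bnd)%R.
Proof.
elim: n z => [|n IH] z Hz Hn; first by apply cusp_bound_high; rewrite /= Rmult_1_l in Hn.
destruct (Rle_lt_dec low (Im z)) as [Hl|Hl]; first by apply cusp_bound_high.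
set k := up (Re z - / 2). destruct (archimed (Re z - / 2)) as [K1 K2]. rewrite -/k in K1 K2.
set u := z + RtoC (IZR (- k)).
have Iu : Im u = Im z by apply Im_shift.
have Ru : Re u = (Re z - IZR k)%R by rewrite /u opp_IZR; destruct z; rewrite /Re /=; ring.
have Ea : qval a z = qval a u by rewrite /u qval_shift.
have Eb : qval b z = qval b u by rewrite /u qval_shift.
rewrite Ea Eb.
have Hu : (0 < Im u)%R by lra. have Hu2 : (Im u < low)%R by lra.
have Hx : (- / 2 <= Re u <= / 2)%R by lra.
have Hstep : forall v, (101 / 100 * Im u <= Im v)%R -> (Cmod (qval a v) <= bnd /\ Cmod (qval b v) <= bnd)%R.
{ intros v Hv. apply IH; first lra. apply: Rle_trans; first exact Hn. rewrite -tech_pow_Rmult -Iu.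
  have Hpn : (0 <= (101 / 100) ^ n)%R by apply pow_le; lra.
  rewrite (Rmult_comm (101 / 100)) Rmult_assoc. by apply Rmult_le_compat_l. }
rewrite /low in Hu2.
(* With x = Re u, W has determinant 5 and needs 25 x^2 <= 505/103 - 29/40, true for |x| <= 4/10. The
   matrices g and g' need (5 |x| - 2)^2 <= 101/103 - 29/40, true for |x| between 4/10 and 1/2, where
   the left side is at most 1/4. *)
destruct (Rle_lt_dec (Rabs (Re u)) (4 / 10)) as [H4|H4].
- have Hr : (- (4 / 10) <= Re u <= 4 / 10)%R by move: H4; rewrite /Rabs; destruct (Rcase_abs (Re u)); lra.
  have H := Hstep (W_ u). rewrite HW // cusp_W' // in H. destruct H as [H1 H2]; last by split.
  apply Im_grows; auto; first lia. apply (raise_ineq 0 5); nra.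
- destruct (Rle_lt_dec 0 (Re u)) as [Hp|Hp].
  + rewrite Rabs_pos_eq // in H4. have H := Hstep (g_ u). rewrite Hga // Hgb // in H. apply H.
    apply Im_grows; auto; first lia. apply (raise_ineq (-2) 1); nra.
  + rewrite Rabs_left // in H4. destruct (cusp_g' u Hu) as [E1 E2].
    have H := Hstep (mobius (-2) (-1) 5 2 u). rewrite E1 E2 in H. apply H.
    apply Im_grows; auto; first lia. apply (raise_ineq 2 1); nra.
Qed.

Lemma cusp_bound (z : C) : (0 < Im z)%R -> (Cmod (qval a z) <= bnd /\ Cmod (qval b z) <= bnd)%R.
Proof.
intros Hz. destruct (Pow_x_infinity (101 / 100) ltac:(rewrite Rabs_pos_eq; lra) (low / Im z)) as [N HN].
apply (cusp_bound_reach N); auto. have H := HN N (Nat.le_refl N).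
rewrite Rabs_pos_eq in H; last by apply pow_le; lra.
apply (Rmult_le_reg_r (/ Im z)); first by apply Rinv_0_lt_compat.
rewrite Rmult_assoc Rinv_r; last lra. rewrite Rmult_1_r. apply Rge_le. exact H.
Qed.

(** As pi > 3, the exponent 2 pi * 16/100 exceeds 96/100, and exp(48/100)^2 >= (148/100)^2 > 2. *)
Lemma half_bound : (exp (- 2 * PI * (low - / 100)) < / 2)%R.
Proof.
have Hp := PI2_3_2. rewrite /low.
have H1 : (148 / 100 <= exp (48 / 100))%R by have := exp_ineq1_le (48 / 100); lra.
have H2 : (2 < exp (96 / 100))%R.
{ replace (96 / 100)%R with (48 / 100 + 48 / 100)%R by lra. rewrite exp_plus. nra. }
have H3 : (exp (96 / 100) < exp (2 * PI * (17 / 100 - / 100)))%R by apply exp_increasing; lra.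
replace (-2 * PI * (17 / 100 - / 100))%R with (- (2 * PI * (17 / 100 - / 100)))%R by ring.
rewrite exp_Ropp. apply Rinv_lt_contravar; nra.
Qed.

(** Cauchy's estimate at height 1/100 bounds |c_n| exp(-2 pi low)^n by [bnd] rho^n, where rho =
    exp(-2 pi (low - 1/100)). As the term n = 0 is absent, the sum is at most [bnd] rho / (1 -
    rho). *)
Lemma size_contract (c : series) : conv c -> c 0%nat = 0%Z -> (0 <= bnd)%R ->
  (forall z, (0 < Im z)%R -> (Cmod (qval c z) <= bnd)%R) ->
  (size c <= bnd * (exp (- 2 * PI * (low - / 100)) / (1 - exp (- 2 * PI * (low - / 100)))))%R.
Proof.
intros Hc Hc0 Hb1 Hbd. have Hh := half_bound. set rho := exp (- 2 * PI * (low - / 100)) in Hh *.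
have Hr : (0 < rho)%R by apply exp_pos.
have Hcoef : forall n, (Rabs (IZR (c n)) * exp (- 2 * PI * low) ^ n <= bnd * rho ^ n)%R.
{ intros n. have H1 : (0 < Im (0, / 100)%R)%R by rewrite /Im /=; lra.
  have H := cauchy_estimate c bnd Hc Hbd n _ H1. rewrite Cmod_qpow in H.
  change (Im (0%R, / 100)%R) with (/ 100)%R in H.
  have -> : (exp (- 2 * PI * low) = exp (- 2 * PI * / 100) * rho)%R.
  { rewrite /rho -exp_plus. f_equal. ring. }
  rewrite Rpow_mult_distr -Rmult_assoc. apply Rmult_le_compat_r; auto. by apply pow_le; left. }
rewrite /size Series_incr_1_aux; last by rewrite Hc0 Rabs_R0; ring.
replace (bnd * (rho / (1 - rho)))%R with (Series (fun n => bnd * rho * rho ^ n))%R.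
- apply Series_le.
  + intros n. split.
    * apply Rmult_le_pos; [apply Rabs_pos | apply pow_le; left; apply exp_pos].
    * apply: Rle_trans; first apply Hcoef. right. simpl. ring.
  + apply: ex_series_scal_l. apply ex_series_geom. rewrite Rabs_pos_eq; lra.
- rewrite Series_scal_l Series_geom; last by rewrite Rabs_pos_eq; lra. field. lra.
Qed.

(** Both sizes are at most t times their maximum [bnd], with t = rho / (1 - rho) < 1 because rho <
    1/2. Hence [bnd] = 0, and Cauchy's estimate annihilates every coefficient. *)
Theorem cusp_function_zero (n : nat) : a n = 0%Z.
Proof.
have Hi : (0 < Im Ci)%R by rewrite /Im /=; lra.
have B0 : (0 <= bnd)%R.
{ destruct (cusp_bound Ci Hi) as [H _]. have := Cmod_ge_0 (qval a Ci). lra. }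
have Sa := size_contract a Ha Ha0 B0 (fun z Hz => proj1 (cusp_bound z Hz)).
have Sb := size_contract b Hb Hb0 B0 (fun z Hz => proj2 (cusp_bound z Hz)).
have Hh := half_bound. set rho := exp (- 2 * PI * (low - / 100)) in Hh Sa Sb.
have Hr : (0 < rho)%R by apply exp_pos.
set t := (rho / (1 - rho))%R in Sa Sb.
have Ht : (t < 1)%R.
{ rewrite /t. apply (Rmult_lt_reg_r (1 - rho)); first lra. replace (rho / (1 - rho) * (1 - rho))%R with rho by (field; lra). lra. }
have HM : (bnd <= bnd * t)%R by apply Rmax_lub.
have Hz0 : (bnd = 0)%R by nra.
have H := cauchy_estimate a bnd Ha (fun z Hz => proj1 (cusp_bound z Hz)) n Ci Hi.
rewrite Hz0 Cmod_qpow in H.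
have He : (0 < exp (-2 * PI * Im Ci) ^ n)%R by apply pow_lt, exp_pos.
have Hc := Rabs_pos (IZR (a n)).
have E : Rabs (IZR (a n)) = 0%R by nra.
destruct (Z.eq_dec (a n) 0) as [E0|E0]; auto.
exfalso. apply (Rabs_no_R0 (IZR (a n))); auto. intros E1. apply E0. by apply eq_IZR.
Qed.
End CuspFunctions.

(** The expansions of 1 / P and, below, of x / Q. Both have integral coefficients since [spart]
    inverts [seta]. *)
Definition sPi : series := smul (spow spart 5) (dilate 5 seta).
Definition sQ0i : series := smul (spow (dilate 5 spart) 5) seta.

(** If N does not divide n, no i makes both i and n - i multiples of N. If n = N q, only the
    multiples of N contribute, and the two sums agree term by term. *)
Lemma dilate_smul (N : nat) (a b : series) : (0 < N)%nat ->
  dilate N (smul a b) = smul (dilate N a) (dilate N b).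
Proof.
intros HN. apply functional_extensionality => n.
have Hz : forall (c : series) k, (k mod N <> 0)%nat -> dilate N c k = 0%Z.
{ intros c k Hk. rewrite /dilate. by destruct (Nat.eqb_spec (k mod N) 0). }
rewrite (Nat.div_mod_eq n N). set q := (n / N)%nat. set s := (n mod N)%nat.
have Hs : (s < N)%nat by apply Nat.mod_upper_bound; lia.
have Hmod : forall i j, (j < N)%nat -> ((N * i + j) mod N = j)%nat.
{ intros i j Hj. rewrite Nat.add_comm Nat.mul_comm Nat.Div0.mod_add Nat.mod_small //. }
destruct (Nat.eq_dec s 0) as [E|E].
- rewrite E Nat.add_0_r dilate_mul // /smul.
  have Hgen : forall r, (r <= q)%nat ->
    zsum (fun i => dilate N a i * dilate N b (N * q - i)%nat)%Z (S (N * r)) =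
    zsum (fun i => a i * b (q - i)%nat)%Z (S r).
  { elim=> [|r IH] Hr.
    - rewrite Nat.mul_0_r. simpl zsum. rewrite !Nat.sub_0_r dilate_mul //.
      by have := dilate_mul N a 0 HN; rewrite Nat.mul_0_r => ->.
    - have E1 : S (N * S r) = (S (N * r) + N)%nat by lia.
      have Hsplit : forall (f : nat -> Z) x y, zsum f (x + y) = (zsum f x + zsum (fun k => f (x + k)%nat) y)%Z.
      { intros f x. elim=> [|y IHy]; first by rewrite Nat.add_0_r; simpl; lia.
        rewrite Nat.add_succ_r. simpl. rewrite IHy. lia. }
      rewrite E1 Hsplit IH; last lia.
      rewrite (zsum_single _ N (N - 1)); last first.
      + intros k Hk Hne. rewrite Hz //. replace (S (N * r) + k)%nat with (N * r + S k)%nat by lia.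
        rewrite Hmod; lia.
      + lia.
      + replace (S (N * r) + (N - 1))%nat with (N * S r)%nat by lia.
        replace (N * q - N * S r)%nat with (N * (q - S r))%nat by nia.
        rewrite !dilate_mul //. }
  rewrite Hgen //.
- rewrite Hz; last by rewrite Hmod.
  symmetry. apply zsum_0 => k Hk.
  destruct (Nat.eq_dec (k mod N) 0) as [Ek|Ek]; last by rewrite Hz.
  rewrite (Hz b); first by rewrite Z.mul_0_r.
  have Hd := Nat.div_mod_eq k N. rewrite Ek in Hd.
  have Hj : (k / N <= q)%nat by (clearbody q s; nia).
  have -> : (N * q + s - k = N * (q - k / N) + s)%nat; last by rewrite Hmod.
  rewrite Nat.mul_sub_distr_l. have : (N * (k / N) <= N * q)%nat by apply Nat.mul_le_mono_l. lia.
Qed.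

Lemma dilate_s1 (N : nat) : (0 < N)%nat -> dilate N s1 = s1.
Proof.
intros HN. apply functional_extensionality => [[|n]].
- rewrite /dilate Nat.Div0.mod_0_l Nat.Div0.div_0_l. reflexivity.
- rewrite /dilate. destruct (Nat.eqb_spec (S n mod N) 0) as [E|E]; last by [].
  have Hd := Nat.div_mod_eq (S n) N. rewrite E in Hd. rewrite /s1.
  destruct (S n / N)%nat; [lia | reflexivity].
Qed.

Lemma sP_inv : smul sP sPi = s1.
Proof.
rewrite /sP /sPi.
transitivity (smul (smul (spow seta 5) (spow spart 5)) (smul (dilate 5 seta) (dilate 5 spart))); first ring.
rewrite -spow_mul_l -dilate_smul; last lia. rewrite seta_spart dilate_s1; last lia. rewrite spow_s1. ring.
Qed.

Lemma sQ_inv : smul sQ sQ0i = sX.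
Proof.
rewrite /sQ /sQ0i.
transitivity (smul sX (smul (smul (spow (dilate 5 seta) 5) (spow (dilate 5 spart) 5)) (smul seta spart))); first ring.
rewrite -spow_mul_l -dilate_smul; last lia. rewrite seta_spart dilate_s1; last lia. rewrite spow_s1. ring.
Qed.

Lemma conv_sPi : conv sPi.
Proof. apply conv_smul; [apply conv_spow, conv_spart | apply conv_dilate; [lia | apply conv_seta]]. Qed.

Lemma conv_sQ0i : conv sQ0i.
Proof. apply conv_smul; [apply conv_spow, conv_dilate; [lia | apply conv_spart] | apply conv_seta]. Qed.

Definition sdrop (k : nat) (a : series) : series := fun n => a (k + n)%nat.

Lemma conv_sdrop (k : nat) (a : series) : conv a -> conv (sdrop k a).
Proof.
intros Ha. apply conv_bounded => rho Hr.
destruct (conv_coef_bounded a rho Ha ltac:(lra)) as [K HK].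
have Hk : (0 < rho ^ k)%R by apply pow_lt; lra.
exists (K / rho ^ k)%R => n. apply (Rmult_le_reg_r (rho ^ k)); auto.
replace (K / rho ^ k * rho ^ k)%R with K by (field; lra).
rewrite Rmult_assoc -pow_add Nat.add_comm. apply HK.
Qed.

Lemma sX_pow_sdrop (k : nat) (a : series) : (forall n, (n < k)%nat -> a n = 0%Z) ->
  smul (spow sX k) (sdrop k a) = a.
Proof.
elim: k a => [|k IH] a H; first by change (smul s1 a = a); ring.
have E : smul sX (sdrop 1 a) = a.
{ apply functional_extensionality => [[|n]].
  - rewrite smul_coef0 H //. lia.
  - by rewrite sX_mul. }
transitivity (smul sX (smul (spow sX k) (sdrop k (sdrop 1 a)))).
- change (smul (smul sX (spow sX k)) (sdrop k (sdrop 1 a)) = smul sX (smul (spow sX k) (sdrop k (sdrop 1 a)))). ring.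
- rewrite IH // => n Hn. apply H. rewrite /=; lia.
Qed.

Lemma spow_square (a : series) (m : nat) : spow (smul a a) m = spow a (2 * m).
Proof. rewrite spow_mul. have -> : spow a 2 = smul a a by simpl; ring. reflexivity. Qed.

(** Division of a by Q^(2m) uses the vanishing of the coefficients below 2m, and the coefficient of
    index 2m makes the quotient A vanish at infinity. Its image under W is B = b / P^(2m), whose
    constant term c is not controlled. *)
Theorem sturm (m : nat) (a b : series) : is_form m a b ->
  (forall n, (n <= 2 * m)%nat -> a n = 0%Z) -> a = s0.
Proof.
intros H H0. have Ca := form_conv_l _ _ _ H. have Cb := form_conv_r _ _ _ H.
set A := smul (sdrop (2 * m) a) (spow sQ0i (2 * m)).
set B := smul b (spow sPi (2 * m)).
have CA : conv A by apply conv_smul; [by apply conv_sdrop | apply conv_spow, conv_sQ0i].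
have CB : conv B by apply conv_smul; [auto | apply conv_spow, conv_sPi].
have CPP := conv_smul _ _ conv_sP conv_sP. have CQQ := conv_smul _ _ conv_sQ conv_sQ.
have EA : smul A (spow (smul sQ sQ) m) = a.
{ rewrite spow_square.
  rewrite /A. transitivity (smul (smul (spow sQ (2 * m)) (spow sQ0i (2 * m))) (sdrop (2 * m) a)); first ring.
  rewrite -spow_mul_l sQ_inv. apply sX_pow_sdrop => n Hn. apply H0. lia. }
have EB : smul B (spow (smul sP sP) m) = b.
{ rewrite spow_square.
  rewrite /B. transitivity (smul b (smul (spow sP (2 * m)) (spow sPi (2 * m)))); first ring.
  rewrite -spow_mul_l sP_inv spow_s1. ring. }
have A0 : A 0%nat = 0%Z.
{ rewrite /A smul_coef0 /sdrop Nat.add_0_r H0 //. }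
have VA : forall z, (0 < Im z)%R -> qval A z * qval (smul sQ sQ) z ^ m = qval a z.
{ intros z Hz. rewrite -qval_spow // -qval_smul ?EA //. by apply conv_spow. }
have VB : forall z, (0 < Im z)%R -> qval B z * qval (smul sP sP) z ^ m = qval b z.
{ intros z Hz. rewrite -qval_spow // -qval_smul ?EB //. by apply conv_spow. }
have NQ : forall z, (0 < Im z)%R -> qval (smul sQ sQ) z ^ m <> 0.
{ intros z Hz. apply Cpow_nz. rewrite qval_sQQ //. apply Cmult_neq_0.
  - apply Cpow_nz, heta_neq_0. by apply Im_5.
  - apply Cmod_gt_0. rewrite Cmod_inv; last by apply heta_neq_0.
    apply Rinv_0_lt_compat, Cmod_gt_0. by apply heta_neq_0. }
have NP : forall z, (0 < Im z)%R -> qval (smul sP sP) z ^ m <> 0.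
{ intros z Hz. apply Cpow_nz. rewrite qval_sPP //. have H5 := Im_5 z Hz. apply Cmult_neq_0.
  - by apply Cpow_nz, heta_neq_0.
  - apply Cmod_gt_0. rewrite Cmod_inv; last by apply heta_neq_0.
    apply Rinv_0_lt_compat, Cmod_gt_0. by apply heta_neq_0. }
have cancel : forall x y u : C, u <> 0 -> x * u = y * u -> x = y.
{ intros x y u Hu E. replace x with (x * u * / u) by (field; auto). rewrite E. field. auto. }
have LW : forall z, (0 < Im z)%R -> qval A (W_ z) = qval B z.
{ intros z Hz. have HW := Im_W z Hz. have Hn := Cpow_nz _ (4 * m) (Im_pos_neq_0 z Hz).
  have NPz := NP z Hz. have N5 := five_pow_neq_0 m.
  have E1 := form_W _ _ _ H z Hz. rewrite -VA // -VB // in E1.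
  have E2 := f_equal (fun x => x ^ m) (QQ_W z Hz). cbv beta in E2. rewrite 2!Cpow_mult_l -Cpow_mult_r in E2.
  apply (cancel _ _ (z ^ (4 * m) * qval (smul sP sP) z ^ m)); first by apply Cmult_neq_0.
  rewrite -{1}E2. transitivity (RtoC 5 ^ m * (qval A (W_ z) * qval (smul sQ sQ) (W_ z) ^ m)); first ring.
  rewrite E1. ring. }
have LgA : forall z, (0 < Im z)%R -> qval A (g_ z) = qval A z.
{ intros z Hz. have Hg := Im_g z Hz. have Nc := Cpow_nz _ (4 * m) (g_factor_neq_0 z Hz).
  have E1 := form_g_l _ _ _ H z Hz. rewrite -VA // -VA // QQ_g // Cpow_mult_l -Cpow_mult_r in E1.
  apply (cancel _ _ ((RtoC 5 * z + RtoC (-2)) ^ (4 * m) * qval (smul sQ sQ) z ^ m)); first by apply Cmult_neq_0; auto.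
  rewrite E1. ring. }
have LgB : forall z, (0 < Im z)%R -> qval B (g_ z) = qval B z.
{ intros z Hz. have Hg := Im_g z Hz. have Nc := Cpow_nz _ (4 * m) (g_factor_neq_0 z Hz).
  have E1 := form_g_r _ _ _ H z Hz. rewrite -VB // -VB // PP_g // Cpow_mult_l -Cpow_mult_r in E1.
  apply (cancel _ _ ((RtoC 5 * z + RtoC (-2)) ^ (4 * m) * qval (smul sP sP) z ^ m)); first by apply Cmult_neq_0; auto.
  rewrite E1. ring. }
suff HA : A = s0 by rewrite -EA HA; ring.
clearbody A B. set c := B 0%nat.
have CAc : conv (ssub A (sC c)) by apply conv_ssub; [auto | apply conv_sC].
have CBc : conv (ssub B (sC c)) by apply conv_ssub; [auto | apply conv_sC].
(* A has value 0 at infinity and c at the cusp 0, so A (A - c) and B (B - c) vanish at both cusps. *)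
have HG : forall n, smul A (ssub A (sC c)) n = 0%Z.
{ apply (cusp_function_zero _ (smul B (ssub B (sC c)))); try by apply conv_smul.
  - by rewrite smul_coef0 A0.
  - rewrite smul_coef0 /ssub /sadd /sopp /sC /= -/c. lia.
  - intros z Hz. have HW := Im_W z Hz. rewrite !qval_smul // !qval_ssub ?qval_sC ?LW //; apply conv_sC.
  - intros z Hz. have Hg := Im_g z Hz. rewrite !qval_smul // !qval_ssub ?qval_sC ?LgA //; apply conv_sC.
  - intros z Hz. have Hg := Im_g z Hz. rewrite !qval_smul // !qval_ssub ?qval_sC ?LgB //; apply conv_sC. }
apply functional_extensionality => n.
destruct (Z.eq_dec c 0) as [Hc|Hc]; first by apply (cusp_function_zero A B).
(* If the coefficients of A below n vanish, the coefficient n of A (A - c) is - c A_n, and c is not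
   0. *)
elim/(well_founded_induction lt_wf): n => n IH.
have E := HG n. rewrite /smul in E. simpl zsum in E.
rewrite zsum_0 in E.
- rewrite Nat.sub_diag /ssub /sadd /sopp A0 /sC /= in E. rewrite /s0. nia.
- intros k Hk. by rewrite IH.
Qed.

(** * Reduction mod 2 *)

Definition red (a : series) : ps2 := fun n => Z.odd (a n).

Lemma red_sadd (a b : series) : red (sadd a b) = ps2_add (red a) (red b).
Proof. apply functional_extensionality => n. apply Z.odd_add. Qed.

Lemma fold_xorb (f : nat -> Z) (n : nat) :
  fold_right xorb false (map (fun i => Z.odd (f i)) (seq 0 n)) = Z.odd (zsum f n).
Proof.
elim: n f => [|n IH] f; first by [].
rewrite zsum_succ_l Z.odd_add. change (seq 0 (S n)) with (0%nat :: seq 1 n).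
simpl. rewrite -seq_shift map_map IH. reflexivity.
Qed.

Lemma red_smul (a b : series) : red (smul a b) = ps2_mul (red a) (red b).
Proof.
apply functional_extensionality => n. rewrite /red /ps2_mul /smul -fold_xorb. f_equal.
apply map_ext => i. apply Z.odd_mul.
Qed.

Lemma red_s1 : red s1 = ps2_one.
Proof. apply functional_extensionality => n. rewrite /red /s1 /ps2_one. by destruct (Nat.eqb n 0). Qed.

Lemma red_spow (a : series) (n : nat) : red (spow a n) = ps2_pow (red a) n.
Proof. elim: n => [|n IH] /=; [apply red_s1 | by rewrite red_smul IH]. Qed.

Lemma red_intro (a b c : series) : a = sadd b (smul (sC 2) c) -> red a = red b.
Proof.
move=> ->. rewrite red_sadd. apply functional_extensionality => n.
rewrite /ps2_add /red sC_mul Z.odd_mul /=. by destruct (Z.odd (b n)).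
Qed.

Lemma red_elim (a b : series) : red a = red b -> exists c, a = sadd b (smul (sC 2) c).
Proof.
intros H. exists (fun n => ((a n - b n) / 2)%Z). apply functional_extensionality => n.
rewrite /sadd sC_mul. have E := f_equal (fun f => f n) H. rewrite /red in E. cbv beta in E.
have Hodd : Z.odd (a n - b n) = false by rewrite Z.odd_sub E; destruct (Z.odd (b n)).
have Hd := Z.div_mod (a n - b n) 2 ltac:(lia). rewrite Zmod_odd Hodd in Hd. lia.
Qed.

(** Frobenius mod 2. Writing a = a_0 + x t gives a^2 = a_0^2 + x^2 t^2 mod 2, so the coefficient n +
    2 of a^2 is the coefficient n of t^2. *)
Lemma red_square (a : series) : red (smul a a) = red (dilate 2 a).
Proof.
apply functional_extensionality => n. move: a.
elim/(well_founded_induction lt_wf): n => n IH a.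
set t := sdrop 1 a.
have Ea : a = sadd (sC (a 0%nat)) (smul sX t).
{ apply functional_extensionality => [[|k]]; rewrite /sadd.
  - rewrite smul_coef0 /sC /sX /=. lia.
  - rewrite sX_mul /sC /t /sdrop /=. destruct (a (S k)); reflexivity. }
have E : smul a a = sadd (sadd (smul (sC (a 0%nat)) (sC (a 0%nat))) (smul sX (smul sX (smul t t))))
  (smul (sC 2) (smul (sC (a 0%nat)) (smul sX t))).
{ have -> : sC 2 = sadd s1 s1 by apply functional_extensionality => [[|k]].
  set c := sC (a 0%nat) in Ea *. rewrite Ea. ring. }
rewrite (red_intro _ _ _ E). rewrite /red /sadd sC_mul.
destruct n as [|[|n]].
- rewrite smul_coef0 /dilate /sC /sX /= Z.odd_add Z.odd_mul. by destruct (Z.odd (a 0%nat)).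
- rewrite sX_mul smul_coef0 /dilate /sC /= Z.mul_0_r. reflexivity.
- rewrite !sX_mul. have H := IH n ltac:(lia) t. rewrite /red in H.
  rewrite Z.add_comm Z.odd_add H /sC /=. rewrite ?Z.mul_0_r ?Bool.xorb_false_r.
  rewrite /dilate. have -> : (S (S n) = n + 1 * 2)%nat by lia.
  rewrite Nat.Div0.mod_add Nat.div_add; last lia. destruct (Nat.eqb _ _); auto.
  by rewrite /t /sdrop Nat.add_comm.
Qed.

Lemma red_square_eq1 (a : series) : red (smul a a) = red s1 -> red a = red s1.
Proof.
intros H. apply functional_extensionality => n. rewrite red_square in H.
have E := f_equal (fun f => f (2 * n)%nat) H. rewrite /red dilate_mul in E; last lia. rewrite /red E.
by destruct n.
Qed.

(** * Forms as integral combinations of monomials in P and Q *)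

Fixpoint slin (c : nat -> Z) (G : nat -> series) (n : nat) : series :=
  match n with O => s0 | S k => sadd (slin c G k) (smul (sC (c k)) (G k)) end.

Lemma slin_ext (c d : nat -> Z) (G : nat -> series) (n : nat) :
  (forall k, (k < n)%nat -> c k = d k) -> slin c G n = slin d G n.
Proof.
elim: n => [|n IH] H //=. rewrite IH; last by (intros; apply H; lia). rewrite H //.
Qed.

Lemma sX_pow_low (u : series) (k n : nat) : (n < k)%nat -> smul (spow sX k) u n = 0%Z.
Proof.
elim: k n => [|k IH] n Hn; first lia.
have -> : smul (spow sX (S k)) u = smul sX (smul (spow sX k) u) by simpl; ring.
destruct n as [|n]; first by rewrite smul_coef0.
rewrite sX_mul IH //. lia.
Qed.

Lemma sX_pow_lead (u : series) (k : nat) : smul (spow sX k) u k = u 0%nat.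
Proof.
elim: k => [|k IH]; first by (have -> : smul (spow sX 0) u = u by simpl; ring).
have -> : smul (spow sX (S k)) u = smul sX (smul (spow sX k) u) by simpl; ring.
by rewrite sX_mul.
Qed.

Lemma mono_sX (a b : nat) : exists u, mono a b = smul (spow sX b) u /\ u 0%nat = 1%Z.
Proof.
exists (smul (spow sP a) (spow (smul (spow (dilate 5 seta) 5) spart) b)). split.
- rewrite /mono /sQ spow_mul_l. ring.
- by rewrite smul_coef0 !spow_coef0.
Qed.

Definition basis (m j : nat) : series := mono (2 * m - j) j.

Lemma is_form_slin (m : nat) (c : nat -> Z) (n : nat) : (n <= S (2 * m))%nat ->
  exists b, is_form m (slin c (basis m) n) b.
Proof.
elim: n => [|n IH] Hn.
- destruct (is_form_mono m (2 * m) 0 ltac:(lia)) as [b Hb].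
  exists (ssub b b). have -> : slin c (basis m) 0 = ssub (mono (2 * m) 0) (mono (2 * m) 0) by simpl; ring.
  by apply is_form_sub.
- destruct (IH ltac:(lia)) as [b Hb].
  destruct (is_form_mono m (2 * m - n) n ltac:(lia)) as [d Hd].
  exists (ssub b (smul (sC (- c n)) d)).
  have -> : slin c (basis m) (S n) = ssub (slin c (basis m) n) (smul (sC (- c n)) (basis m n)).
  { have -> : sC (- c n) = sopp (sC (c n)) by apply functional_extensionality => [[|k]].
    simpl. ring. }
  apply is_form_sub; auto. by apply is_form_scal.
Qed.

Theorem form_decomposition (m : nat) (a b : series) : is_form m a b ->
  exists c, a = slin c (basis m) (S (2 * m)).
Proof.
intros H.
have H1 : forall k, (k <= S (2 * m))%nat ->
  exists c, forall n, (n < k)%nat -> ssub a (slin c (basis m) k) n = 0%Z.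
{ elim=> [|k IH] Hk.
  - exists (fun _ => 0%Z). intros n Hn. lia.
  - destruct (IH ltac:(lia)) as [c Hc].
    set e := ssub a (slin c (basis m) k) in Hc.
    exists (fun j => if Nat.eqb j k then e k else c j).
    have E : forall n, ssub a (slin (fun j => if Nat.eqb j k then e k else c j) (basis m) (S k)) n =
      (e n - e k * basis m k n)%Z.
    { intros n. simpl slin. rewrite (slin_ext _ c).
      - rewrite Nat.eqb_refl /ssub /sadd /sopp sC_mul /e /ssub /sadd /sopp. lia.
      - intros j Hj. destruct (Nat.eqb_spec j k); [lia | reflexivity]. }
    destruct (mono_sX (2 * m - k) k) as (u & Hu & Hu0).
    intros n Hn. rewrite E /basis Hu. destruct (Nat.eq_dec n k) as [->|Hne].
    + rewrite sX_pow_lead Hu0. lia.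
    + rewrite Hc; last lia. rewrite sX_pow_low; lia. }
destruct (H1 (S (2 * m)) (Nat.le_refl _)) as [c Hc]. exists c.
destruct (is_form_slin m c (S (2 * m)) (Nat.le_refl _)) as [d Hd].
have Z0 := sturm m _ _ (is_form_sub _ _ _ _ _ H Hd) (fun n Hn => Hc n ltac:(lia)).
transitivity (sadd (ssub a (slin c (basis m) (S (2 * m)))) (slin c (basis m) (S (2 * m)))); first ring.
rewrite Z0. ring.
Qed.

(** * The reductions of P and Q *)

Lemma sD_spow5 (a : series) : sD (spow a 5) = smul (sC 5) (smul (spow a 4) (sD a)).
Proof.
have -> : sC 5 = sadd s1 (sadd s1 (sadd s1 (sadd s1 s1))) by apply functional_extensionality => [[|k]].
simpl. rewrite !sD_smul sD_s1. ring.
Qed.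

Lemma sD_dilate (N : nat) (a : series) : (0 < N)%nat ->
  sD (dilate N a) = smul (sC (Z.of_nat N)) (dilate N (sD a)).
Proof.
intros HN. apply functional_extensionality => n. rewrite sC_mul /sD /dilate.
destruct (Nat.eqb_spec (n mod N) 0) as [E|E]; last lia.
have Hd := Nat.div_mod_eq n N. rewrite E in Hd. rewrite {1}Hd. lia.
Qed.

Lemma sD_sX : sD sX = sX.
Proof. by apply functional_extensionality => [[|[|n]]]; rewrite /sD /sX /= ?Z.mul_0_r. Qed.

Lemma dilate_sopp (N : nat) (a : series) : dilate N (sopp a) = sopp (dilate N a).
Proof. apply functional_extensionality => n. rewrite /dilate /sopp. by destruct (Nat.eqb _ _). Qed.

Lemma sD_sP : sD sP = smul sP (smul (sC 5) (ssub (dilate 5 ssig) ssig)).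
Proof.
rewrite /sP sD_smul sD_spow5 sD_seta sD_dilate; last lia. rewrite sD_spart dilate_smul; last lia.
change (Z.of_nat 5) with 5%Z. simpl. ring.
Qed.

Lemma sD_sQ : sD sQ = smul sQ (sadd s1 (ssub ssig (smul (smul (sC 5) (sC 5)) (dilate 5 ssig)))).
Proof.
rewrite /sQ 2!sD_smul sD_spow5 sD_dilate; last lia.
rewrite sD_seta sD_spart sD_sX dilate_sopp dilate_smul; last lia.
change (Z.of_nat 5) with 5%Z. simpl. ring.
Qed.

Lemma smul_coef1 (a b : series) : smul a b 1%nat = (a 0%nat * b 1%nat + a 1%nat * b 0%nat)%Z.
Proof. reflexivity. Qed.

Lemma smul_coef2 (a b : series) :
  smul a b 2%nat = (a 0%nat * b 2%nat + a 1%nat * b 1%nat + a 2%nat * b 0%nat)%Z.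
Proof. reflexivity. Qed.

(** At exponent 1 the operator x d/dx is the identity, so the coefficient is read off from the
    logarithmic derivative. *)
Lemma sP_1 : sP 1%nat = (-5)%Z.
Proof.
have H := f_equal (fun f => f 1%nat) sD_sP. cbv beta in H.
have P0 : sP 0%nat = 1%Z by rewrite /sP smul_coef0 spow_coef0.
have -> : sP 1%nat = sD sP 1%nat by rewrite /sD Z.mul_1_l.
rewrite H smul_coef1 P0 !sC_mul. reflexivity.
Qed.

Lemma red_PQ : red (sadd sP sQ) = red s1.
Proof.
destruct (form_decomposition _ _ _ is_form_E5) as [c Hc].
have HE : red (smul sE5 sE5) = red s1.
{ set w := ssub (smul (sC 3) ssig) (smul (sC 15) (dilate 5 ssig)).
  apply (red_intro _ _ (sadd (smul (sC 2) (smul w w)) (smul (sC 2) w))).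
  have -> : sE5 = sadd s1 (smul (sC 2) w).
  { apply functional_extensionality => n. rewrite /sE5 /w /ssub /sadd /sopp !sC_mul. lia. }
  have -> : sC 2 = sadd s1 s1 by apply functional_extensionality => [[|k]]. ring. }
have E : smul sE5 sE5 = sadd (smul (sC (c 0%nat)) (smul sP sP))
   (sadd (smul (sC (c 1%nat)) (smul sP sQ)) (smul (sC (c 2%nat)) (smul sQ sQ))).
{ rewrite Hc /basis /mono /=. ring. }
have P0 : sP 0%nat = 1%Z by rewrite /sP smul_coef0 spow_coef0.
have P1 := sP_1.
have Q0 : sQ 0%nat = 0%Z by [].
have Q1 : sQ 1%nat = 1%Z.
{ rewrite /sQ sX_mul smul_coef0 spow_coef0 //. }
have parity : forall n, Z.odd (c 0%nat * smul sP sP n + (c 1%nat * smul sP sQ n + c 2%nat * smul sQ sQ n)) = Z.odd (s1 n).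
{ intros n. have := f_equal (fun f => f n) HE. rewrite /red E /sadd !sC_mul. auto. }
(* These parities make c_0 odd, c_1 even and c_2 odd: P^2 has the coefficient 2 * (-5) at x and 25
   plus an even number at x^2, while PQ and Q^2 begin with x and x^2. Hence E^2 = P^2 + Q^2 = (P +
   Q)^2 mod 2. *)
have C0 := parity 0%nat. have C1 := parity 1%nat. have C2 := parity 2%nat.
rewrite !smul_coef0 in C0. rewrite !smul_coef1 in C1. rewrite !smul_coef2 in C2.
rewrite P0 Q0 in C0 C1 C2. rewrite P1 Q1 in C1 C2.
rewrite ?Z.odd_add ?Z.odd_mul /= in C0 C1 C2.
apply red_square_eq1. rewrite -HE E.
have -> : smul (sadd sP sQ) (sadd sP sQ) = sadd (smul sP sP) (sadd (smul (sC 2) (smul sP sQ)) (smul sQ sQ)).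
{ have -> : sC 2 = sadd s1 s1 by apply functional_extensionality => [[|k]]. ring. }
apply functional_extensionality => n. rewrite /red /sadd !sC_mul.
set x := smul sP sP n. set y := smul sP sQ n. set w := smul sQ sQ n. clearbody x y w.
rewrite !Z.odd_add !Z.odd_mul. change (Z.odd 2) with false. move: C0 C1 C2.
case: (Z.odd (c 0%nat)); case: (Z.odd (c 1%nat)); case: (Z.odd (c 2%nat));
  case: (Z.odd x); case: (Z.odd y); case: (Z.odd w); done.
Qed.

(* Logarithmic derivatives: DP = P r and DQ = Q (1 + r) mod 2, with r the sum of sigma(n) x^n and its
   dilation by 5, while D(P + Q) = 0 mod 2. *)
Lemma red_sQ : red sQ = red (sadd ssig (dilate 5 ssig)).
Proof.
destruct (red_elim _ _ red_PQ) as [c Hc].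
set u := ssig. set v := dilate 5 ssig. set r := sadd u v.
have E2 : sC 2 = sadd s1 s1 by apply functional_extensionality => [[|k]].
have E5 : sC 5 = sadd s1 (smul (sC 2) (sC 2)).
{ apply functional_extensionality => n. rewrite /sadd sC_mul /sC /s1. by destruct n. }
have HD : sadd (sD sP) (sD sQ) = smul (sC 2) (sD c).
{ rewrite -sD_sadd Hc sD_sadd sD_s1 E2 !sD_smul !sD_sadd sD_s1. ring. }
rewrite sD_sP sD_sQ -/u -/v in HD.
have EQ : sP = ssub (sadd s1 (smul (sC 2) c)) sQ by rewrite -Hc; ring.
rewrite -/r. set three := sadd s1 (sC 2). set w := ssub u (smul (sC 5) v).
(* With P = 1 + 2 c - Q, the equation DP + DQ = 2 Dc becomes Q (1 + 6 u - 30 v) = 2 Dc + 5 (1 + 2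
   c)(u - v). The witness is (Q - r) / 2 as solved from it. *)
apply (red_intro _ _ (sadd (sD c) (sadd (smul (smul (sC 5) (ssub u v)) c)
  (ssub (ssub (smul (sC 2) u) (smul three v)) (smul (smul three w) sQ))))).
have Hz : ssub (smul (sC 2) (sD c)) (sadd (smul sP (smul (sC 5) (ssub v u)))
  (smul sQ (sadd s1 (ssub u (smul (smul (sC 5) (sC 5)) v))))) = s0 by rewrite -HD; ring.
transitivity (sadd sQ s0); first ring.
rewrite -Hz EQ /r /w /three E5 E2. ring.
Qed.

Lemma is_j_square_spec (j N : nat) : (0 < j)%nat ->
  is_j_square j N = true <-> exists m, (0 < m)%nat /\ (j * (m * m) = N)%nat.
Proof.
intros Hj. rewrite /is_j_square existsb_exists. split.
- intros (m & Hm & E). apply in_seq in Hm. apply Nat.eqb_eq in E. exists m. split; [lia | auto].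
- intros (m & Hm & E). exists m. split; last by apply Nat.eqb_eq. apply in_seq. nia.
Qed.

Lemma bool_iff (b c : bool) : (b = true <-> c = true) -> b = c.
Proof. destruct b, c; intuition congruence. Qed.

Lemma zsum_odd_ext (f g : nat -> Z) (n : nat) :
  (forall k, (k < n)%nat -> Z.odd (f k) = Z.odd (g k)) -> Z.odd (zsum f n) = Z.odd (zsum g n).
Proof.
elim: n => [|n IH] H //=. rewrite !Z.odd_add IH; last by (intros; apply H; lia). rewrite H //.
Qed.

(** Terms off the diagonal cancel in pairs mod 2. *)
Lemma zsum_odd_symmetric (u : nat -> nat -> Z) (n : nat) : (forall i j, u i j = u j i) ->
  Z.odd (zsum (fun i => zsum (fun j => u i j) n) n) = Z.odd (zsum (fun i => u i i) n).
Proof.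
intros Hu. elim: n => [|n IH] //.
change (Z.odd (zsum (fun i => zsum (fun j => u i j) n + u i n) n + (zsum (fun j => u n j) n + u n n)) =
  Z.odd (zsum (fun i => u i i) n + u n n))%Z.
rewrite zsum_plus (zsum_ext (fun j => u n j) (fun i => u i n)); last by intros; apply Hu.
rewrite !Z.odd_add IH. by destruct (Z.odd (zsum (fun i => u i n) n)), (Z.odd (zsum (fun i => u i i) n)), (Z.odd (u n n)).
Qed.

Lemma zsum_double (f : nat -> Z) (n : nat) :
  zsum f (2 * n) = zsum (fun l => f (2 * l)%nat + f (S (2 * l)))%Z n.
Proof.
elim: n => [|n IH] //. have -> : (2 * S n = S (S (2 * n)))%nat by lia.
cbn [zsum]. rewrite IH. lia.
Qed.

(** In [ssig n] the divisor d contributes n / d. An odd divisor of 2 n contributes an even quotient,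
    and the even divisors 2 d contribute the terms n / d of [ssig n]. *)
Lemma odd_ssig_double (n : nat) : Z.odd (ssig (2 * n)%nat) = Z.odd (ssig n).
Proof.
rewrite /ssig zsum_double. apply zsum_odd_ext => l Hl. rewrite Z.odd_add.
have -> : dilate (S (S (2 * l))) sid (2 * n)%nat = dilate (S l) sid n.
{ have -> : S (S (2 * l)) = (2 * S l)%nat by lia.
  rewrite /dilate Nat.Div0.mul_mod_distr_l Nat.Div0.div_mul_cancel_l; last lia.
  destruct (Nat.eqb_spec (n mod S l) 0) as [->|H]; first by [].
  destruct (Nat.eqb_spec (2 * (n mod S l)) 0); [lia | reflexivity]. }
have -> : Z.odd (dilate (S (2 * l)) sid (2 * n)%nat) = false; last by [].
rewrite /dilate /sid. destruct (Nat.eqb_spec ((2 * n) mod S (2 * l)) 0) as [E|E]; last by [].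
have Hd := Nat.div_mod_eq (2 * n) (S (2 * l)). rewrite E in Hd. set q := (2 * n / S (2 * l))%nat in Hd *.
clearbody q. apply Bool.not_true_is_false => Ho. apply Z.odd_spec in Ho. destruct Ho as [h Hh]. 
have : (2 * Z.of_nat n = (2 * Z.of_nat l + 1) * (2 * h + 1))%Z by lia. nia.
Qed.

(** All divisors of n are odd, so sigma(n) has the parity of the number of factorizations n = i j,
    and by symmetry that of the number with i = j. *)
Lemma odd_ssig_odd (n : nat) : Nat.odd n = true -> Z.odd (ssig n) = is_j_square 1 n.
Proof.
intros Hn.
set u : nat -> nat -> Z := fun i j => if Nat.eqb (S i * S j) n then 1%Z else 0%Z.
have E1 : Z.odd (ssig n) = Z.odd (zsum (fun i => zsum (fun j => u i j) n) n).
{ rewrite /ssig. apply zsum_odd_ext => i Hi. rewrite /dilate /sid.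
  destruct (Nat.eqb_spec (n mod S i) 0) as [E|E].
  - have Hd := Nat.div_mod_eq n (S i). rewrite E in Hd. set q := (n / S i)%nat in Hd *. clearbody q.
    have Hq : (0 < q)%nat by destruct q; lia.
    rewrite (zsum_single _ _ (q - 1)); [|nia|].
    + rewrite /u. have -> : Nat.eqb (S i * S (q - 1)) n = true by apply Nat.eqb_eq; nia.
      apply Nat.odd_spec in Hn. destruct Hn as [h Hh]. apply Z.odd_spec.
      destruct (Nat.Even_or_Odd q) as [[e He]|[e He]]; first by nia. exists (Z.of_nat e). lia.
    + intros k Hk Hne. rewrite /u. destruct (Nat.eqb_spec (S i * S k) n) as [F|F]; last by [].
      exfalso. apply Hne. nia.
  - rewrite zsum_0 // => k Hk. rewrite /u. destruct (Nat.eqb_spec (S i * S k) n) as [F|F]; last by [].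
    exfalso. apply E. rewrite -F Nat.mul_comm. apply Nat.Div0.mod_mul. }
rewrite E1 zsum_odd_symmetric; last by (intros i j; rewrite /u Nat.mul_comm).
apply bool_iff. rewrite is_j_square_spec; last lia. split.
- intros H. destruct (Nat.eq_dec (length (filter (fun i => Nat.eqb (S i * S i) n) (seq 0 n))) 0) as [E|E].
  + apply length_zero_iff_nil in E. rewrite zsum_0 // in H => k Hk. rewrite /u.
    destruct (Nat.eqb (S k * S k) n) eqn:F; last by [].
    have : In k (filter (fun i => Nat.eqb (S i * S i) n) (seq 0 n)).
    { apply filter_In. split; [apply in_seq; lia | exact F]. }
    by rewrite E.
  + destruct (filter (fun i => Nat.eqb (S i * S i) n) (seq 0 n)) as [|k l] eqn:F; first by [].
    have : In k (filter (fun i => Nat.eqb (S i * S i) n) (seq 0 n)) by rewrite F; left.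
    intros Hk. apply filter_In in Hk. destruct Hk as [_ Hk]. apply Nat.eqb_eq in Hk. exists (S k). lia.
- intros (m & Hm & E). rewrite (zsum_single _ _ (m - 1)); [|nia|].
  + rewrite /u. have -> : Nat.eqb (S (m - 1) * S (m - 1)) n = true by apply Nat.eqb_eq; nia. reflexivity.
  + intros k Hk Hne. rewrite /u. destruct (Nat.eqb_spec (S k * S k) n) as [F|F]; last by [].
    exfalso. apply Hne. nia.
Qed.

(** For even n, passing to n / 2 preserves the parity of sigma and exchanges squares with twice
    squares. *)
Lemma odd_ssig (n : nat) : Z.odd (ssig n) = xorb (is_j_square 1 n) (is_j_square 2 n).
Proof.
elim/(well_founded_induction lt_wf): n => n IH.
destruct (Nat.Even_or_Odd n) as [[e He]|[e He]].
- destruct (Nat.eq_dec e 0) as [H0|H0]; first by rewrite He H0.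
  rewrite He odd_ssig_double IH; last lia. rewrite Bool.xorb_comm. f_equal; apply bool_iff; rewrite !is_j_square_spec; try lia.
  + split; intros (m & Hm & E); [exists (2 * m)%nat; split; lia|].
    destruct (Nat.Even_or_Odd m) as [[h Hh]|[h Hh]]; last by nia.
    exists h. split; nia.
  + split; intros (m & Hm & E); exists m; split; lia.
- rewrite odd_ssig_odd; last by (apply Nat.odd_spec; exists e).
  have -> : is_j_square 2 n = false; last by rewrite Bool.xorb_false_r.
  apply Bool.not_true_is_false. rewrite is_j_square_spec; last lia. intros (m & Hm & E). lia.
Qed.

Lemma is_j_square_5 (j n : nat) : (0 < j)%nat ->
  is_j_square (5 * j) n = if Nat.eqb (n mod 5) 0 then is_j_square j (n / 5) else false.
Proof.
intros Hj. have Hd := Nat.div_mod_eq n 5. apply bool_iff. rewrite is_j_square_spec; last lia.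
destruct (Nat.eqb_spec (n mod 5) 0) as [E|E].
- rewrite is_j_square_spec //. split; intros (m & Hm & F); exists m; (split; [auto | nia]).
- split; last by []. intros (m & Hm & F). exfalso. apply E. rewrite -F -Nat.mul_assoc Nat.mul_comm. apply Nat.Div0.mod_mul.
Qed.

Theorem red_sQ_r : red sQ = r.
Proof.
rewrite red_sQ. apply functional_extensionality => n. rewrite red_sadd /ps2_add /red /r odd_ssig.
rewrite (is_j_square_5 1) // (is_j_square_5 2); last lia. rewrite Bool.xorb_assoc. do 2 f_equal.
rewrite /dilate. destruct (Nat.eqb (n mod 5) 0); [apply odd_ssig | reflexivity].
Qed.

(** * Hecke operators mod 2 *)

Lemma red_hecke (p k : nat) (a : series) : Nat.odd p = true -> red (hecke_series p k a) = Tp p (red a).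
Proof.
intros Hp. apply functional_extensionality => n. rewrite /red /hecke_series /Tp Z.odd_add !Z.odd_mul.
have Hz : Z.odd (Z.of_nat p) = true.
{ apply Nat.odd_spec in Hp. destruct Hp as [h Hh]. apply Z.odd_spec. exists (Z.of_nat h). lia. }
have Hzk : Z.odd (Z.of_nat p ^ Z.of_nat k) = true.
{ elim: k => [|k IH] //. by rewrite Nat2Z.inj_succ Z.pow_succ_r ?Z.odd_mul ?Hz ?IH //; lia. }
rewrite Hz Hzk /= /dilate. by destruct (Nat.eqb (n mod p) 0).
Qed.

Lemma Tp_odd_support (p : nat) (f : ps2) : Nat.odd p = true ->
  (forall n, Nat.even n = true -> f n = false) -> forall n, Nat.even n = true -> Tp p f n = false.
Proof.
intros Hp Hf n Hn. rewrite /Tp Hf; last by rewrite Nat.even_mul Hn Bool.orb_true_r.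
destruct (Nat.eqb_spec (n mod p) 0) as [E|E]; last by [].
rewrite Hf //. have Hd := Nat.div_mod_eq n p. rewrite E Nat.add_0_r in Hd.
rewrite Hd Nat.even_mul -Nat.negb_odd Hp in Hn. exact Hn.
Qed.

(** Only the defining conditions are transported, in any weight; no comparison with P and Q
    enters. *)
Theorem modform_hecke (p k : nat) (a : series) : prime (Z.of_nat p) -> p <> 5%nat ->
  is_modform_G05 k a -> is_modform_G05 k (hecke_series p k a).
Proof.
intros Hp Hp5 (H1 & H2 & H3). have Ha := qconverges_conv a H1. have Hh := conv_hecke_series p Hp Hp5 k a Ha.
split; [|split].
- intros z Hz. by apply conv_qconverges.
- intros al be ga de D H5 z Hz.
  have H := hecke_weight p Hp Hp5 k (qval a) H2 al be ga de D H5 z Hz.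
  rewrite !hecke_qval // in H. apply Im_mobius_pos; auto. lia.
- intros al be ga de D. destruct (hecke_bounded p Hp Hp5 k (qval a) H3 al be ga de D) as (B & Y & H).
  exists B, (Rmax 0 Y) => z Hz. have HY := Rmax_l 0 Y. have HY2 := Rmax_r 0 Y.
  have Hm : (0 < Im (mobius al be ga de z))%R by apply Im_mobius_pos; [lia | lra].
  rewrite -hecke_qval //. apply H. lra.
Qed.

(** The span over Z/2 is expressed through integral lifts, so that products, x d/dx and the ring
    identities of [series] remain at hand. *)
Definition span (G : nat -> series) (n : nat) (a : series) : Prop := exists c, red a = red (slin c G n).

Lemma slin_0 (G : nat -> series) (n : nat) : slin (fun _ => 0%Z) G n = s0.
Proof.
elim: n => [|n IH] //=. rewrite IH. have -> : sC 0 = s0 by apply functional_extensionality => [[|k]]. ring.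
Qed.

Lemma slin_add (c d : nat -> Z) (G : nat -> series) (n : nat) :
  slin (fun k => c k + d k)%Z G n = sadd (slin c G n) (slin d G n).
Proof.
elim: n => [|n IH] /=; first ring. rewrite IH.
have -> : sC (c n + d n) = sadd (sC (c n)) (sC (d n)) by apply functional_extensionality => [[|k]]. ring.
Qed.

Lemma slin_scal (e : Z) (c : nat -> Z) (G : nat -> series) (n : nat) :
  slin (fun k => e * c k)%Z G n = smul (sC e) (slin c G n).
Proof.
elim: n => [|n IH] /=; first ring. rewrite IH.
have -> : sC (e * c n) = smul (sC e) (sC (c n)).
{ apply functional_extensionality => k. rewrite sC_mul /sC. destruct (Nat.eqb k 0); lia. }
ring.
Qed.

Lemma slin_single (i : nat) (G : nat -> series) (n : nat) : (i < n)%nat ->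
  slin (fun k => if Nat.eqb k i then 1%Z else 0%Z) G n = G i.
Proof.
elim: n => [|n IH] Hi; first lia. simpl. destruct (Nat.eqb_spec n i) as [<-|Hne].
- rewrite (slin_ext _ (fun _ => 0%Z)).
  + rewrite slin_0. change (sC 1) with s1. ring.
  + intros k Hk. destruct (Nat.eqb_spec k n); [lia | reflexivity].
- rewrite IH; last lia. have -> : sC 0 = s0 by apply functional_extensionality => [[|k]]. ring.
Qed.

Lemma slin_succ_l (c : nat -> Z) (G : nat -> series) (n : nat) :
  slin c G (S n) = sadd (smul (sC (c 0%nat)) (G 0%nat)) (slin (fun k => c (S k)) (fun k => G (S k)) n).
Proof.
elim: n => [|n IH]; first by simpl; ring.
change (slin c G (S (S n))) with (sadd (slin c G (S n)) (smul (sC (c (S n))) (G (S n)))).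
rewrite IH /=. ring.
Qed.

Lemma span_red (G : nat -> series) (n : nat) (a b : series) : red a = red b -> span G n b -> span G n a.
Proof. intros E [c Hc]. exists c. by rewrite E. Qed.

Lemma span_0 (G : nat -> series) (n : nat) : span G n s0.
Proof. exists (fun _ => 0%Z). by rewrite slin_0. Qed.

Lemma span_gen (G : nat -> series) (n i : nat) : (i < n)%nat -> span G n (G i).
Proof. intros Hi. exists (fun k => if Nat.eqb k i then 1%Z else 0%Z). by rewrite slin_single. Qed.

Lemma span_add (G : nat -> series) (n : nat) (a b : series) : span G n a -> span G n b -> span G n (sadd a b).
Proof.
intros [c Hc] [d Hd]. exists (fun k => c k + d k)%Z. by rewrite slin_add !red_sadd Hc Hd.
Qed.

Lemma span_scal (G : nat -> series) (n : nat) (e : Z) (a : series) : span G n a -> span G n (smul (sC e) a).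
Proof. intros [c Hc]. exists (fun k => e * c k)%Z. by rewrite slin_scal !red_smul Hc. Qed.

(** A congruence a = b + 2 d is respected by every additive L that commutes with constants, so it
    suffices to treat the generators. *)
Lemma span_map (L : series -> series) (G H : nat -> series) (n m : nat) (a : series) :
  L s0 = s0 -> (forall x y, L (sadd x y) = sadd (L x) (L y)) ->
  (forall e x, L (smul (sC e) x) = smul (sC e) (L x)) ->
  (forall i, (i < n)%nat -> span H m (L (G i))) -> span G n a -> span H m (L a).
Proof.
intros L0 LD LZ HG [c Hc]. destruct (red_elim _ _ Hc) as [d ->].
apply (span_red _ _ _ (L (slin c G n))).
{ apply (red_intro _ _ (L d)). by rewrite LD LZ. }
clear Hc. elim: n HG => [|n IH] HG /=.
- rewrite L0. apply span_0.
- rewrite LD LZ. apply span_add; [apply IH; auto | apply span_scal; auto].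
Qed.

Lemma span_mul (u : series) (G H : nat -> series) (n m : nat) (a : series) :
  (forall i, (i < n)%nat -> span H m (smul u (G i))) -> span G n a -> span H m (smul u a).
Proof. apply (span_map (smul u)); intros; ring. Qed.

Lemma span_trans (G H : nat -> series) (n m : nat) (a : series) :
  (forall i, (i < n)%nat -> span H m (G i)) -> span G n a -> span H m a.
Proof. by apply (span_map (fun x => x)). Qed.

Lemma sD_scal (e : Z) (a : series) : sD (smul (sC e) a) = smul (sC e) (sD a).
Proof. apply functional_extensionality => n. rewrite /sD !sC_mul. lia. Qed.

Lemma span_sD (G H : nat -> series) (n m : nat) (a : series) :
  (forall i, (i < n)%nat -> span H m (sD (G i))) -> span G n a -> span H m (sD a).
Proof.
apply (span_map sD).
- apply functional_extensionality => n'. rewrite /sD /s0. lia.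
- apply sD_sadd.
- apply sD_scal.
Qed.

Lemma in_span_iff (G : nat -> series) (n : nat) (f : ps2) :
  in_span (map (fun i => red (G i)) (seq 0 n)) f <-> exists a, f = red a /\ span G n a.
Proof.
elim: n G f => [|n IH] G f.
- split.
  + intros H. exists s0. split; last apply span_0. by apply functional_extensionality.
  + intros (a & -> & [c Hc]) k. by rewrite Hc.
- change (seq 0 (S n)) with (0%nat :: seq 1 n). cbn [map in_span]. rewrite -seq_shift map_map.
  rewrite !(IH (fun i => G (S i))). 
  have Hlift : forall a, span (fun i => G (S i)) n a -> span G (S n) a.
  { intros a. apply span_trans => i Hi. apply (span_gen G (S n) (S i)). lia. }
  split.
  + intros [(a & -> & Ha)|(a & E & Ha)].
    * exists a. split; auto.
    * exists (sadd a (G 0%nat)). split.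
      -- rewrite red_sadd -E. apply functional_extensionality => k. rewrite /ps2_add.
         by destruct (f k), (red (G 0%nat) k).
      -- apply span_add; [auto | apply span_gen; lia].
  + intros (a & -> & [c Hc]). rewrite slin_succ_l red_sadd in Hc.
    set t := slin (fun k => c (S k)) (fun k => G (S k)) n in Hc.
    have Ht : span (fun i => G (S i)) n t by exists (fun k => c (S k)).
    destruct (Z.odd (c 0%nat)) eqn:Ec.
    * right. exists t. split; last exact Ht. rewrite Hc. apply functional_extensionality => k.
      rewrite /ps2_add /red sC_mul Z.odd_mul Ec /=. by destruct (Z.odd (G 0%nat k)), (Z.odd (t k)).
    * left. exists t. split; last exact Ht. rewrite Hc. apply functional_extensionality => k.
      by rewrite /ps2_add /red sC_mul Z.odd_mul Ec.
Qed.

Lemma red_sP : red sP = red (sadd s1 sQ).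
Proof.
destruct (red_elim _ _ red_PQ) as [c Hc]. apply (red_intro _ _ (ssub c sQ)).
have -> : sP = ssub (sadd sP sQ) sQ by ring. rewrite Hc.
have -> : sC 2 = sadd s1 s1 by apply functional_extensionality => [[|k]]. ring.
Qed.

(** Mod 2, P = 1 + Q, so P^a Q^b is a polynomial in Q of degree a + b. *)
Lemma span_pow_mono (a b : nat) : span (spow sQ) (S (a + b)) (mono a b).
Proof.
elim: a => [|a IH].
- have -> : mono 0 b = spow sQ b by rewrite /mono /=; ring. apply span_gen. lia.
- apply (span_red _ _ _ (sadd (mono a b) (smul sQ (mono a b)))).
  + have -> : mono (S a) b = smul sP (mono a b) by rewrite /mono /=; ring.
    rewrite red_smul red_sP -red_smul. f_equal. ring.
  + apply span_add.
    * apply (span_trans (spow sQ) _ (S (a + b))) => // i Hi. apply span_gen. lia.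
    * apply (span_mul sQ (spow sQ) _ (S (a + b))) => // i Hi.
      change (smul sQ (spow sQ i)) with (spow sQ (S i)). apply span_gen. lia.
Qed.

(** Homogenization: Q^i is multiplied by (P + Q)^e, which is 1 mod 2, and the product is
    expanded. *)
Lemma span_mono_pow (e i : nat) : span (fun j => mono (e + i - j) j) (S (e + i)) (spow sQ i).
Proof.
apply (span_red _ _ _ (smul (spow (sadd sP sQ) e) (spow sQ i))).
{ rewrite red_smul (red_spow (sadd sP sQ)) red_PQ -red_spow -red_smul spow_s1. f_equal. ring. }
elim: e => [|e IH].
- have -> : smul (spow (sadd sP sQ) 0) (spow sQ i) = mono (0 + i - i) i.
  { by rewrite Nat.add_0_l Nat.sub_diag. }
  apply (span_gen (fun j => mono (0 + i - j) j)). lia.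
- set a := smul (spow (sadd sP sQ) e) (spow sQ i) in IH *.
  have -> : smul (spow (sadd sP sQ) (S e)) (spow sQ i) = sadd (smul sP a) (smul sQ a) by rewrite /a /=; ring.
  apply span_add.
  + apply: span_mul IH => j Hj.
    have -> : smul sP (mono (e + i - j) j) = mono (S e + i - j) j.
    { have -> : (S e + i - j = S (e + i - j))%nat by lia. rewrite /mono /=. ring. }
    apply (span_gen (fun j => mono (S e + i - j) j)). lia.
  + apply: span_mul IH => j Hj.
    have -> : smul sQ (mono (e + i - j) j) = mono (S e + i - S j) (S j).
    { have -> : (S e + i - S j = e + i - j)%nat by lia. rewrite /mono /=. ring. }
    apply (span_gen (fun j => mono (S e + i - j) j)). lia.
Qed.

(** Homogenizing in degree 2m lifts the combination of powers of Q to an integral form. Its Hecke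
    image is again an integral combination of the P^(2m-j) Q^j, which is turned back into powers of
    Q. *)
Theorem span_pow_hecke (p m : nat) (a : series) : prime (Z.of_nat p) -> p <> 5%nat -> Nat.odd p = true ->
  span (spow sQ) (S (2 * m)) a -> exists b, Tp p (red a) = red b /\ span (spow sQ) (S (2 * m)) b.
Proof.
intros Hp Hp5 Hodd Ha.
have [c Hc] : span (basis m) (S (2 * m)) a.
{ apply: span_trans Ha => i Hi. have H := span_mono_pow (2 * m - i) i.
  replace (2 * m - i + i)%nat with (2 * m)%nat in H by lia. exact H. }
destruct (is_form_slin m c (S (2 * m)) (Nat.le_refl _)) as [d Hd].
have Hh := is_form_hecke p m _ _ Hp Hp5 Hd.
destruct (form_decomposition _ _ _ Hh) as [e He].
exists (slin e (basis m) (S (2 * m))). split; first by rewrite Hc -He red_hecke.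
apply (span_trans (basis m) _ (S (2 * m))); last by exists e.
intros i Hi. have H := span_pow_mono (2 * m - i) i.
replace (2 * m - i + i)%nat with (2 * m)%nat in H by lia. exact H.
Qed.

Definition odd_basis (i : nat) : series := smul (spow sQ (2 * i)) (sadd (spow sQ 2) sQ).

(** Squares are constants for x d/dx mod 2. *)
Lemma red_sD_square (a b : series) : red (sD (smul (smul a a) b)) = red (smul (smul a a) (sD b)).
Proof.
apply (red_intro _ _ (smul (smul a (sD a)) b)). rewrite !sD_smul.
have -> : sC 2 = sadd s1 s1 by apply functional_extensionality => [[|k]]. ring.
Qed.

Lemma red_sD_sQ : red (sD sQ) = red (sadd (spow sQ 2) sQ).
Proof.
have -> : red (sadd (spow sQ 2) sQ) = red (smul sQ (sadd s1 (sadd ssig (dilate 5 ssig)))).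
{ have -> : sadd (spow sQ 2) sQ = smul sQ (sadd s1 sQ) by simpl; ring.
  by rewrite !red_smul !(red_sadd s1) red_sQ. }
(* The factor of Q in DQ is 1 + u - 25 v, where u and v are the series of sigma and its dilation by
   5; it differs from 1 + u + v by 2 (-13) v. *)
rewrite sD_sQ !red_smul. f_equal. apply (red_intro _ _ (smul (sC (-13)) (dilate 5 ssig))).
have -> : smul (sC 5) (sC 5) = sC 25 by apply functional_extensionality => n; rewrite sC_mul; destruct n.
apply functional_extensionality => n. rewrite /ssub /sadd /sopp !sC_mul. lia.
Qed.

(* The operator D kills the even powers of Q mod 2 and maps Q^(2i+1) to Q^(2i) (Q^2 + Q). *)
Lemma span_odd_basis (m : nat) (a : series) : span (spow sQ) (S (2 * m)) a -> span odd_basis m (sD a).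
Proof.
apply span_sD => i Hi. destruct (Nat.Even_or_Odd i) as [[j Hj]|[j Hj]].
- apply (span_red _ _ _ s0); last apply span_0.
  have -> : spow sQ i = smul (smul (spow sQ j) (spow sQ j)) s1.
  { rewrite Hj /= Nat.add_0_r spow_add. ring. }
  rewrite red_sD_square sD_s1. f_equal. ring.
- apply (span_red _ _ _ (odd_basis j)); last by apply span_gen; lia.
  have -> : spow sQ i = smul (smul (spow sQ j) (spow sQ j)) sQ.
  { rewrite Hj Nat.add_1_r /= Nat.add_0_r spow_add. ring. }
  rewrite red_sD_square red_smul red_sD_sQ -red_smul /odd_basis. do 2 f_equal.
  by rewrite /= Nat.add_0_r spow_add.
Qed.

Lemma odd_basis_span_pow (m : nat) (a : series) : span odd_basis m a -> span (spow sQ) (S (2 * m)) a.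
Proof.
apply span_trans => i Hi.
have -> : odd_basis i = sadd (spow sQ (S (S (2 * i)))) (spow sQ (S (2 * i))) by rewrite /odd_basis /=; ring.
apply span_add; apply span_gen; lia.
Qed.

(** Mod 2 the operator x d/dx fixes Q^2 + Q and treats Q^(2i) as a constant, so it fixes the span;
    and it annihilates the even exponents. *)
Lemma odd_basis_support (m : nat) (a : series) : span odd_basis m a ->
  forall n, Nat.even n = true -> red a n = false.
Proof.
intros H. have E : red a = red (sD a).
{ have [c Hc] := H. rewrite Hc. destruct (red_elim _ _ Hc) as [d Hd].
  have -> : red (sD a) = red (sD (slin c odd_basis m)).
  { apply (red_intro _ _ (sD d)). by rewrite Hd sD_sadd sD_scal. }
  clear. elim: m => [|m IH] /=.
  - f_equal. apply functional_extensionality => n. rewrite /sD /s0. lia.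
  - rewrite sD_sadd sD_scal (red_sadd (slin _ _ _)) (red_sadd (sD _)) -IH !(red_smul (sC _)). do 2 f_equal.
    have -> : odd_basis m = smul (smul (spow sQ m) (spow sQ m)) (sadd (spow sQ 2) sQ).
    { by rewrite /odd_basis /= Nat.add_0_r spow_add. }
    rewrite red_sD_square !(red_smul (smul _ _)). f_equal. rewrite sD_sadd (red_sadd (sD _)) red_sD_sQ.
    have -> : spow sQ 2 = smul (smul sQ sQ) s1 by simpl; ring.
    rewrite red_sD_square sD_s1. have -> : smul (smul sQ sQ) s0 = s0 by ring.
    rewrite -red_sadd. by have -> : sadd s0 (sadd (smul (smul sQ sQ) s1) sQ) = sadd (smul (smul sQ sQ) s1) sQ by ring. }
intros n Hn. rewrite E /red /sD Z.odd_mul. apply Nat.even_spec in Hn. destruct Hn as [h Hh].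
have -> : Z.odd (Z.of_nat n) = false; last by [].
rewrite Hh Nat2Z.inj_mul Z.odd_mul. reflexivity.
Qed.

(** A series with odd exponents only equals its image under x d/dx mod 2, and that image lies in the
    smaller span. *)
Lemma support_odd_basis (m : nat) (a : series) : span (spow sQ) (S (2 * m)) a ->
  (forall n, Nat.even n = true -> red a n = false) -> span odd_basis m a.
Proof.
intros H Hs. apply (span_red _ _ _ (sD a)); last by apply span_odd_basis.
apply functional_extensionality => n. rewrite /red /sD Z.odd_mul.
destruct (Nat.Even_or_Odd n) as [[h Hh]|[h Hh]].
- have E := Hs n ltac:(apply Nat.even_spec; exists h; auto). rewrite /red in E. rewrite E. rewrite Hh Nat2Z.inj_mul Z.odd_mul. reflexivity.
- have -> : Z.odd (Z.of_nat n) = true; last by []. apply Z.odd_spec. exists (Z.of_nat h). lia.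
Qed.

Close Scope C_scope.

Theorem theorem1p14 (p : nat) :
  prime (Z.of_nat p) -> p <> 2%nat -> p <> 5%nat ->
  (forall f, M f -> M (Tp p f)) /\
  (forall f, Modd f -> Modd (Tp p f)) /\
  (forall m : nat,
     stabilizes (Tp p) (map (fun i => ps2_pow r i) (seq 0 (2 * m + 1))) /\
     stabilizes (Tp p)
       (map (fun i => ps2_mul (ps2_pow r (2 * i)) (ps2_add (ps2_pow r 2) r)) (seq 0 m))).
Proof.
intros Hp Hp2 Hp5.
have Hodd : Nat.odd p = true.
{ apply Nat.odd_spec. destruct (Nat.Even_or_Odd p) as [[h Hh]|H]; last exact H.
  exfalso. destruct (prime_divisors _ Hp 2) as [E|[E|[E|E]]]; try lia. exists (Z.of_nat h). lia. }
have HM : forall f, M f -> M (Tp p f).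
{ intros f (m & a & Ha & Hf). exists m, (hecke_series p (4 * m) a). split; first by apply modform_hecke.
  have -> : f = red a by apply functional_extensionality.
  intros n. by rewrite -(red_hecke p (4 * m)). }
split; [exact HM | split].
- intros f [Hf Hs]. split; [by apply HM | by apply Tp_odd_support].
- intros m. 
  have -> : map (fun i => ps2_pow r i) (seq 0 (2 * m + 1)) = map (fun i => red (spow sQ i)) (seq 0 (S (2 * m))).
  { rewrite Nat.add_1_r. apply map_ext => i. by rewrite red_spow red_sQ_r. }
  have -> : map (fun i => ps2_mul (ps2_pow r (2 * i)) (ps2_add (ps2_pow r 2) r)) (seq 0 m) =
    map (fun i => red (odd_basis i)) (seq 0 m).
  { apply map_ext => i. by rewrite /odd_basis red_smul red_sadd !red_spow red_sQ_r. }
  have stable : forall a, span (spow sQ) (S (2 * m)) a ->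
    exists b, Tp p (red a) = red b /\ span (spow sQ) (S (2 * m)) b by intros a; apply span_pow_hecke.
  split; intros f Hf; apply in_span_iff in Hf; destruct Hf as (a & -> & Ha); apply in_span_iff.
  + by apply stable.
  (* T_p preserves odd support and the span of the r^i, i <= 2m; within this span, odd support
     characterizes the smaller span. *)
  + destruct (stable a (odd_basis_span_pow m a Ha)) as (b & Eb & Hb).
    exists b. split; auto. apply support_odd_basis; auto.
    rewrite -Eb. apply Tp_odd_support; auto. exact (odd_basis_support m a Ha).
Qed.
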